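(* Let $n\ge 3$ be an odd integer. A function $g\in C_c^\infty(\mathbb{S}^{n-1}\times(0,2))$ satisfies $Pg=0$ on $\mathbb{B}$ if and only if $g$ belongs to the range of $D^{n-2}t^{n-2}\mathcal{M}$, i.e. if and only if there exists $f\in C_c^\infty(\mathbb{B})$ such that $g(\theta,t)=D^{n-2}\big(t^{n-2}\mathcal{M}f(\theta,t)\big)$ for all $(\theta,t)\in\mathbb{S}^{n-1}\times(0,2)$.
   Context: $\mathbb{B}$ is the open unit ball in $\mathbb{R}^n$, $\mathbb{S}^{n-1}$ is the unit sphere, $dS$ is its surface measure, and $\omega_n$ is its total surface area. The spherical mean transform $\mathcal{M}:C_c^\infty(\mathbb{B})\to C_c^\infty(\mathbb{S}^{n-1}\times(0,2))$ is $$\mathcal{M}f(p,t)=\frac1{\omega_n}\int_{\mathbb{S}^{n-1}}f(p+t\theta)\,dS(\theta),$$ with $f$ extended by zero outside $\mathbb{B}$. The backprojection operator is $$(PF)(x)=\frac1{\omega_n}\int_{\mathbb{S}^{n-1}}F(\theta,|x-\theta|)\,dS(\theta),\qquad x\in\mathbb{B}.$$ $D=\frac1t\frac{d}{dt}$ acts in the variable $t$, and $D^{n-2}t^{n-2}$ means multiplication by $t^{n-2}$ followed by $D^{n-2}$. *)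

(* Defs.v *)
From HB Require Import structures.
From mathcomp Require Import all_boot all_order all_algebra.
From mathcomp Require Import all_classical all_reals all_analysis.
From mathcomp Require Import measurable_realfun.
Set Implicit Arguments.
Unset Strict Implicit.
Unset Printing Implicit Defensive.
Import Order.TTheory GRing.Theory Num.Theory.
Import numFieldNormedType.Exports.
Local Open Scope classical_set_scope.
Local Open Scope ring_scope.

(* The library's norm `|x| on 'rV[R]_n is the sup norm. *)
Definition enorm (R : realType) (n : nat) (x : 'rV[R]_n) : R :=
  Num.sqrt (\sum_(i < n) x ord0 i ^+ 2).

Definition eball (R : realType) (n : nat) : set 'rV[R]_n :=
  [set x | enorm x < 1].

Definition esphere (R : realType) (n : nat) : set 'rV[R]_n :=
  [set x | enorm x = 1].

Arguments eball : clear implicits.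
Arguments esphere : clear implicits.

Section smooth.
Context {R : realType} {V : normedModType R}.

(* Class C^k on U, meant for U open and V finite-dimensional: all the
   directional derivatives up to order k exist and are continuous. *)
Fixpoint Ck_open (k : nat) (U : set V) (f : V -> R) : Prop :=
  match k with
  | 0%N => forall x, U x -> {for x, continuous f}
  | k'.+1 => (forall x, U x -> differentiable f x) /\
             (forall v : V, Ck_open k' U (fun x => 'D_v f x))
  end.

Definition smooth_open (U : set V) (f : V -> R) : Prop :=
  forall k, Ck_open k U f.

(* Smoothness on an arbitrary subset X: near every point of X, f agrees on X
   with a smooth function on an open subset of V. For X open this is
   smoothness on X, and for X an embedded submanifold it is smoothness in the
   sense of manifolds. The values of f outside X are irrelevant. *)
Definition smooth_on (X : set V) (f : V -> R) : Prop :=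
  forall x, X x -> exists (U : set V) (h : V -> R),
    [/\ open U, U x, smooth_open U h & forall y, X y -> U y -> f y = h y].

Definition Cc_smooth (X : set V) (f : V -> R) : Prop :=
  smooth_on X f /\
  exists K : set V,
    [/\ compact K, K `<=` X & forall x, X x -> ~ K x -> f x = 0].

End smooth.

(* 'rV[R]_n gets the sigma-algebra generated by the coordinates, i.e. the
   Borel sigma-algebra. *)
Definition rV_display : measure_display.
Proof. exact: default_measure_display. Qed.

Section measurable_rV.
Context {R : realType} {n : nat}.

Let coor : 'I_n -> 'rV[R]_n -> measurableTypeR R := fun i x => x ord0 i.

Let rV_set0 : g_sigma_preimage coor set0.
Proof. exact: sigma_algebra0. Qed.

Let rV_setC A : g_sigma_preimage coor A -> g_sigma_preimage coor (~` A).
Proof. exact: sigma_algebraC. Qed.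

Let rV_bigcup (F : (set 'rV[R]_n)^nat) :
  (forall i, g_sigma_preimage coor (F i)) ->
  g_sigma_preimage coor (\bigcup_i (F i)).
Proof. exact: sigma_algebra_bigcup. Qed.

HB.instance Definition _ := @isMeasurable.Build rV_display
  'rV[R]_n (g_sigma_preimage coor) rV_set0 rV_setC rV_bigcup.

Lemma measurable_coor (i : 'I_n) :
  measurable_fun [set: 'rV[R]_n] (fun x => x ord0 i : measurableTypeR R).
Proof.
move=> _ Y mY; rewrite setTI; apply: sub_sigma_algebra => /=.
rewrite -bigcup_seq/=; exists i => /=; first by rewrite mem_index_enum.
by exists Y => //; rewrite setTI.
Qed.

Lemma measurable_to_rV d (T : measurableType d) (f : T -> 'rV[R]_n) :
  (forall i, measurable_fun [set: T]
     (fun x => f x ord0 i : measurableTypeR R)) ->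
  measurable_fun [set: T] f.
Proof.
move=> mf.
suff : g_sigma_preimage (fun i => coor i \o f) `<=` measurable.
  rewrite g_sigma_preimage_comp => h _ A mA; apply: h; by exists A.
apply: smallest_sub; first exact: sigma_algebra_measurable.
rewrite -bigcup_seq/=; apply: bigcup_sub => i _ A [B mB <-].
exact: mf.
Qed.

Lemma measurable_enorm :
  measurable_fun [set: 'rV[R]_n] (fun x => enorm x : measurableTypeR R).
Proof.
have h : measurable_fun setT (fun x : 'rV[R]_n => \sum_(i < n) x ord0 i ^+ 2).
  apply: measurable_sum => i.
  by apply: measurable_funX; exact: measurable_coor.
apply: (measurableT_comp _ h); apply: continuous_measurable_fun.
exact: sqrt_continuous.
Qed.

End measurable_rV.

(* Lebesgue measure on R^n, by recursion: R^(n+1) = R x R^n. *)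
Section lebesgue_rV.
Context {R : realType}.

Definition rV_cons (n : nat) (z : measurableTypeR R * 'rV[R]_n) : 'rV[R]_n.+1 :=
  row_mx (z.1%:M : 'rV[R]_1) z.2.

Let rV_uncons (n : nat) (v : 'rV[R]_n.+1) : measurableTypeR R * 'rV[R]_n :=
  ((v : 'rV[R]_(1 + n)) ord0 (lshift n ord0), rsubmx (v : 'rV[R]_(1 + n))).

Let rV_consK n : cancel (@rV_cons n) (@rV_uncons n).
Proof.
by move=> [x v]; rewrite /rV_cons /rV_uncons row_mxKr row_mxEl mxE mulr1n.
Qed.

Let measurable_rV_uncons n : measurable_fun setT (@rV_uncons n).
Proof.
apply/measurable_fun_pairP; split; first exact: measurable_coor.
apply: measurable_to_rV => i.
rewrite (_ : (fun _ => _) =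
  (fun v : 'rV[R]_(1 + n) => v ord0 (rshift 1 i) : measurableTypeR R)).
  exact: measurable_coor.
by apply/funext => v /=; rewrite mxE.
Qed.

Lemma measurable_rV_cons n : measurable_fun setT (@rV_cons n).
Proof.
apply: measurable_to_rV => i; rewrite /rV_cons.
case: (@split_ordP 1 n i) => j ->.
- rewrite (_ : (fun _ => _) = fst)//; apply/funext => z.
  apply: (etrans (row_mxEl (z.1%:M : 'rV[R]_1) z.2 ord0 j)).
  by rewrite mxE (ord1 j) mulr1n.
- rewrite (_ : (fun _ => _) =
    (fun v : 'rV[R]_n => v ord0 j : measurableTypeR R) \o snd).
    by apply: measurableT_comp => //; exact: measurable_coor.
  apply/funext => z; exact: (row_mxEr (z.1%:M : 'rV[R]_1) z.2 ord0 j).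
Qed.

Section cons.
Context {n : nat} (m : {sigma_finite_measure set 'rV[R]_n -> \bar R}).

Definition lebesgue_cons : set 'rV[R]_n.+1 -> \bar R :=
  pushforward ((@lebesgue_measure R) \x m)%E (@rV_cons n).

Let mu : {measure set 'rV[R]_n.+1 -> \bar R} :=
  measure_function_pushforward__canonical__measure_function_Measure
    ((@lebesgue_measure R) \x m)%E (@measurable_rV_cons n).

Let lebesgue_cons0 : lebesgue_cons set0 = 0%E.
Proof. exact: (measure0 mu). Qed.

Let lebesgue_cons_ge0 A : (0 <= lebesgue_cons A)%E.
Proof. exact: (measure_ge0 mu). Qed.

Let lebesgue_cons_sigma_additive : semi_sigma_additive lebesgue_cons.
Proof. exact: (@measure_semi_sigma_additive _ _ _ mu). Qed.

HB.instance Definition _ := isMeasure.Build _ _ _ lebesgue_cons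
  lebesgue_cons0 lebesgue_cons_ge0 lebesgue_cons_sigma_additive.

Let lebesgue_cons_sigma_finite : sigma_finite setT lebesgue_cons.
Proof.
have /sigma_finiteP[F [TF ndF Foo]] := sigma_finiteT (@lebesgue_measure R).
have /sigma_finiteP[G [TG ndG Goo]] := sigma_finiteT m.
exists (fun k => @rV_uncons n @^-1` (F k `*` G k)).
  rewrite -preimage_bigcup (_ : \bigcup_k _ = setT) ?preimage_setT//.
  apply/seteqP; split => // -[x y] _.
  have [i _ Fx] : (\bigcup_k F k) x by rewrite -TF.
  have [j _ Gy] : (\bigcup_k G k) y by rewrite -TG.
  exists (maxn i j) => //; split.
  - by move: x Fx; exact/subsetPset/ndF/leq_maxl.
  - by move: y Gy; exact/subsetPset/ndG/leq_maxr.
move=> k; have [mF Fk] := Foo k; have [mG Gk] := Goo k.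
split.
  rewrite -[X in measurable X]setTI; apply: measurable_rV_uncons => //.
  exact: measurableX.
rewrite /lebesgue_cons /pushforward -comp_preimage.
rewrite (_ : _ \o _ = id); last by apply/funext => z /=; exact: rV_consK.
by rewrite preimage_id product_measure1E// lte_mul_pinfty// ge0_fin_numE.
Qed.

HB.instance Definition _ := Measure_isSigmaFinite.Build _ _ _ lebesgue_cons
  lebesgue_cons_sigma_finite.

End cons.

Fixpoint lebesgue_rV (n : nat) : {sigma_finite_measure set 'rV[R]_n -> \bar R} :=
  match n with
  | 0%N => dirac (0 : 'rV[R]_0)
  | n'.+1 => lebesgue_cons (lebesgue_rV n')
  end.

End lebesgue_rV.

(* Surface measure of the unit sphere of R^n, as in polar coordinates: n times
   the volume of the cone {r theta | 0 < r <= 1, theta in A} over A. It is a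
   measure on R^n carried by the sphere. *)
Section sphere_measure.
Context {R : realType}.

Definition sphere_measure (n : nat) (A : set 'rV[R]_n) : \bar R :=
  (n%:R%:E * lebesgue_rV n
    [set x | A ((enorm x)^-1 *: x) /\ (0 < enorm x <= 1)%R])%E.

Section measure.
Context {n : nat}.

Let pball : set 'rV[R]_n := [set x | 0 < enorm x <= 1].

Let measurable_pball : measurable pball.
Proof.
have -> : pball = (fun x => enorm x : measurableTypeR R) @^-1` `]0, 1].
  by apply/seteqP; split => x /=; rewrite in_itv.
by rewrite -[X in measurable X]setTI; apply: measurable_enorm.
Qed.

Let measurable_normalize :
  measurable_fun [set: 'rV[R]_n] (fun x : 'rV[R]_n => (enorm x)^-1 *: x).
Proof.
apply: measurable_to_rV => i.
rewrite (_ : (fun _ => _) =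
  (fun x : 'rV[R]_n => (enorm x)^-1) \* (fun x => x ord0 i)); last first.
  by apply/funext => x; rewrite mxE.
apply: measurable_funM; last exact: measurable_coor.
apply: (measurableT_comp (f := fun r : measurableTypeR R => r^-1) _
  measurable_enorm).
rewrite (_ : setT = [set r : R | r != 0] `|` [set 0]); last first.
  by apply/seteqP; split => r // _; have [->|r0] := eqVneq r 0; [right|left].
apply/measurable_funU => //; first exact: open_measurable.
split; last exact: measurable_fun_set1.
apply: open_continuous_measurable_fun => //; apply/in_setP => x /= x0.
exact: inv_continuous.
Qed.

Let mu : {measure set 'rV[R]_n -> \bar R} :=
  mscale n%:R%:nng
    (measure_function_pushforward__canonical__measure_function_Measure
      (mrestr (lebesgue_rV n) measurable_pball) measurable_normalize).

Let sphere_measure0 : sphere_measure (set0 : set 'rV[R]_n) = 0%E.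
Proof. exact: (measure0 mu). Qed.

Let sphere_measure_ge0 (A : set 'rV[R]_n) : (0 <= sphere_measure A)%E.
Proof. exact: (measure_ge0 mu). Qed.

Let sphere_measure_sigma_additive :
  semi_sigma_additive (@sphere_measure n).
Proof. exact: (@measure_semi_sigma_additive _ _ _ mu). Qed.

HB.instance Definition _ := isMeasure.Build _ _ _ (@sphere_measure n)
  sphere_measure0 sphere_measure_ge0 sphere_measure_sigma_additive.

End measure.

Definition sphere_area (n : nat) : R := fine (sphere_measure (esphere R n)).

End sphere_measure.

Section operators.
Context {R : realType} {n : nat}.

Local Notation dS := (@sphere_measure R n).

Definition spherical_mean (f : 'rV[R]_n -> R) (p : 'rV[R]_n) (t : R) : R :=
  (sphere_area n)^-1 *
  \int[dS]_(theta in esphere R n) patch (fun=> 0) (eball R n) f (p + t *: theta).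

Definition backprojection (F : 'rV[R]_n * R -> R) (x : 'rV[R]_n) : R :=
  (sphere_area n)^-1 *
  \int[dS]_(theta in esphere R n) F (theta, enorm (x - theta)).

Definition cylinder : set ('rV[R]_n * R) := esphere R n `*` `]0, 2[.

End operators.

Arguments cylinder : clear implicits.

Definition Dt (R : realType) (h : R -> R) (t : R) : R := t^-1 * derive1 h t.

(* Main.v *)
(* Write n = 2m+3, N = n-2, and for a family G_j(theta, s) with G_(j+1) the
   s-derivative of G_j let F_j(x) be the mean over the sphere of
   G_j(theta, |x - theta|^2). With G_0(theta, t^2) = g(theta, t) the hypothesis
   P g = 0 reads F_0 = 0, and t^-1 d/dt is 2 d/ds.

   Uniqueness: differentiating F_0 = F_1 = 0 in x gives F_j = 0 for all j, and
   then the backprojections of (xi . theta)^l G_j vanish for j >= l. Averaging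
   them over the direction of x and descending in the exponent of the weight
   (1 - z^2)^m shows that every mean of (xi . theta)^l G_0(theta, s) is 0, hence
   G_0 = 0 on the sphere by density of polynomials.

   Range: for A_0(theta, t^2) = t^N M f(theta, t), pass to polar coordinates
   about x in a smoothed version of the mean of A_N(theta, |x - theta|^2). The
   weight (1 - z^2)^m has degree below N, so this mean is 0. With an extra
   factor theta it is a constant times the integral over r of the mean of
   f(x + r eta) eta, whose divergence is a multiple of f. The divergence of the
   mean itself is 2(|x|^2 - 1) times the mean of A_(N+1), which determines f.

   Conversely, if P g = 0, put f = const (1 - |x|^2) F_1. The zonal moments of
   F_0 near the sphere are polynomials in the radius and its inverse; their
   vanishing forces F_1 = 0 there, so f has compact support. The family of g
   minus that of f has F_0 = F_1 = 0 and vanishes by uniqueness. *)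
From HB Require Import structures.
Require Import Defs.
From mathcomp Require Import all_boot all_order all_algebra.
From mathcomp Require Import all_classical all_reals all_analysis.
From mathcomp Require Import measurable_realfun ring lra zify.
Import Order.TTheory GRing.Theory Num.Theory.
Import numFieldNormedType.Exports.
Local Open Scope classical_set_scope.
Local Open Scope ring_scope.
Set Implicit Arguments.
Unset Strict Implicit.
Unset Printing Implicit Defensive.

(** * Lebesgue measure and spherical means *)

(** Oddness of n enters through the density (1 - z^2)^m, m = (n-3)/2, of w . theta under the mean
    over the sphere: the weight is a polynomial. So the descent reaches exponent 0 in m steps, the
    moments near the sphere become polynomial identities in the radius, and a derivative of order N
    sees only one leading coefficient. The variable s = t^2 makes |x - theta|^2 affine in theta on
    the sphere, so an x-derivative only raises the index of the family and multiplies the weight by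
    a linear form. Rotation invariance of the surface measure is replaced by translation invariance
    of Lebesgue measure, read in polar coordinates about two centres ([polar_translate]): applied to
    a bump it gives the moment identities behind Funk-Hecke, applied to f it moves the centre from
    theta to x. The obstacle in the converse is that F_0 = 0 does not make F_1 vanish on the ball:
    F_1 is the datum that encodes f. It must vanish only near the sphere, where |x - theta|^2 sweeps
    the whole s-support of the family. *)

Section lebesgue_affine.
Context {R : realType}.

Definition affine1 (c p : R) : measurableTypeR R -> measurableTypeR R :=
  fun x => c * x + p.

Lemma measurable_affine1 c p : measurable_fun setT (affine1 c p).
Proof.
by apply: measurable_funD => //; apply: measurable_funM.
Qed.

(** Lebesgue measure is determined by its values on half-open intervals; the pushforward under
    [affine1 c p], scaled by c, has the right ones. *)
Lemma lebesgue_affine1 (c p : R) (A : set (measurableTypeR R)) :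
  0 < c -> measurable A ->
  (c%:E * (@lebesgue_measure R) (affine1 c p @^-1` A) =
   (@lebesgue_measure R) A)%E.
Proof.
move=> c0 mA.
pose mu : {measure set (measurableTypeR R) -> \bar R} :=
  mscale (NngNum (ltW c0))
    (measure_function_pushforward__canonical__measure_function_Measure
      (@lebesgue_measure R) (@measurable_affine1 c p)).
apply/esym; apply: (@lebesgue_measure_unique R mu) => // X /ocitvP[->|[[a b]]].
  by rewrite !measure0.
move=> /= ab ->; rewrite /= /mscale /pushforward /=.
pose I : set (measurableTypeR R) := [set` `](a - p) / c, (b - p) / c]].
transitivity (c%:E * (@lebesgue_measure R) I)%E; last first.
  congr (_ * lebesgue_measure _)%E.
  apply/seteqP; split => x; rewrite /I /= !in_itv /= /affine1;
    by rewrite ltr_pdivrMr // ler_pdivlMr // mulrC ltrBlDr lerBrDr.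
rewrite /I !lebesgue_measure_itv /= !lte_fin ltr_pM2r ?invr_gt0 // ltrD2r.
case: ifP => _; last by rewrite mule0.
rewrite -!EFinB -EFinM; congr EFin; field; exact: lt0r_neq0.
Qed.

Lemma integral_affine1 (c p : R) (h : measurableTypeR R -> \bar R) :
  0 < c -> measurable_fun setT h -> (forall x, 0 <= h x)%E ->
  (c%:E * \int[lebesgue_measure]_x h (affine1 c p x) =
   \int[lebesgue_measure]_x h x)%E.
Proof.
move=> c0 mh h0.
pose mu : {measure set (measurableTypeR R) -> \bar R} :=
  measure_function_pushforward__canonical__measure_function_Measure
      (@lebesgue_measure R) (@measurable_affine1 c p).
transitivity (c%:E * \int[mu]_x h x)%E.
  congr (_ * _)%E; apply/esym.
  by rewrite (ge0_integral_pushforward (measurable_affine1 c p) lebesgue_measure measurableT mh).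
rewrite -(ge0_integral_mscale mu measurableT (NngNum (ltW c0)) mh) //.
by apply: eq_measure_integral => B mB _; exact: lebesgue_affine1.
Qed.

End lebesgue_affine.

(** * Borel sets and dilations in R^n *)

Section lebesgue_rV.
Context {R : realType}.
Local Notation leb n := (@lebesgue_rV R n).

(** The sigma-algebra is given only by coordinate preimages. Sup-norm balls are finite intersections
    of these, and an open set is a countable union of balls with rational centre and radius
    1/(k+1). *)
Lemma open_measurable_rV (n : nat) (U : set 'rV[R]_n) : open U -> measurable U.
Proof.
move=> oU.
pose B (i : 'rV[rat]_n * nat) : set 'rV[R]_n :=
  ball (map_mx ratr i.1 : 'rV[R]_n) i.2.+1%:R^-1.
have mB i : measurable (B i).
  have -> : B i = \big[setI/setT]_(j < n)
      ((fun x : 'rV[R]_n => x ord0 j : measurableTypeR R) @^-1`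
        ball (ratr (i.1 ord0 j) : R) i.2.+1%:R^-1).
    rewrite -bigcap_seq; apply/seteqP; split => x.
    - by move=> [_ bx] j _ /=; have := bx ord0 j; rewrite mxE.
    - move=> bx; split=> [|k j]; first by rewrite invr_gt0.
      by rewrite (ord1 k) mxE; apply: bx => /=; exact: mem_index_enum.
  apply: bigsetI_measurable => j _; rewrite -[X in measurable X]setTI.
  by apply: measurable_coor => //; apply: measurable_ball.
have -> : U = \bigcup_i (if `[< B i `<=` U >] then B i else set0).
  apply/seteqP; split => x; last first.
    by move=> [i _]; case: ifPn => // /asboolP iU; exact: iU.
  move=> Ux; have /nbhs_ballP[e /= e0 eU] := oU x Ux.
  have [N Ne] : exists N : nat, N.+1%:R^-1 < e / 2.
    exists (Num.truncn (e / 2)^-1); rewrite invf_plt ?posrE ?divr_gt0 //.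
    exact: truncnS_gt.
  have N0 : (0 : R) < N.+1%:R^-1 by rewrite invr_gt0.
  have qx (j : 'I_n) : exists q : rat, `|x ord0 j - ratr q| < N.+1%:R^-1.
    have [q] : exists q, ratr q \in `](x ord0 j - N.+1%:R^-1), (x ord0 j + N.+1%:R^-1)[.
      by apply: rat_in_itvoo; rewrite ltrBlDr -addrA ltrDl addr_gt0.
    rewrite in_itv /= => /andP[q1 q2]; exists q; by rewrite distrC ltr_distl q1 q2.
  pose q := \row_j xget 0 [set q : rat | `|x ord0 j - ratr q| < N.+1%:R^-1].
  have qE j : `|x ord0 j - ratr (q ord0 j)| < N.+1%:R^-1.
    by rewrite mxE; case: xgetP => [q' _ //|/=]; have [q' q'P] := qx j => /(_ q').
  exists (q, N) => //; case: ifPn => [_|/asboolP[]].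
    by split=> // i j; rewrite (ord1 i) /ball /= mxE distrC.
  move=> y [_ By]; apply: eU; split=> // i j.
  have := By i j; rewrite (ord1 i) /ball /= !mxE -?/(q ord0 j) => h.
  have := qE j; rewrite mxE => h2.
  apply: le_lt_trans (ler_distD (ratr (q ord0 j)) _ _) _; rewrite mxE.
  by apply: lt_trans (ltrD h2 h) _; rewrite [ltRHS](splitr e) ltrD.
apply: (@countable_bigcupT_measurable rV_display 'rV[R]_n ('rV[rat]_n * nat)%type
  (fun i => if `[< B i `<=` U >] then B i else set0)) => [|i].
  exact: countableP.
by case: ifPn.
Qed.

Lemma continuous_measurable_rV (n : nat) (f : 'rV[R]_n -> R) :
  continuous f -> measurable_fun setT (f : _ -> measurableTypeR R).
Proof.
move=> cf; apply: (measurability _ (RGenOpens.measurableE R)).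
move=> _ [_ [a [b ->]]] <-; rewrite setTI; apply: open_measurable_rV.
by apply: open_comp => // x _; exact: cf.
Qed.

Definition affine_rV (n : nat) (c : R) (p : 'rV[R]_n) : 'rV[R]_n -> 'rV[R]_n :=
  fun x => c *: x + p.

Lemma measurable_affine_rV (n : nat) c (p : 'rV[R]_n) :
  measurable_fun setT (affine_rV c p).
Proof.
apply: measurable_to_rV => i; rewrite /affine_rV.
under eq_fun do rewrite !mxE.
apply: measurable_funD => //; apply: measurable_funM => //.
exact: measurable_coor.
Qed.

Lemma leb_cons (n : nat) (A : set 'rV[R]_n.+1) : measurable A ->
  leb n.+1 A =
    (\int[lebesgue_measure]_x leb n [set v | A (rV_cons (x, v))])%E.
Proof.
move=> mA; rewrite /= /lebesgue_cons /pushforward /product_measure1 /=.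
apply: eq_integral => x _ /=; congr (leb n _).
by apply/seteqP; split => v /=; rewrite /xsection /= inE.
Qed.

(** Induction on the dimension by slicing: each slice contributes c^n by the induction hypothesis,
    and the first coordinate one more factor c by [integral_affine1]. *)
Lemma leb_affine (n : nat) (c : R) (p : 'rV[R]_n) (A : set 'rV[R]_n) :
  0 < c -> measurable A ->
  ((c ^+ n)%:E * leb n (affine_rV c p @^-1` A) = leb n A)%E.
Proof.
move=> c0; elim: n p A => [|n IH] p A mA.
  rewrite expr0 mul1e; congr (leb 0 _).
  by apply/seteqP; split => x /=; rewrite (thinmx0 x) (thinmx0 (affine_rV _ _ _)).
have mT : measurable (affine_rV c p @^-1` A).
  by rewrite -[X in measurable X]setTI; exact: measurable_affine_rV.
rewrite leb_cons // leb_cons //.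
pose p0 := p ord0 ord0; pose p1 : 'rV[R]_n := rsubmx (p : 'rV_(1 + n)).
pose h x : \bar R := leb n [set v | A (rV_cons (x, v))].
have mA1 x : measurable [set v | A (rV_cons (x, v))].
  have -> : [set v | A (rV_cons (x, v))] = xsection (@rV_cons R n @^-1` A) x.
    by apply/seteqP; split => v /=; rewrite /xsection /= inE.
  apply: measurable_xsection; rewrite -[X in measurable X]setTI.
  exact: measurable_rV_cons.
have mh : measurable_fun setT h.
  have -> : h = leb n \o xsection (@rV_cons R n @^-1` A).
    apply/funext => x /=; congr (leb n _).
    by apply/seteqP; split => v /=; rewrite /xsection /= inE.
  apply: measurable_fun_xsection; rewrite -[X in measurable X]setTI.
  exact: measurable_rV_cons.
have E x : leb n [set v | (affine_rV c p @^-1` A) (rV_cons (x, v))] =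
    leb n (affine_rV c p1 @^-1` [set v | A (rV_cons (affine1 c p0 x, v))]).
  congr (leb n _); apply/funext => v /=; congr (A _).
  apply/rowP => i; rewrite /affine_rV /rV_cons !mxE.
  case: fintype.splitP => j ij; rewrite !mxE /=.
    rewrite (ord1 j) /affine1 /p0 !mulr1n; congr (_ + p _ _); apply/val_inj => //=.
    by rewrite ij (ord1 j).
  by congr (_ + p _ _); apply/val_inj.
under eq_integral do rewrite E.
have E2 x : ((c ^+ n)%:E * leb n (affine_rV c p1 @^-1` [set v | A (rV_cons (affine1 c p0 x, v))])
    = (h \o affine1 c p0) x)%E by rewrite IH.
have mhc : measurable_fun setT (h \o affine1 c p0).
  by apply: measurableT_comp => //; exact: measurable_affine1.
have cn0 : 0 < c ^+ n by rewrite exprn_gt0.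
have E3 x : leb n (affine_rV c p1 @^-1` [set v | A (rV_cons (affine1 c p0 x, v))]) =
   ((c ^+ n)^-1%:E * (h \o affine1 c p0) x)%E.
  by rewrite -E2 muleA -EFinM mulVf ?mul1e // lt0r_neq0.
under eq_integral do rewrite E3.
rewrite ge0_integralZl //=; last by rewrite lee_fin invr_ge0 ltW.
rewrite muleA -EFinM exprS mulfK ?lt0r_neq0 //.
by rewrite (integral_affine1 p0 (h := h)).
Qed.

Definition cube (n : nat) (M : R) : set 'rV[R]_n :=
  [set x | forall i, `|x ord0 i| <= M].

Lemma measurable_cube n M : measurable (@cube n M).
Proof.
have -> : @cube n M = \big[setI/setT]_(j < n)
      ((fun x : 'rV[R]_n => x ord0 j : measurableTypeR R) @^-1` `[- M, M]).
  rewrite -bigcap_seq; apply/seteqP; split => x /=.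
    by move=> h j _ /=; rewrite in_itv /= -ler_norml.
  move=> h j; have := h j; rewrite /= in_itv /= -ler_norml; apply.
  exact: mem_index_enum.
apply: bigsetI_measurable => j _; rewrite -[X in measurable X]setTI.
exact: measurable_coor.
Qed.

Lemma leb_cubeS (n : nat) (M : R) :
  leb n.+1 (@cube n.+1 M) =
  (leb n (@cube n M) * (@lebesgue_measure R) `[(- M)%R, M])%E.
Proof.
rewrite leb_cons; last exact: measurable_cube.
have -> : (\int[lebesgue_measure]_x leb n [set v | @cube n.+1 M (rV_cons (x, v))] =
    \int[lebesgue_measure]_(x in [set` `[(- M)%R, M]%R]) cst (leb n (@cube n M)) x)%E.
  rewrite [RHS]integral_mkcond; apply: eq_integral => x _.
  rewrite patchE; case: ifPn; rewrite ?inE ?notin_setE /= in_itv /= -ler_norml => xM.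
    congr (leb n _); apply/seteqP; split => v /=.
      move=> h i; have := h (lift ord0 i); rewrite /rV_cons mxE.
      case: fintype.splitP => [j|j] /= ij; first by rewrite (ord1 j) in ij.
      by congr (`|v _ _| <= _); apply/val_inj => /=; rewrite /bump /= in ij; case: ij.
    move=> h i; rewrite /rV_cons mxE.
    by case: fintype.splitP => j ij; rewrite ?mxE ?(ord1 j).
  suff -> : [set v | @cube n.+1 M (rV_cons (x, v))] = set0 by rewrite measure0.
  rewrite -subset0 => v /(_ ord0) /=.
  rewrite /rV_cons mxE; case: fintype.splitP => j //= _; rewrite mxE (ord1 j) mulr1n.
  exact: xM.
by rewrite integral_cst.
Qed.

Lemma leb_cube (n : nat) (M : R) : (leb n (@cube n M) < +oo)%E.
Proof.
elim: n => [|n IH]; first by rewrite /= diracE; case: (_ \in _); rewrite ltry.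
rewrite leb_cubeS lebesgue_measure_itv /=.
rewrite lte_mul_pinfty // ?measure_ge0 //.
  by rewrite ge0_fin_numE ?measure_ge0.
by case: ifP => _; rewrite ?ltry.
Qed.

Lemma leb_cube_gt0 (n : nat) (M : R) : 0 < M -> (0 < leb n (@cube n M))%E.
Proof.
move=> M0; elim: n => [|n IH].
  by rewrite /= diracE mem_set ?lte01 // => -[].
rewrite leb_cubeS lebesgue_measure_itv /= lte_fin gtrN // mule_gt0 //.
by rewrite opprK -EFinD lte_fin addr_gt0.
Qed.

Lemma measurable_eball (n : nat) (M : R) : measurable [set x : 'rV[R]_n | enorm x <= M].
Proof.
have -> : [set x : 'rV[R]_n | enorm x <= M] =
   (fun x => enorm x : measurableTypeR R) @^-1` `]-oo, M].
  by apply/seteqP; split => x; rewrite /= in_itv.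
by rewrite -[X in measurable X]setTI; exact: measurable_enorm.
Qed.

Lemma normr_le_enorm (n : nat) (x : 'rV[R]_n) i : `|x ord0 i| <= enorm x.
Proof.
rewrite /enorm -sqrtr_sqr ler_sqrt; last by apply: sumr_ge0 => j _; exact: sqr_ge0.
by rewrite (bigD1 i) //= lerDl; apply: sumr_ge0 => j _; exact: sqr_ge0.
Qed.

Lemma leb_ball (n : nat) (M : R) : (leb n [set x | (enorm x <= M)%R] < +oo)%E.
Proof.
apply: le_lt_trans (leb_cube n M); apply: le_measure; rewrite ?inE.
- exact: measurable_eball.
- exact: measurable_cube.
- by move=> x /= xM i; apply: le_trans xM; exact: normr_le_enorm.
Qed.

End lebesgue_rV.


Section continuity.
Context {R : realType} {T : topologicalType}.
Implicit Types f g : T -> R.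

Lemma cfD f g : continuous f -> continuous g -> continuous (fun x => f x + g x).
Proof. by move=> cf cg x; apply: cvgD; [exact: cf|exact: cg]. Qed.

Lemma cfN f : continuous f -> continuous (fun x => - f x).
Proof. by move=> cf x; apply: cvgN; exact: cf. Qed.

Lemma cfB f g : continuous f -> continuous g -> continuous (fun x => f x - g x).
Proof. by move=> cf cg; apply: cfD => //; exact: cfN. Qed.

Lemma cfM f g : continuous f -> continuous g -> continuous (fun x => f x * g x).
Proof. by move=> cf cg x; apply: cvgM; [exact: cf|exact: cg]. Qed.

Lemma cfX f k : continuous f -> continuous (fun x => f x ^+ k).
Proof.
move=> cf; elim: k => [|k IH]; first by move=> x; exact: cvg_cst.
by under eq_fun do rewrite exprS; exact: cfM.
Qed.

Lemma cfC (c : R) : continuous (fun _ : T => c).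
Proof. by move=> x; exact: cvg_cst. Qed.

Lemma cfV f : continuous f -> (forall x, f x != 0) -> continuous (fun x => (f x)^-1).
Proof. by move=> cf f0 x; apply: cvgV => //; exact: cf. Qed.

Lemma cf_norm f : continuous f -> continuous (fun x => `|f x|).
Proof. by move=> cf x; apply: cvg_norm; exact: cf. Qed.

Lemma cf_sum (I : Type) (r : seq I) (F : I -> T -> R) :
  (forall i, continuous (F i)) -> continuous (fun x => \sum_(i <- r) F i x).
Proof.
move=> cF; elim: r => [|i r IH].
  by under eq_fun do rewrite big_nil; exact: cfC.
by under eq_fun do rewrite big_cons; exact: cfD.
Qed.

Lemma cf_comp (U : topologicalType) (f : T -> U) (h : U -> R) :
  continuous f -> continuous h -> continuous (fun x => h (f x)).
Proof. by move=> cf ch x; apply: (continuous_comp (cf x) (ch (f x))). Qed.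

Lemma cf_max0 f : continuous f -> continuous (fun x => Num.max 0 (f x)).
Proof.
move=> cf; have -> : (fun x => Num.max 0 (f x)) = (fun x => (f x + `|f x|) * 2^-1).
  by apply/funext => x; case: (leP 0 (f x)) => h; [rewrite ger0_norm|rewrite ltr0_norm] => //; lra.
by apply: cfM; [apply: cfD => //; exact: cf_norm|exact: cfC].
Qed.

Lemma cf_sqrt f : continuous f -> continuous (fun x => Num.sqrt (f x)).
Proof. by move=> cf; apply: cf_comp => // y; exact: sqrt_continuous. Qed.

Lemma cf_pair (U W : topologicalType) (f : T -> U) (g : T -> W) :
  continuous f -> continuous g -> continuous (fun x => (f x, g x)).
Proof. by move=> cf cg x; apply: cvg_pair; [exact: cf|exact: cg]. Qed.

Lemma cf2 (U W : topologicalType) (u : U -> W -> R) (f : T -> U) (g : T -> W) :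
  continuous (fun z : U * W => u z.1 z.2) -> continuous f -> continuous g ->
  continuous (fun x => u (f x) (g x)).
Proof.
by move=> cu cf cg; apply: (cf_comp (cf_pair cf cg) cu).
Qed.

Lemma cf_fst (U W : topologicalType) (f : T -> U * W) :
  continuous f -> continuous (fun x => (f x).1).
Proof. by move=> cf x; apply: (continuous_comp (cf x)); exact: cvg_fst. Qed.

Lemma cf_snd (U W : topologicalType) (f : T -> U * W) :
  continuous f -> continuous (fun x => (f x).2).
Proof. by move=> cf x; apply: (continuous_comp (cf x)); exact: cvg_snd. Qed.

Lemma cf_id : continuous (fun x : T => x).
Proof. by move=> x; exact: cvg_id. Qed.

Section vector.
Context {n : nat}.
Implicit Types u v : T -> 'rV[R]_n.

Lemma cvD u v : continuous u -> continuous v -> continuous (fun x => u x + v x).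
Proof. by move=> cu cv x; apply: cvgD; [exact: cu|exact: cv]. Qed.

Lemma cvN u : continuous u -> continuous (fun x => - u x).
Proof. by move=> cu x; apply: cvgN; exact: cu. Qed.

Lemma cvZ f u : continuous f -> continuous u -> continuous (fun x => f x *: u x).
Proof. by move=> cf cu x; apply: cvgZ; [exact: cf|exact: cu]. Qed.

Lemma cvC (p : 'rV[R]_n) : continuous (fun _ : T => p).
Proof. by move=> x; exact: cvg_cst. Qed.

Lemma cf_coord u i : continuous u -> continuous (fun x => u x ord0 i).
Proof. by move=> cu; exact: (cf_comp cu (@coord_continuous _ _ _ _ _)). Qed.

End vector.
End continuity.

Section dot.
Context {R : realType} {n : nat}.
Implicit Types x y z : 'rV[R]_n.

Definition dot x y : R := \sum_(i < n) x ord0 i * y ord0 i.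

Lemma dotC x y : dot x y = dot y x.
Proof. by apply: eq_bigr => i _; rewrite mulrC. Qed.

Lemma dotDl x y z : dot (x + y) z = dot x z + dot y z.
Proof. by rewrite -big_split; apply: eq_bigr => i _; rewrite mxE mulrDl. Qed.

Lemma dotDr x y z : dot x (y + z) = dot x y + dot x z.
Proof. by rewrite dotC dotDl !(dotC x). Qed.

Lemma dotZl c x y : dot (c *: x) y = c * dot x y.
Proof. by rewrite mulr_sumr; apply: eq_bigr => i _; rewrite mxE mulrA. Qed.

Lemma dotZr c x y : dot x (c *: y) = c * dot x y.
Proof. by rewrite dotC dotZl dotC. Qed.

Lemma dotNl x y : dot (- x) y = - dot x y.
Proof. by rewrite -scaleN1r dotZl mulN1r. Qed.

Lemma dotNr x y : dot x (- y) = - dot x y.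
Proof. by rewrite dotC dotNl dotC. Qed.

Lemma dot0l x : dot 0 x = 0.
Proof. by rewrite -(scale0r (0 : 'rV[R]_n)) dotZl mul0r. Qed.

Lemma dot0r x : dot x 0 = 0.
Proof. by rewrite dotC dot0l. Qed.

Definition dotE := (dotDl, dotDr, dotNl, dotNr, dotZl, dotZr, dot0l, dot0r).

Lemma dot_delta x i : dot x (delta_mx ord0 i) = x ord0 i.
Proof.
rewrite /dot (bigD1 i) //= big1 ?addr0 => [|j ji].
  by rewrite mxE !eqxx mulr1.
by rewrite mxE (negPf ji) andbF mulr0.
Qed.

Lemma dotxx_ge0 x : 0 <= dot x x.
Proof. by apply: sumr_ge0 => i _; rewrite -expr2 sqr_ge0. Qed.

Lemma enormE x : enorm x = Num.sqrt (dot x x).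
Proof. by congr Num.sqrt; apply: eq_bigr => i _; rewrite expr2. Qed.

Lemma enorm_ge0 x : 0 <= enorm x.
Proof. exact: sqrtr_ge0. Qed.

Lemma sqr_enorm x : enorm x ^+ 2 = dot x x.
Proof. by rewrite enormE sqr_sqrtr // dotxx_ge0. Qed.

Lemma enorm_le x c : 0 <= c -> (enorm x <= c) = (dot x x <= c ^+ 2).
Proof. by move=> c0; rewrite -sqr_enorm ler_pXn2r // nnegrE enorm_ge0. Qed.

Lemma enorm_lt x c : 0 <= c -> (enorm x < c) = (dot x x < c ^+ 2).
Proof. by move=> c0; rewrite -sqr_enorm ltr_pXn2r // nnegrE enorm_ge0. Qed.

Lemma enormZ c x : enorm (c *: x) = `|c| * enorm x.
Proof.
by rewrite !enormE dotZl dotZr mulrA -expr2 sqrtrM ?sqr_ge0 // sqrtr_sqr.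
Qed.

Lemma enormN x : enorm (- x) = enorm x.
Proof. by rewrite -scaleN1r enormZ normrN1 mul1r. Qed.

Lemma enorm0 : enorm (0 : 'rV[R]_n) = 0.
Proof. by rewrite enormE dot0l sqrtr0. Qed.

Lemma enorm_eq0 x : (enorm x == 0) = (x == 0).
Proof.
apply/idP/eqP => [/eqP x0|->]; last by rewrite enorm0.
apply/rowP => i; rewrite mxE; apply/eqP; rewrite -normr_le0 -x0.
exact: normr_le_enorm.
Qed.

Lemma dot_sphere x : esphere R n x -> dot x x = 1.
Proof. by rewrite -sqr_enorm /esphere /= => ->; rewrite expr1n. Qed.

Lemma sphere_dot x : dot x x = 1 -> esphere R n x.
Proof. by rewrite /esphere /= enormE => ->; rewrite sqrtr1. Qed.

(* Cauchy-Schwarz: [0 <= |(y.y) x - (x.y) y|^2]. *)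
Lemma dot_cauchy x y : dot x y ^+ 2 <= dot x x * dot y y.
Proof.
have [y0|y0] := eqVneq (dot y y) 0.
  suff -> : y = 0 by rewrite !dot0r expr0n mulr0.
  by apply/eqP; rewrite -enorm_eq0 enormE y0 sqrtr0.
have yp : 0 < dot y y by rewrite lt_def y0 dotxx_ge0.
have := dotxx_ge0 (dot y y *: x - dot x y *: y).
rewrite !dotE (dotC y x) => h.
rewrite -subr_ge0 -(pmulr_rge0 _ yp); nra.
Qed.

Lemma dot_le x y : `|dot x y| <= enorm x * enorm y.
Proof.
rewrite -sqrtr_sqr !enormE -sqrtrM ?dotxx_ge0 // ler_sqrt ?dot_cauchy //.
by rewrite mulr_ge0 ?dotxx_ge0.
Qed.

Lemma enormD x y : enorm (x + y) <= enorm x + enorm y.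
Proof.
rewrite enorm_le ?addr_ge0 ?enorm_ge0 // !dotE (dotC y x).
have := dot_le x y; rewrite ler_norml => /andP[_ h].
rewrite sqrrD !sqr_enorm mulr2n; lra.
Qed.

Lemma sphere_normalize x : x != 0 -> esphere R n ((enorm x)^-1 *: x).
Proof.
by move=> x0; rewrite /esphere /= enormZ ger0_norm ?invr_ge0 ?enorm_ge0 // mulVf // enorm_eq0.
Qed.

Context {T : topologicalType}.
Lemma cf_dot (u v : T -> 'rV[R]_n) : continuous u -> continuous v ->
  continuous (fun x : T => dot (u x) (v x)).
Proof.
by move=> cu cv; apply: cf_sum => i; apply: cfM; exact: cf_coord.
Qed.

Lemma cf_enorm (u : T -> 'rV[R]_n) : continuous u ->
  continuous (fun x : T => enorm (u x)).
Proof.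
by move=> cu; under eq_fun do rewrite enormE; apply: cf_sqrt; exact: cf_dot.
Qed.

End dot.

Ltac cts_step :=
  lazymatch goal with
  | |- continuous (fun _ => ?c) => exact: cst_continuous
  | |- continuous (fun x => x) => exact: cf_id
  | |- continuous (fun x => (_ + _)%R) => first [apply: cfD | apply: cvD]
  | |- continuous (fun x => (- _)%R) => first [apply: cfN | apply: cvN]
  | |- continuous (fun x => (_ * _)%R) => apply: cfM
  | |- continuous (fun x => (_ ^+ _)%R) => apply: cfX
  | |- continuous (fun x => (_ *: _)%R) => apply: cvZ
  | |- continuous (fun x => dot _ _) => apply: cf_dot
  | |- continuous (fun x => enorm _) => apply: cf_enorm
  | |- continuous (fun x => Num.max 0 _) => apply: cf_max0
  | |- continuous (fun x => Num.sqrt _) => apply: cf_sqrt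
  | |- continuous (fun x => `|_|%R) => apply: cf_norm
  | |- continuous (fun x => fst _) => apply: cf_fst
  | |- continuous (fun x => snd _) => apply: cf_snd
  | |- continuous (fun x => fun_of_matrix _ _ _) => apply: cf_coord
  | |- continuous (fun x => (_, _)) => apply: cf_pair
  | |- continuous (fun x => _) => assumption
  | |- continuous ?F =>
      first [assumption | change (continuous (fun x => F x))]
  | |- _ => assumption
  end.

Ltac cts := repeat cts_step.

Section compact.
Context {R : realType} {n : nat}.

Lemma compact_cball (M : R) : compact [set x : 'rV[R]_n | enorm x <= M].
Proof.
apply: bounded_closed_compact.
  exists M; split; first exact: num_real.
  move=> r Mr x /= xM; rewrite /Num.norm /= mx_normrE.
  apply/bigmax_leP; split=> [|[i j] _ /=].
    by apply: le_trans (ltW Mr); apply: le_trans xM; exact: enorm_ge0.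
  by rewrite (ord1 i); apply: le_trans (normr_le_enorm _ _) (le_trans xM (ltW Mr)).
have -> : [set x : 'rV[R]_n | enorm x <= M] = (fun x => enorm x) @^-1` [set r | r <= M] by [].
apply: closed_comp; last exact: closed_le.
by move=> x _; apply: (@cf_enorm _ _ 'rV[R]_n id); exact: cf_id.
Qed.

Lemma closed_sphere : closed (esphere R n).
Proof.
have -> : esphere R n = (fun x => enorm x) @^-1` [set 1] by [].
apply: closed_comp; last exact: closed_eq.
by move=> x _; apply: (@cf_enorm _ _ 'rV[R]_n id); exact: cf_id.
Qed.

Lemma compact_sphere : compact (esphere R n).
Proof.
apply: (subclosed_compact closed_sphere (compact_cball (M := 1))).
by move=> x /= ->.
Qed.

Lemma continuous_bounded_on (K : set 'rV[R]_n) (f : 'rV[R]_n -> R) :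
  compact K -> continuous f -> exists M, 0 <= M /\ forall x, K x -> `|f x| <= M.
Proof.
move=> cK cf.
have [M [_ h]] : bounded_set (f @` K).
  apply: compact_bounded; apply: continuous_compact => //.
  exact: continuous_subspaceT.
exists (`|M| + 1); split; first by rewrite addr_ge0.
move=> x Kx; apply: (h (`|M| + 1)); last by exists x.
by rewrite (le_lt_trans (ler_norm _)) // ltrDl.
Qed.

End compact.

(** Tube lemma: closeness is uniform over the compact parameter. Parametrised integrals get their
    continuity and differentiability from it. *)
Lemma near_compact (R : realType) (T U : topologicalType) (K : set U)
  (u : T -> U -> R) (t0 : T) (e : R) :
  compact K -> continuous (fun z : T * U => u z.1 z.2) -> 0 < e ->
  \forall t \near t0, forall x, K x -> `|u t x - u t0 x| < e.
Proof.
move=> cK cu e0.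
have : \forall t \near t0, K `<=` (fun x => `|u t x - u t0 x| < e).
  apply: (compact_near_coveringP K).1 => // x Kx.
  have c2 : continuous (fun z : U * T => u z.2 z.1 - u t0 z.1).
    apply: cfB; apply: (cf2 cu); try exact: cf_snd cf_id; try exact: cf_fst cf_id.
    by move=> y; exact: cvg_cst.
  have := c2 (x, t0); move/cvgrPdist_lt => /(_ e e0).
  rewrite /= subrr; under eq_near do rewrite sub0r normrN.
  by apply.
by apply.

Qed.


(** * Cones, shells and the mean over the sphere *)

Section sphere_measure.
Context {R : realType} {n : nat}.
Local Notation leb := (@lebesgue_rV R n).
Local Notation dS := (@sphere_measure R n).
Local Notation V := 'rV[R]_n.

Definition normalize (x : V) : V := (enorm x)^-1 *: x.

Lemma measurable_normalize : measurable_fun setT normalize.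
Proof.
apply: measurable_to_rV => i; rewrite /normalize.
under eq_fun do rewrite mxE.
apply: measurable_funM; last exact: measurable_coor.
apply: (measurableT_comp (f := fun r : measurableTypeR R => r^-1) _
  measurable_enorm).
rewrite (_ : setT = [set r : R | r != 0] `|` [set 0]); last first.
  by apply/seteqP; split => r // _; have [->|r0] := eqVneq r 0; [right|left].
apply/measurable_funU => //; first exact: open_measurable.
split; last exact: measurable_fun_set1.
apply: open_continuous_measurable_fun => //; apply/in_setP => x /= x0.
exact: inv_continuous.
Qed.

Definition shell (a b : R) : set V := [set x | a < enorm x <= b].

Lemma measurable_shell a b : measurable (shell a b).
Proof.
have -> : shell a b = (fun x => enorm x : measurableTypeR R) @^-1` `]a, b].
  by apply/seteqP; split => x /=; rewrite in_itv.
by rewrite -[X in measurable X]setTI; apply: measurable_enorm.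
Qed.

Definition cone_shell (A : set V) (a b : R) : set V :=
  (normalize @^-1` A) `&` shell a b.

Lemma measurable_cone_shell A a b : measurable A -> measurable (cone_shell A a b).
Proof.
move=> mA; apply: measurableI; last exact: measurable_shell.
by rewrite -[X in measurable X]setTI; apply: measurable_normalize.
Qed.

Lemma leb_shell_fin A a b : measurable A -> leb (cone_shell A a b) \is a fin_num.
Proof.
move=> mA; rewrite ge0_fin_numE ?measure_ge0 //.
apply: le_lt_trans (leb_ball n b); apply: le_measure; rewrite ?inE.
- exact: measurable_cone_shell.
- exact: measurable_eball.
- by move=> x [_ /andP[]].
Qed.

Lemma sphere_measureE A : dS A = (n%:R%:E * leb (cone_shell A 0 1))%E.
Proof. by []. Qed.

Lemma sphere_measure_fin A : measurable A -> dS A \is a fin_num.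
Proof. by move=> mA; rewrite sphere_measureE fin_numM // leb_shell_fin. Qed.

(** The cone of height b is the dilation by b of the cone of height 1 that defines
    [sphere_measure]. *)
Lemma leb_cone A b : measurable A -> 0 < b ->
  (n%:R%:E * leb (cone_shell A 0 b) = (b ^+ n)%:E * dS A)%E.
Proof.
move=> mA b0; rewrite -(@leb_affine R n b 0 (cone_shell A 0 b)) //; last first.
  exact: measurable_cone_shell.
rewrite sphere_measureE muleCA; congr (_ * (_ * leb _))%E.
apply/funext => x; rewrite /cone_shell /affine_rV /shell /setI /preimage /normalize.
rewrite /mkset addr0 enormZ ger0_norm ?(ltW b0) // scalerA invfM mulrAC mulVf ?gt_eqF //.
by rewrite mul1r pmulr_rgt0 // -[X in _ <= X]mulr1 ler_pM2l.
Qed.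

Lemma leb_cone_shell A a b : measurable A -> 0 < a -> a <= b ->
  (n%:R%:E * leb (cone_shell A a b) = (b ^+ n - a ^+ n)%:E * dS A)%E.
Proof.
move=> mA a0 ab; have b0 : 0 < b by exact: lt_le_trans ab.
have mc c d := measurable_cone_shell c d mA.
have : (leb (cone_shell A 0 b) = leb (cone_shell A 0 a) + leb (cone_shell A a b))%E.
  rewrite -measureU //; last first.
    rewrite -subset0 => x [[_ /andP[_ xa]] [_ /andP[ax _]]].
    by have := le_lt_trans xa ax; rewrite ltxx.
  congr (leb _); apply/seteqP; split => x; rewrite /cone_shell /shell /=.
    move=> [Ax /andP[x0 xb]]; case: (leP (enorm x) a) => xa; [left|right];
      by rewrite ?x0 ?xa ?xb.
  move=> [[Ax /andP[x0 xa]]|[Ax /andP[ax xb]]]; split => //.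
    by rewrite x0 (le_trans xa).
  by rewrite xb (lt_trans a0).
move=> E; have := leb_cone mA b0; have := leb_cone mA a0.
rewrite {}E.
rewrite -(fineK (leb_shell_fin 0 a mA)) -(fineK (leb_shell_fin a b mA)).
rewrite -(fineK (sphere_measure_fin mA)) -!EFinD -!EFinM => -[h1] -[h2].
by congr EFin; lra.
Qed.

(** If the sphere had measure 0, so would the shell between radii r/2 and r. The two balls would
    then have equal measure, whereas dilation by 2 multiplies it by 2^n > 1. *)
Lemma sphere_measure_sphere : (0 < n)%N -> (0 < dS (esphere R n))%E.
Proof.
move=> n0.
have mS : measurable (esphere R n).
  have -> : esphere R n = (fun x => enorm x : measurableTypeR R) @^-1` [set 1] by [].
  by rewrite -[X in measurable X]setTI; exact: measurable_enorm.
(* This radius makes the ball contain the cube [-1, 1]^n, whose measure is known to be positive. *)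
pose r := Num.sqrt n%:R : R.
have r0 : 0 < r by rewrite sqrtr_gt0 ltr0n.
have cb : @cube R n 1 `<=` [set x | enorm x <= r].
  move=> x x1 /=; rewrite enorm_le ?(ltW r0) // sqr_sqrtr ?ler0n //.
  have -> : n%:R = \sum_(i < n) (1 : R) by rewrite sumr_const card_ord.
  apply: ler_sum => i _; have := x1 i; rewrite ler_norml => /andP[h1 h2]; nra.
have b_gt0 : (0 < leb [set x | (enorm x <= r)%R])%E.
  apply: (@lt_le_trans _ _ (leb (@cube R n 1))); first exact: leb_cube_gt0.
  apply: le_measure; rewrite ?inE; [exact: measurable_cube|exact: measurable_eball|].
  exact: cb.
have E : (leb [set x | (enorm x <= r / 2)%R] * (2 ^+ n)%:E = leb [set x | (enorm x <= r)%R])%E.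
  rewrite muleC -(@leb_affine R n 2 0 [set x | (enorm x <= r)%R]) //; last exact: measurable_eball.
  congr (_ * leb _)%E; apply/seteqP; split => x; rewrite /affine_rV /= addr0 enormZ ger0_norm //; lra.
rewrite lt0e measure_ge0 andbT; apply/eqP => dS0.
have r2 : r / 2 <= r by lra.
have := leb_cone_shell mS (divr_gt0 r0 (ltr0n R 2)) r2.
rewrite dS0 mule0 => /eqP; rewrite mule_eq0 eqe pnatr_eq0 gtn_eqF //= => /eqP sh0.
have U : leb [set x | (enorm x <= r)%R] =
   (leb [set x | (enorm x <= r / 2)%R] + leb (cone_shell (esphere R n) (r / 2) r))%E.
  rewrite -measureU; first last.
  - rewrite -subset0 => x [/= xa [_ /andP[ax _]]].
    by have := le_lt_trans xa ax; rewrite ltxx.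
  - exact: measurable_cone_shell.
  - exact: measurable_eball.
  congr (leb _); apply/seteqP; split => x /=.
    move=> xr; case: (leP (enorm x) (r / 2)) => xa; [by left|right].
    split; last by rewrite /shell /= xa xr.
    apply: sphere_normalize; apply/eqP => x0; move: xa; rewrite x0 enorm0; lra.
  by move=> [xa|[_ /andP[_]] //]; exact: le_trans r2.
move: U; rewrite sh0 adde0 => U.
move: E b_gt0; rewrite U.
have : leb [set x | (enorm x <= r / 2)%R] \is a fin_num.
  by rewrite ge0_fin_numE ?measure_ge0 // leb_ball.
move=> /fineK <-; rewrite -EFinM lte_fin => -[E] b0.
have : 1 < (2 : R) ^+ n by rewrite exprn_egt1 ?ltr1n // -lt0n.
by move: E; nra.
Qed.

Hypothesis n0 : (0 < n)%N.

Lemma measurable_esphere : measurable (esphere R n).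
Proof.
have -> : esphere R n = (fun x => enorm x : measurableTypeR R) @^-1` [set 1] by [].
by rewrite -[X in measurable X]setTI; exact: measurable_enorm.
Qed.

Lemma sphere_area_gt0 : 0 < sphere_area n :> R.
Proof.
apply: fine_gt0; rewrite sphere_measure_sphere //=.
by rewrite -ge0_fin_numE ?measure_ge0 // sphere_measure_fin //; exact: measurable_esphere.
Qed.

(** The normalised mean; [spherical_mean] and [backprojection] are values of [SI] by unfolding. *)
Definition SI (f : V -> R) : R :=
  (sphere_area n)^-1 * \int[dS]_(x in esphere R n) f x.

Lemma bounded_integrable (mu : {measure set V -> \bar R}) (D : set V) (f : V -> R) (M : R) :
  measurable D -> (mu D < +oo)%E -> measurable_fun D (f : _ -> measurableTypeR R) ->
  (forall x, D x -> `|f x| <= M) -> mu.-integrable D (EFin \o f).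
Proof.
move=> mD muD mf fM; apply: measurable_bounded_integrable => //.
exists M; split; first exact: num_real.
by move=> r Mr x Dx; apply: le_trans (fM _ Dx) (ltW Mr).
Qed.

Lemma SI_integrable (f : V -> R) : continuous f ->
  dS.-integrable (esphere R n) (EFin \o f).
Proof.
move=> cf; have [M [_ fM]] := continuous_bounded_on (@compact_sphere R n) cf.
apply: (bounded_integrable measurable_esphere _ _ fM).
  by rewrite -ge0_fin_numE ?measure_ge0 // sphere_measure_fin //; exact: measurable_esphere.
by apply: measurable_funTS; exact: continuous_measurable_rV.
Qed.

Lemma SI_ext (f g : V -> R) : (forall x, esphere R n x -> f x = g x) -> SI f = SI g.
Proof.
move=> fg; congr (_ * _); apply: eq_Rintegral => x; rewrite inE; exact: fg.
Qed.

Lemma SID (f g : V -> R) : continuous f -> continuous g ->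
  SI (fun x => f x + g x) = SI f + SI g.
Proof.
by move=> cf cg; rewrite /SI RintegralD ?mulrDr //;
  [exact: measurable_esphere|exact: SI_integrable|exact: SI_integrable].
Qed.

Lemma SIZ (c : R) (f : V -> R) : continuous f ->
  SI (fun x => c * f x) = c * SI f.
Proof.
move=> cf; rewrite /SI RintegralZl; first by rewrite mulrCA.
  exact: measurable_esphere.
exact: SI_integrable.
Qed.

Lemma SIN (f : V -> R) : continuous f -> SI (fun x => - f x) = - SI f.
Proof.
move=> cf; rewrite -mulN1r -SIZ //; apply: SI_ext => x _; by rewrite mulN1r.
Qed.

Lemma SIB (f g : V -> R) : continuous f -> continuous g ->
  SI (fun x => f x - g x) = SI f - SI g.
Proof. by move=> cf cg; rewrite SID ?SIN //; exact: cfN. Qed.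

Lemma SI_cst (c : R) : SI (fun=> c) = c.
Proof.
rewrite /SI Rintegral_cst; last exact: measurable_esphere.
by rewrite mulrCA mulVf ?mulr1 // gt_eqF // sphere_area_gt0.
Qed.

Lemma SI_sum (I : Type) (r : seq I) (F : I -> V -> R) :
  (forall i, continuous (F i)) ->
  SI (fun x => \sum_(i <- r) F i x) = \sum_(i <- r) SI (F i).
Proof.
move=> cF; elim: r => [|i r IH].
  by rewrite big_nil -[RHS]SI_cst; apply: SI_ext => x _; rewrite big_nil.
rewrite big_cons -IH -SID //; last exact: cf_sum.
by apply: SI_ext => x _; rewrite big_cons.
Qed.

Lemma SI_ge0 (f : V -> R) : (forall x, esphere R n x -> 0 <= f x) -> 0 <= SI f.
Proof.
move=> f0; rewrite mulr_ge0 ?invr_ge0 ?(ltW sphere_area_gt0) //.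
exact: Rintegral_ge0.
Qed.

Lemma SI_le (f g : V -> R) : continuous f -> continuous g ->
  (forall x, esphere R n x -> f x <= g x) -> SI f <= SI g.
Proof.
move=> cf cg fg; rewrite -subr_ge0 -SIB //; apply: SI_ge0 => x Sx.
by rewrite subr_ge0 fg.
Qed.

Lemma SI_norm_le (f : V -> R) (M : R) : continuous f ->
  (forall x, esphere R n x -> `|f x| <= M) -> `|SI f| <= M.
Proof.
move=> cf fM; rewrite ler_norml; apply/andP; split.
  rewrite -[- M]SI_cst; apply: SI_le => //; first exact: cfC.
  by move=> x /fM; rewrite ler_norml => /andP[].
rewrite -[leRHS]SI_cst; apply: SI_le => //; first exact: cfC.
by move=> x /fM; rewrite ler_norml => /andP[].
Qed.

Lemma SI_continuous (T : topologicalType) (u : T -> V -> R) :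
  continuous (fun z : T * V => u z.1 z.2) -> continuous (fun t => SI (u t)).
Proof.
move=> cu t0; apply/cvgrPdist_le => e e0.
have cut t : continuous (u t).
  apply: (cf2 cu); last exact: cf_id.
  exact: cst_continuous.
have := near_compact t0 (@compact_sphere R n) cu e0; apply: filterS => t h.
rewrite -SIB //; apply: SI_norm_le; first exact: cfB.
by move=> x Sx; rewrite distrC ltW // h.
Qed.

Lemma shell_integrable (f : V -> R) a b (M : R) :
  measurable_fun setT (f : _ -> measurableTypeR R) ->
  (forall x, shell a b x -> `|f x| <= M) ->
  (leb : {measure set V -> \bar R}).-integrable (shell a b) (EFin \o f).
Proof.
move=> mf fM; apply: (bounded_integrable (measurable_shell a b) _ _ fM); last first.
  exact: measurable_funTS.
apply: le_lt_trans (leb_ball n b); apply: le_measure; rewrite ?inE.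
- exact: measurable_shell.
- exact: measurable_eball.
- by move=> x /andP[].
Qed.

Lemma shell_normalize_integrable (f : V -> R) a b : continuous f -> 0 < a ->
  (leb : {measure set V -> \bar R}).-integrable (shell a b)
    (EFin \o (fun x => f (normalize x))).
Proof.
move=> cf a0; have [M [M0 fM]] := continuous_bounded_on (@compact_sphere R n) cf.
apply: (@shell_integrable _ a b M).
  apply: (measurableT_comp (f := f : V -> measurableTypeR R)).
    exact: continuous_measurable_rV.
  exact: measurable_normalize.
move=> x xs; apply: fM; apply: sphere_normalize; apply/eqP => x0.
by move: xs; rewrite /shell /= x0 enorm0 => /andP[]; lra.
Qed.

(** Normalisation pushes Lebesgue measure on the shell to a multiple of [dS]; [leb_cone_shell] gives
    the constant. *)
Lemma SI_shell_ge0 (f : V -> R) a b : continuous f -> (forall x, 0 <= f x) ->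
  0 < a -> a <= b ->
  n%:R * \int[leb]_(x in shell a b) f (normalize x) =
  (b ^+ n - a ^+ n) * sphere_area n * SI f.
Proof.
move=> cf f0 a0 ab.
rewrite /SI mulrA mulfK ?gt_eqF ?sphere_area_gt0 //.
(* Points outside the shell go to 0, which is off the sphere, so preimages of subsets of the sphere
   stay inside the shell. *)
pose phi (x : V) : V := \1_(shell a b) x *: normalize x.
have mphi : measurable_fun setT phi.
  apply: measurable_to_rV => i; rewrite /phi.
  under eq_fun do rewrite mxE.
  apply: measurable_funM.
    by apply: measurable_indic; exact: measurable_shell.
  apply: (measurableT_comp (f := fun x : V => x ord0 i : measurableTypeR R)).
    exact: measurable_coor.
  exact: measurable_normalize.
have phiS A : A `<=` esphere R n -> phi @^-1` A = cone_shell A a b.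
  move=> AS; apply/seteqP; split => x.
    rewrite /preimage /phi /= indicE; have [xs|xs] := boolP (x \in shell a b).
      by rewrite scale1r => Ax; split => //; rewrite inE in xs.
    rewrite scale0r => /AS; rewrite /esphere /= enorm0 => /esym/eqP.
    by rewrite oner_eq0.
  by move=> [Ax xs]; rewrite /preimage /phi /= indicE mem_set // scale1r.
have phiT : phi @^-1` (esphere R n) = shell a b.
  rewrite phiS //; apply/seteqP; split => x; first by case.
  move=> xs; split => //; apply: sphere_normalize; apply/eqP => x0.
  by move: xs; rewrite /shell /= x0 enorm0 => /andP[]; lra.
have bn : 0 <= b ^+ n - a ^+ n.
  by rewrite subr_ge0 lerXn2r // nnegrE ltW // (lt_le_trans a0).
pose mu1 : {measure set V -> \bar R} :=
  mscale (NngNum (ler0n R n))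
    (measure_function_pushforward__canonical__measure_function_Measure leb mphi).
pose mu2 : {measure set V -> \bar R} := mscale (NngNum bn) dS.
have E : (\int[mu1]_(x in esphere R n) (f x)%:E = \int[mu2]_(x in esphere R n) (f x)%:E)%E.
  apply: eq_measure_integral => A mA AS.
  by rewrite /= /mscale /= -leb_cone_shell // /pushforward phiS.
have mS := measurable_esphere.
have mf : measurable_fun setT (EFin \o f).
  by apply/measurable_EFinP; exact: continuous_measurable_rV.
move: E; rewrite /mu1 /mu2 !ge0_integral_mscale //; try (by move=> x _; rewrite lee_fin);
  try exact: (measurable_funTS mf).
rewrite ge0_integral_pushforward //; last 2 first.
- exact: (measurable_funTS mf).
- by move=> x _; rewrite lee_fin.
rewrite phiT /= => E.
have -> : (\int[leb]_(x in shell a b) f (normalize x) =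
    fine (\int[leb]_(x in shell a b) ((EFin \o f) \o phi) x)%E).
  congr fine; apply: eq_integral => x; rewrite inE => xs.
  by rewrite /= /phi indicE mem_set // scale1r.
have F1 : (\int[leb]_(x in shell a b) ((EFin \o f) \o phi) x)%E \is a fin_num.
  have := integrable_fin_num (measurable_shell a b) (shell_normalize_integrable b cf a0).
  congr (_ \is a fin_num); apply: eq_integral => x; rewrite inE => xs.
  by rewrite /= /phi indicE mem_set // scale1r.
have F2 := integrable_fin_num measurable_esphere (SI_integrable cf).
move: E; rewrite -(fineK F1) -(fineK F2) -!EFinM => -[].
by [].
Qed.

Lemma SI_shell (f : V -> R) a b : continuous f -> 0 < a -> a <= b ->
  n%:R * \int[leb]_(x in shell a b) f (normalize x) =
  (b ^+ n - a ^+ n) * sphere_area n * SI f.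
Proof.
move=> cf a0 ab.
pose p x := Num.max 0 (f x); pose q x := Num.max 0 (- f x).
have cp : continuous p by exact: cf_max0.
have cq : continuous q by apply: cf_max0; exact: cfN.
have fE x : f x = p x - q x.
  by rewrite /p /q; case: (leP 0 (f x)) => h1; case: (leP 0 (- f x)) => h2; lra.
have -> : SI f = SI p - SI q by rewrite -SIB //; apply: SI_ext => x _.
have -> : \int[leb]_(x in shell a b) f (normalize x) =
  \int[leb]_(x in shell a b) p (normalize x) - \int[leb]_(x in shell a b) q (normalize x).
  rewrite -RintegralB; first by apply: eq_Rintegral => x _; exact: fE.
  - exact: measurable_shell.
  - exact: shell_normalize_integrable.
  - exact: shell_normalize_integrable.
have := SI_shell_ge0 cp (fun x => _) a0 ab; have := SI_shell_ge0 cq (fun x => _) a0 ab.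
move=> hq hp; rewrite mulrBr hp ?hq ?mulrBr // => x; by rewrite le_max lexx.
Qed.

End sphere_measure.

(** * One-dimensional calculus *)

Definition dv (R : realType) (f : R -> R) (x l : R) : Prop := is_derive x 1 f l.

Section derivative.
Context {R : realType}.
Implicit Types (f g : R -> R) (x y a b c l : R).

Lemma near_dist x (d : R) (P : R -> Prop) : 0 < d ->
  (forall y, `|y - x| < d -> P y) -> \forall y \near x, P y.
Proof.
by move=> d0 h; apply/nbhs_ballP; exists d => // y; rewrite /ball /= distrC; exact: h.
Qed.

Lemma dist_near x (P : R -> Prop) : (\forall y \near x, P y) ->
  exists2 d : R, 0 < d & forall y, `|y - x| < d -> P y.
Proof.
move=> /nbhs_ballP[d /= d0 h]; exists d => // y; rewrite distrC => yx; exact: h.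
Qed.

Lemma dv_eq f x l l' : dv f x l -> l = l' -> dv f x l'.
Proof. by move=> h <-. Qed.

Lemma dv_near f g x l : (\forall y \near x, f y = g y) -> dv g x l -> dv f x l.
Proof.
move=> fg dg; apply: DeriveDef.
  by apply: near_eq_derivable (@ex_derive _ _ _ _ _ _ _ dg) => //; apply: filterS fg.
by rewrite (near_eq_derive _ fg) // (@derive_val _ _ _ _ _ _ _ dg).
Qed.

Lemma dvC (c : R) x : dv (fun=> c) x 0.
Proof. exact: is_derive_cst. Qed.

Lemma dvId (x : R) : dv (fun x => x) x 1.
Proof. exact: is_derive_id. Qed.

Lemma dvD f g x a b : dv f x a -> dv g x b -> dv (fun x => f x + g x) x (a + b).
Proof. by move=> df dg; exact: is_deriveD. Qed.

Lemma dvB f g x a b : dv f x a -> dv g x b -> dv (fun x => f x - g x) x (a - b).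
Proof. by move=> df dg; exact: is_deriveB. Qed.

Lemma dvM f g x a b : dv f x a -> dv g x b ->
  dv (fun x => f x * g x) x (a * g x + f x * b).
Proof.
move=> df dg; apply: dv_eq (is_deriveM df dg) _.
by rewrite /GRing.scale /= addrC (mulrC a).
Qed.

Lemma dvZ f x a c : dv f x a -> dv (fun x => c * f x) x (c * a).
Proof.
by move=> df; apply: dv_eq (dvM (dvC c x) df) _; rewrite mul0r add0r.
Qed.

Lemma dvX f x a k : dv f x a -> dv (fun x => f x ^+ k) x (k%:R * f x ^+ k.-1 * a).
Proof.
move=> df; elim: k => [|k IH].
  by apply: dv_eq (dvC 1 x) _; rewrite mul0r mul0r.
under eq_fun do rewrite exprS.
apply: dv_eq (dvM df IH) _; case: k {IH} => [|k] /=; first by rewrite !expr0 !mulr1; ring.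
by rewrite exprS [in RHS]mulrS; ring.
Qed.

Lemma dv_cont f x a : dv f x a -> {for x, continuous f}.
Proof.
by move=> df; apply/differentiable_continuous/derivable1_diffP; exact: (@ex_derive _ _ _ _ _ _ _ df).
Qed.

Lemma dv_continuous f (f' : R -> R) : (forall x, dv f x (f' x)) -> continuous f.
Proof. by move=> df x; exact: dv_cont (df x). Qed.

Lemma dv_comp f g x a b : dv g x b -> dv f (g x) a -> dv (fun x => f (g x)) x (a * b).
Proof.
move=> dg df; apply: dv_eq (is_derive1_comp df dg) _.
by rewrite /GRing.scale /=.
Qed.

Lemma dv_affine f x a c d : dv f (c * x + d) a -> dv (fun x => f (c * x + d)) x (a * c).
Proof.
move=> df; apply: (dv_comp (g := fun x => c * x + d)) df.
by apply: dv_eq (dvD (dvZ c (dvId x)) (dvC d x)) _; rewrite mulr1 addr0.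
Qed.

Lemma dv_uniq f x a b : dv f x a -> dv f x b -> a = b.
Proof. by move=> h1 h2; rewrite -(@derive_val _ _ _ _ _ _ _ h1) (@derive_val _ _ _ _ _ _ _ h2). Qed.

Lemma dvP f x a :
  (forall e, 0 < e -> \forall y \near x, `|f y - f x - a * (y - x)| <= e * `|y - x|) ->
  dv f x a.
Proof.
move=> h.
have c : h^-1 *: ((f \o shift x) (h *: 1) - f x) @[h --> 0^'] --> a.
  apply/cvgrPdist_le => e e0.
  have := h e e0; rewrite (near_shift 0) subr0 /= => h2.
  near=> k.
  have k0 : k != 0 by near: k; exact: nbhs_dnbhs_neq.
  have : `|f (k + x) - f x - a * (k + x - x)| <= e * `|k + x - x|.
    by near: k; apply: nbhs_dnbhs.
  rewrite addrK /GRing.scale /= mulr1 => h3.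
  have kp : 0 < `|k| by rewrite normr_gt0.
  rewrite -(ler_pM2r kp) -normrM mulrBl mulrAC mulVf // mul1r.
  by rewrite distrC.
by apply: DeriveDef; [apply/cvg_ex; exists a|exact: cvg_lim].
Unshelve. all: end_near. Qed.

Lemma dv0_cst f a b : a <= b -> (forall x, a < x < b -> dv f x 0) ->
  (forall x, a <= x <= b -> {for x, continuous f}) -> f b = f a.
Proof.
move=> ab df cf.
have [||c _] := @MVT_segment R f (fun=> 0) a b ab.
- by move=> x; rewrite in_itv /=; exact: df.
- apply: continuous_in_subspaceT => x; rewrite inE /= in_itv /=; exact: cf.
- by rewrite mul0r => /eqP; rewrite subr_eq0 => /eqP.
Qed.

Lemma dv_mvt f (f' : R -> R) a b : (forall x, dv f x (f' x)) ->
  exists c, `|c - a| <= `|b - a| /\ f b - f a = f' c * (b - a).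
Proof.
move=> df.
have cf i : {within i, continuous f}.
  apply: continuous_subspaceT; exact: dv_continuous df.
have [ab|/ltW ba] := leP a b.
  have [c cab E] := @MVT_segment R f f' a b ab (fun x _ => df x) (cf _).
  exists c; split => //; move: cab; rewrite in_itv /= => /andP[h1 h2].
  by rewrite !ger0_norm ?subr_ge0 //; lra.
have [c cab E] := @MVT_segment R f f' b a ba (fun x _ => df x) (cf _).
exists c; split; last by move: E; lra.
move: cab; rewrite in_itv /= => /andP[h1 h2].
by rewrite !ler0_norm ?subr_le0 //; lra.
Qed.

End derivative.

(** * Integrals as differences of primitives *)

Section newton_integral.
Context {R : realType}.
Implicit Types (f g : R -> R) (x y a b c l : R).

Lemma antiderivative_on f (a b : R) : continuous f -> exists F : R -> R,
  forall x, a < x < b -> dv F x (f x).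
Proof.
move=> cf; exists (fun x => \int[lebesgue_measure]_(t in [set` `[a, x]]) f t) => x /andP[ax xb].
have fi : lebesgue_measure.-integrable `[a, b] (EFin \o f).
  apply: continuous_compact_integrable; first exact: segment_compact.
  exact: continuous_subspaceT.
have [d1 d2] := continuous_FTC1_closed xb fi ax (cf x).
by apply: DeriveDef; [exact: d1|rewrite -derive1E; exact: d2].
Qed.

(** Primitives on (-N, N), normalised to vanish at 0, agree where they overlap; at x the one with
    the least integer N > |x| is used. *)
Lemma antiderivative f : continuous f -> exists F : R -> R, forall x, dv F x (f x).
Proof.
move=> cf.
have H (N : nat) : exists F : R -> R, forall x, - N%:R < x < N%:R -> dv F x (f x).
  exact: antiderivative_on.
have [P HP] := choice H.
pose Q N x := P N x - P N 0.
have QE (N M : nat) x : (N <= M)%N -> - N%:R < x < N%:R -> Q N x = Q M x.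
  move=> NM /andP[x1 x2]; have NMR : (N%:R : R) <= M%:R by rewrite ler_nat.
  have N0 : (0 : R) < N%:R by lra.
  have dW y : - N%:R < y < N%:R -> dv (fun y => P N y - P M y) y 0.
    move=> /andP[y1 y2]; rewrite -[X in dv _ _ X](subrr (f y)).
    by apply: dvB; apply: HP; apply/andP; split; lra.
  have [x0|x0] := leP 0 x.
    suff h : P N x - P M x = P N 0 - P M 0 by rewrite /Q; lra.
    apply: (dv0_cst (f := fun y => P N y - P M y) x0) => y /andP[y1 y2]; [|apply: dv_cont]; apply: dW; lra.
  suff h : P N 0 - P M 0 = P N x - P M x by rewrite /Q; lra.
  apply: (dv0_cst (f := fun y => P N y - P M y) (ltW x0)) => y /andP[y1 y2]; [|apply: dv_cont]; apply: dW; lra.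
exists (fun x => Q (Num.truncn `|x|).+1 x) => x.
have xt := truncnS_gt `|x|; set N := (Num.truncn `|x|).+1 in xt.
have : dv (Q N) x (f x).
  rewrite -[f x]subr0; apply: dvB; last exact: dvC.
  by apply: HP; rewrite -ltr_norml.
apply: dv_near; near=> y.
have yN : `|y| < N%:R.
  near: y; apply: (@cvgr_lt _ _ _ _ (fun y : R => `|y|) `|x|) => //.
  apply: cvg_norm; exact: cvg_id.
apply: QE; last by rewrite -ltr_norml truncnS_gt.
by rewrite -(ltr_nat R) (le_lt_trans _ yN) // truncn_le.
Unshelve. all: by end_near.
Qed.

Definition primitive f : R -> R :=
  if pselect (exists F : R -> R, forall x, dv F x (f x)) is left h
  then projT1 (cid h) else fun=> 0.

Lemma primitiveP f : continuous f -> forall x, dv (primitive f) x (f x).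
Proof.
move=> cf; rewrite /primitive; case: pselect => [h|[]]; last exact: antiderivative.
exact: projT2 (cid h).
Qed.

(** Newton integral: additive in the endpoints, in any order, by pure algebra, and independent of
    the chosen primitive when [f] is continuous. *)
Definition NI f a b : R := primitive f b - primitive f a.

(** Differentiability is asked for only inside the interval: in [polar] the primitive is
    differentiated at positive radii and only its continuity is available at 0. *)
Lemma NI_FTC_in f F a b : continuous f -> a <= b ->
  (forall x, a < x < b -> dv F x (f x)) ->
  (forall x, a <= x <= b -> {for x, continuous F}) -> NI f a b = F b - F a.
Proof.
move=> cf ab dF cF; have dP := primitiveP cf; rewrite /NI; set P := primitive f in dP *.
have : P b - F b = P a - F a.
  apply: (dv0_cst (f := fun y => P y - F y) ab) => x xab.
    rewrite -[X in dv _ _ X](subrr (f x)); apply: dvB; [exact: dP|exact: dF].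
  by apply: cvgB; [exact: dv_cont (dP x)|exact: cF].
by move=> ?; lra.
Qed.

Lemma NI_FTC f F a b : continuous f -> (forall x, dv F x (f x)) -> NI f a b = F b - F a.
Proof.
move=> cf dF; have [ab|/ltW ba] := leP a b.
  by apply: NI_FTC_in => // x _; exact: dv_cont (dF x).
suff : NI f b a = F a - F b by rewrite /NI; lra.
by apply: NI_FTC_in => // x _; exact: dv_cont (dF x).
Qed.

Lemma NI_dv f a x : continuous f -> dv (fun x => NI f a x) x (f x).
Proof.
move=> cf; have [F dF] := antiderivative cf.
rewrite (_ : (fun x => _) = (fun x => F x - F a)); last first.
  by apply/funext => y; exact: NI_FTC.
by apply: dv_eq (dvB (dF x) (dvC _ _)) _; rewrite subr0.
Qed.

Lemma NIxx f a : NI f a a = 0.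
Proof. by rewrite /NI subrr. Qed.

Lemma NI_split f a b c : NI f a c = NI f a b + NI f b c.
Proof. by rewrite /NI; ring. Qed.

Lemma NI_ext f g a b : continuous f -> continuous g -> a <= b ->
  (forall x, a <= x <= b -> f x = g x) -> NI f a b = NI g a b.
Proof.
move=> cf cg ab fg; rewrite (NI_FTC_in cf ab (F := fun x => NI g a x)) ?NIxx ?subr0 //.
  move=> x /andP[x1 x2]; rewrite fg ?(ltW x1) ?(ltW x2) //; exact: NI_dv.
move=> x _; exact: dv_cont (NI_dv _ _ cg).
Qed.

Lemma NID f g a b : continuous f -> continuous g ->
  NI (fun x => f x + g x) a b = NI f a b + NI g a b.
Proof.
move=> cf cg; rewrite (NI_FTC (F := fun x => NI f a x + NI g a x)) ?NIxx ?addr0 ?subr0 //.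
  exact: cfD.
by move=> x; apply: dvD; exact: NI_dv.
Qed.

Lemma NIZ c f a b : continuous f -> NI (fun x => c * f x) a b = c * NI f a b.
Proof.
move=> cf; rewrite (NI_FTC (F := fun x => c * NI f a x)) ?NIxx ?mulr0 ?subr0 //.
  by apply: cfM => //; exact: cfC.
by move=> x; apply: dvZ; exact: NI_dv.
Qed.

Lemma NIN f a b : continuous f -> NI (fun x => - f x) a b = - NI f a b.
Proof.
move=> cf; rewrite -mulN1r -NIZ //; congr NI; by apply/funext => x; rewrite mulN1r.
Qed.

Lemma NIB f g a b : continuous f -> continuous g ->
  NI (fun x => f x - g x) a b = NI f a b - NI g a b.
Proof. by move=> cf cg; rewrite NID ?NIN //; exact: cfN. Qed.

Lemma NI_cst c a b : NI (fun=> c) a b = c * (b - a).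
Proof.
rewrite (NI_FTC (F := fun x => c * x)) ?mulrBr //; first exact: cfC.
by move=> x; apply: dv_eq (dvZ c (dvId x)) _; rewrite mulr1.
Qed.

Lemma NI_sum (I : Type) (r : seq I) (F : I -> R -> R) a b :
  (forall i, continuous (F i)) ->
  NI (fun x => \sum_(i <- r) F i x) a b = \sum_(i <- r) NI (F i) a b.
Proof.
move=> cF; elim: r => [|i r IH].
  rewrite big_nil (_ : (fun x => _) = (fun=> 0)) ?NI_cst ?mul0r //.
  by apply/funext => x; rewrite big_nil.
rewrite big_cons -IH -NID //; last exact: cf_sum.
by congr NI; apply/funext => x; rewrite big_cons.
Qed.

Lemma NI_affine f a b c d : continuous f ->
  NI (fun x => f (c * x + d) * c) a b = NI f (c * a + d) (c * b + d).
Proof.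
move=> cf; have [F dF] := antiderivative cf.
rewrite (NI_FTC (F := fun x => F (c * x + d))) ?(NI_FTC (F := F)) //.
  apply: cfM; last exact: cfC.
  apply: (cf_comp _ cf); apply: cfD; last exact: cfC.
  by apply: cfM; [exact: cfC|exact: cf_id].
by move=> x; apply: dv_affine; exact: dF.
Qed.

Lemma NI_IBP f f' g g' a b : continuous f' -> continuous g' ->
  (forall x, dv f x (f' x)) -> (forall x, dv g x (g' x)) ->
  NI (fun x => f' x * g x) a b = f b * g b - f a * g a - NI (fun x => f x * g' x) a b.
Proof.
move=> cf' cg' df dg; have cf := dv_continuous df; have cg := dv_continuous dg.
have c1 : continuous (fun x => f' x * g x) by exact: cfM.
have c2 : continuous (fun x => f x * g' x) by exact: cfM.
have := NI_FTC (f := fun x => f' x * g x + f x * g' x) (F := fun x => f x * g x) a b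
  (cfD c1 c2) (fun x => dvM (df x) (dg x)).
by rewrite NID // => E; lra.
Qed.

Lemma NI_ge0 f a b : continuous f -> a <= b -> (forall x, a <= x <= b -> 0 <= f x) ->
  0 <= NI f a b.
Proof.
move=> cf ab f0; have [F dF] := antiderivative cf.
rewrite (NI_FTC (F := F)) //.
have [||c cab ->] := @MVT_segment R F f a b ab.
- by move=> x _; exact: dF.
- apply: continuous_subspaceT; exact: dv_continuous dF.
- by rewrite mulr_ge0 ?subr_ge0 // f0 // -in_itv.
Qed.

Lemma NI_le f g a b : continuous f -> continuous g -> a <= b ->
  (forall x, a <= x <= b -> f x <= g x) -> NI f a b <= NI g a b.
Proof.
move=> cf cg ab fg; rewrite -subr_ge0 -NIB //; apply: NI_ge0 => //; first exact: cfB.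
by move=> x /fg; rewrite subr_ge0.
Qed.

Lemma NI_norm_le f a b M : continuous f -> a <= b ->
  (forall x, a <= x <= b -> `|f x| <= M) -> `|NI f a b| <= M * (b - a).
Proof.
move=> cf ab fM; rewrite ler_norml; apply/andP; split.
  rewrite -mulNr -NI_cst; apply: NI_le => //; first exact: cfC.
  by move=> x /fM; rewrite ler_norml => /andP[].
rewrite -NI_cst; apply: NI_le => //; first exact: cfC.
by move=> x /fM; rewrite ler_norml => /andP[].
Qed.

Lemma NI_gt0 f a b c : continuous f -> (forall x, a <= x <= b -> 0 <= f x) ->
  a < c < b -> 0 < f c -> 0 < NI f a b.
Proof.
move=> cf f0 /andP[ac cb] fc.
have [e e0 he] : exists2 e, 0 < e & forall y, `|y - c| < e -> f c / 2 < f y.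
  have /cvgrPdist_lt /(_ (f c / 2)) := cf c.
  rewrite divr_gt0 // => /(_ isT) /nbhs_ballP[e /= e0 he]; exists e => // y yc.
  have := he y; rewrite /ball /= distrC => /(_ yc); rewrite ltr_norml => /andP[h1 h2]; lra.
pose d := Num.min (e / 2) (Num.min (b - c) (c - a)).
have d0 : 0 < d by rewrite !lt_min; apply/and3P; split; lra.
have [de [db da]] : d <= e / 2 /\ d <= b - c /\ d <= c - a.
  by rewrite /d !ge_min !lexx ?orbT; split.
rewrite (NI_split f a c b) (NI_split f c (c + d) b).
have h1 : 0 <= NI f a c.
  by apply: NI_ge0 => //; [lra|move=> x /andP[? ?]; apply: f0; apply/andP; split; lra].
have h2 : 0 <= NI f (c + d) b.
  by apply: NI_ge0 => //; [lra|move=> x /andP[? ?]; apply: f0; apply/andP; split; lra].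
have h3 : f c / 2 * (c + d - c) <= NI f c (c + d).
  rewrite -NI_cst; apply: NI_le => //; [exact: cfC|lra|].
  move=> x /andP[x1 x2]; apply/ltW/he; rewrite ger0_norm; lra.
have h4 : 0 < f c / 2 * (c + d - c) by rewrite mulr_gt0 //; lra.
lra.
Qed.

End newton_integral.


(** * Parametrised means: continuity, differentiation, Fubini *)

Section mean.
Context {R : realType} {U : topologicalType}.

(** Common interface of [NI] over a segment and [SI] over the sphere: linear and bounded by the
    supremum over a compact set. Continuity in a parameter, differentiation under the sign and
    exchange with [NI] are then proved once. *)
Definition mean_on (K : set U) (L : (U -> R) -> R) : Prop :=
  [/\ compact K,
      forall f g : U -> R, continuous f -> continuous g ->
        L (fun x => f x - g x) = L f - L g,
      forall (c : R) (f : U -> R), continuous f -> L (fun x => c * f x) = c * L f &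
      exists2 C, 0 <= C & forall (f : U -> R) M, continuous f -> (forall x, K x -> `|f x| <= M) ->
        `|L f| <= C * M].

Context (K : set U) (L : (U -> R) -> R) (mL : mean_on K L).

Lemma mean_continuous (T : topologicalType) (u : T -> U -> R) :
  continuous (fun z : T * U => u z.1 z.2) -> continuous (fun t => L (u t)).
Proof.
have [cK LB LZ [C C0 LC]] := mL.
move=> cu t0; apply/cvgrPdist_le => e e0.
have cut t : continuous (u t).
  apply: (cf2 cu); last exact: cf_id.
  exact: cst_continuous.
have e1 : 0 < e / (C + 1) by rewrite divr_gt0 // ltr_wpDl.
have := near_compact t0 cK cu e1; apply: filterS => t h.
rewrite distrC -LB //; apply: le_trans (LC _ (e / (C + 1)) _ _) _.
- exact: cfB.
- by move=> x Kx; apply/ltW/h.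
- rewrite mulrCA -[leRHS]mulr1 ler_wpM2l ?(ltW e0) // ler_pdivrMr ?mul1r ?lerDl //.
  exact: ltr_wpDl.
Qed.

(** The mean value theorem turns the difference quotient into a value of u' at a nearby time, which
    [near_compact] makes uniformly close to u' at t. *)
Lemma mean_derive (u u' : R -> U -> R) t :
  (forall x t, dv (fun t => u t x) t (u' t x)) -> (forall t, continuous (u t)) ->
  continuous (fun z : R * U => u' z.1 z.2) ->
  dv (fun t => L (u t)) t (L (u' t)).
Proof.
have [cK LB LZ [C C0 LC]] := mL.
move=> du cu cu'; apply: dvP => e e0.
have cu't s : continuous (u' s).
  apply: (cf2 cu'); last exact: cf_id.
  exact: cst_continuous.
have e1 : 0 < e / (C + 1) by rewrite divr_gt0 // ltr_wpDl.
have /nbhs_ballP[d /= d0 hd] := near_compact t cK cu' e1.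
near=> y.
have yt : `|y - t| < d.
  near: y; apply/nbhs_ballP; exists d => // y; rewrite /ball /= distrC //.
rewrite -LB // mulrC -LZ // -LB; last 2 first.
- exact: cfB.
- by apply: cfM; [exact: cfC|exact: cu't].
apply: le_trans (LC _ (e / (C + 1) * `|y - t|) _ _) _.
- by apply: cfB; [exact: cfB|apply: cfM; [exact: cfC|exact: cu't]].
- move=> x Kx; have [c [cy ->]] := dv_mvt t y (du x).
  rewrite (mulrC (y - t)) -mulrBl normrM ler_wpM2r // ltW //.
  by apply: hd => //; rewrite /ball /= distrC (le_lt_trans cy).
- rewrite mulrA ler_wpM2r // mulrCA -[leRHS]mulr1 ler_wpM2l ?(ltW e0) //.
  rewrite ler_pdivrMr ?mul1r ?lerDl //; exact: ltr_wpDl.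
Unshelve. all: by end_near.
Qed.

End mean.

Section mean_NI.
Context {R : realType}.

Lemma mean_on_NI (a b : R) : a <= b -> mean_on [set` `[a, b]] (fun f : R -> R => NI f a b).
Proof.
move=> ab; split.
- exact: segment_compact.
- by move=> f g cf cg; exact: NIB.
- by move=> c f cf; exact: NIZ.
- exists (b - a); first by rewrite subr_ge0.
  move=> f M cf fM; rewrite mulrC; apply: NI_norm_le => // x xab; exact: fM.
Qed.

Lemma NIC (f : R -> R) a b : NI f a b = - NI f b a.
Proof. by rewrite /NI opprB. Qed.

Lemma NI_continuous (T : topologicalType) (u : T -> R -> R) a b :
  continuous (fun z : T * R => u z.1 z.2) -> continuous (fun t => NI (u t) a b).
Proof.
move=> cu; have [ab|/ltW ba] := leP a b.
  exact: (mean_continuous (mean_on_NI ab)).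
under eq_fun do rewrite NIC; apply: cfN.
exact: (mean_continuous (mean_on_NI ba)).
Qed.

Lemma NI_derive (u u' : R -> R -> R) a b t : a <= b ->
  (forall x t, dv (fun t => u t x) t (u' t x)) -> (forall t, continuous (u t)) ->
  continuous (fun z : R * R => u' z.1 z.2) ->
  dv (fun t => NI (u t) a b) t (NI (u' t) a b).
Proof. by move=> ab; exact: (mean_derive (mean_on_NI ab)). Qed.

Lemma cf_swap (T U : topologicalType) (u : T -> U -> R) :
  continuous (fun z : T * U => u z.1 z.2) -> continuous (fun z : U * T => u z.2 z.1).
Proof. by move=> cu; apply: (cf2 cu); [exact: cf_snd cf_id|exact: cf_fst cf_id]. Qed.

Lemma cf_left (T U : topologicalType) (u : T -> U -> R) t :
  continuous (fun z : T * U => u z.1 z.2) -> continuous (u t).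
Proof. by move=> cu; apply: (cf2 cu); [exact: cst_continuous|exact: cf_id]. Qed.

Lemma cf_right (T U : topologicalType) (u : T -> U -> R) x :
  continuous (fun z : T * U => u z.1 z.2) -> continuous (fun t => u t x).
Proof. by move=> cu; apply: (cf2 cu); [exact: cf_id|exact: cst_continuous]. Qed.

(** As functions of the endpoint b both sides vanish at a and have derivative [L (u b)], so this
    Fubini statement comes down to differentiation under [L]. *)
Lemma mean_NI (U : topologicalType) (K : set U) (L : (U -> R) -> R)
  (u : R -> U -> R) a b : mean_on K L ->
  continuous (fun z : R * U => u z.1 z.2) ->
  L (fun x => NI (fun t => u t x) a b) = NI (fun t => L (u t)) a b.
Proof.
move=> mL cu; apply/esym.
rewrite (NI_FTC (F := fun b => L (fun x => NI (fun t => u t x) a b))).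
- have [_ _ LZ _] := mL.
  suff -> : L (fun x => NI (fun t => u t x) a a) = 0 by rewrite subr0.
  rewrite (_ : (fun x => _) = (fun x => 0 * (fun=> 0) x)).
    by rewrite LZ ?mul0r //; exact: cfC.
  by apply/funext => x; rewrite NIxx mul0r.
- exact: (mean_continuous mL).
- move=> x; apply: (mean_derive mL) => //.
    by move=> y t; apply: (NI_dv (f := fun t => u t y)); exact: cf_right.
  move=> t; apply: (@NI_continuous _ (fun y t => u t y)); exact: cf_swap.
Qed.

End mean_NI.

Section SI_mean.
Context {R : realType} {n : nat}.
Hypothesis n0 : (0 < n)%N.
Local Notation V := 'rV[R]_n.
Local Notation dS := (@sphere_measure R n).

Lemma mean_on_SI : mean_on (esphere R n) (@SI R n).
Proof.
split.
- exact: compact_sphere.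
- by move=> f g cf cg; exact: SIB.
- by move=> c f cf; exact: SIZ.
- exists 1 => // f M cf fM; rewrite mul1r; exact: SI_norm_le.
Qed.

Lemma SI_derive (u u' : R -> V -> R) t :
  (forall x t, dv (fun t => u t x) t (u' t x)) -> (forall t, continuous (u t)) ->
  continuous (fun z : R * V => u' z.1 z.2) ->
  dv (fun t => SI (u t)) t (SI (u' t)).
Proof. exact: (mean_derive mean_on_SI). Qed.

Lemma SI_NI (u : R -> V -> R) a b :
  continuous (fun z : R * V => u z.1 z.2) ->
  SI (fun x => NI (fun t => u t x) a b) = NI (fun t => SI (u t)) a b.
Proof. exact: (mean_NI _ _ mean_on_SI). Qed.

Lemma cv_of_coord (T : topologicalType) (m : nat) (f : T -> 'rV[R]_m) :
  (forall i, continuous (fun x => f x ord0 i)) -> continuous f.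
Proof.
move=> cf x; apply/cvg_ballP => e e0.
have : \forall t \near x, forall i, `|f x ord0 i - f t ord0 i| < e.
  by apply: filter_forall => i; move/cvgrPdist_lt: (cf i x) => /(_ e e0).
apply: filterS => t h; split => // i j; rewrite (ord1 i); exact: h.
Qed.

(** Tonelli asks for measurability in the product sigma-algebra. The map into R^(n+n) is measurable
    coordinate by coordinate, and there continuity already gives measurability. *)
Lemma measurable_joint (u : V -> V -> R) : continuous (fun z : V * V => u z.1 z.2) ->
  measurable_fun setT (fun z : V * V => u z.1 z.2 : measurableTypeR R).
Proof.
move=> cu.
have cc (i : 'I_(n + n)) : continuous (fun w : 'rV[R]_(n + n) => w ord0 i).
  exact: cf_coord cf_id.
have cl : continuous (fun w : 'rV[R]_(n + n) => u (lsubmx w) (rsubmx w)).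
  by apply: (cf2 cu); apply: cv_of_coord => i; under eq_fun do rewrite mxE; exact: cc.
have -> : (fun z : V * V => u z.1 z.2) =
    (fun w : 'rV[R]_(n + n) => u (lsubmx w) (rsubmx w)) \o (fun z => row_mx z.1 z.2).
  by apply/funext => z /=; rewrite row_mxKl row_mxKr.
apply: measurableT_comp; first exact: continuous_measurable_rV.
apply: measurable_to_rV => i; under eq_fun do rewrite mxE.
case: (fintype.split i) => j.
  by apply: (measurableT_comp (f := fun x : V => x ord0 j : measurableTypeR R)) => //;
    exact: measurable_coor.
by apply: (measurableT_comp (f := fun x : V => x ord0 j : measurableTypeR R)) => //;
    exact: measurable_coor.
Qed.

HB.instance Definition _ := Measure_isFinite.Build _ _ _ (@sphere_measure R n)
  (@sphere_measure_fin R n).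

Lemma SI_SI_ge0 (u : V -> V -> R) : (forall x y, 0 <= u x y) ->
  continuous (fun z : V * V => u z.1 z.2) ->
  SI (fun x => SI (fun y => u x y)) = SI (fun y => SI (fun x => u x y)).
Proof.
move=> u0 cu; have mS := @measurable_esphere R n.
pose f (z : V * V) : \bar R := (\1_(esphere R n) z.1 * \1_(esphere R n) z.2 * u z.1 z.2)%:E.
have f0 z : (0 <= f z)%E by rewrite lee_fin !mulr_ge0 // indicE.
have mf : measurable_fun setT f.
  apply/measurable_EFinP; apply: measurable_funM; last exact: measurable_joint.
  have mI : measurable_fun setT (\1_(esphere R n) : V -> measurableTypeR R).
    exact: measurable_indic.
  apply: measurable_funM.
    exact: (measurableT_comp mI (@measurable_fst _ _ V V)).
  exact: (measurableT_comp mI (@measurable_snd _ _ V V)).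
have H (v : V -> V -> R) (F : V -> \bar R) : (forall x, continuous (v x)) ->
    continuous (fun x => SI (v x)) ->
    (forall x, F x = \int[dS]_y (\1_(esphere R n) x * \1_(esphere R n) y * v x y)%:E)%E ->
    SI (fun x => SI (v x)) =
    (sphere_area n)^-1 * ((sphere_area n)^-1 * fine (\int[dS]_x F x)%E).
  move=> cv cSv FE; rewrite {1}/SI; congr (_ * _).
  rewrite /SI RintegralZl //; last first.
    have aS : continuous (fun x => (sphere_area n : R) * SI (v x)).
      by apply: cfM => //; exact: cfC.
    have := SI_integrable aS.
    congr (_.-integrable _ _); apply/funext => x /=; rewrite /SI mulrA mulfV ?mul1r //.
    by rewrite gt_eqF // sphere_area_gt0.
  congr (_ * fine _); rewrite integral_mkcond; apply: eq_integral => x _.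
  rewrite FE patchE; case: ifPn => xS.
    rewrite /Rintegral fineK; last by apply: integrable_fin_num => //; exact: SI_integrable.
    rewrite integral_mkcond; apply: eq_integral => y _; rewrite patchE !indicE xS mul1r.
    by case: ifPn => _; rewrite ?mul1r ?mul0r.
  rewrite integral0_eq // => y _; by rewrite indicE (negPf xS) !mul0r.
rewrite (H _ (fun x => \int[dS]_y f (x, y))%E) //; last 2 first.
- by move=> x; exact: cf_left.
- exact: (mean_continuous mean_on_SI).
have -> : SI (fun y => SI (fun x => u x y)) =
    (sphere_area n)^-1 * ((sphere_area n)^-1 * fine (\int[dS]_y \int[dS]_x f (x, y))%E).
  apply: (H (fun y x => u x y)).
  - by move=> x; exact: cf_right.
  - by apply: (mean_continuous mean_on_SI (u := fun y x => u x y)); exact: cf_swap.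
  - move=> y; apply: eq_integral => x _; rewrite /f /=.
    by rewrite (mulrC (\1_(esphere R n) x)).
congr (_ * (_ * fine _)).
by have := @fubini_tonelli _ _ _ _ _ dS dS f mf f0.
Qed.

Lemma SI_SI (u : V -> V -> R) : continuous (fun z : V * V => u z.1 z.2) ->
  SI (fun x => SI (fun y => u x y)) = SI (fun y => SI (fun x => u x y)).
Proof.
move=> cu.
pose p x y := Num.max 0 (u x y); pose q x y := Num.max 0 (- u x y).
have cp : continuous (fun z : V * V => p z.1 z.2) by exact: cf_max0.
have cq : continuous (fun z : V * V => q z.1 z.2) by apply: cf_max0; exact: cfN.
have uE x y : u x y = p x y - q x y.
  by rewrite /p /q; case: (leP 0 (u x y)) => h1; case: (leP 0 (- u x y)) => h2; lra.
have E (v w : V -> V -> R) : continuous (fun z : V * V => v z.1 z.2) ->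
   continuous (fun z : V * V => w z.1 z.2) ->
   SI (fun x => SI (fun y => v x y - w x y)) =
   SI (fun x => SI (fun y => v x y)) - SI (fun x => SI (fun y => w x y)).
  move=> cv cw; rewrite -SIB //; try exact: (mean_continuous mean_on_SI).
  by congr SI; apply/funext => x; rewrite SIB //; exact: cf_left.
have -> : u = (fun x y => p x y - q x y) by apply/funext => x; apply/funext => y.
rewrite (E p q cp cq) (E (fun y x => p x y) (fun y x => q x y)); try exact: cf_swap.
by rewrite (SI_SI_ge0 _ cp) ?(SI_SI_ge0 _ cq) // => x y; rewrite le_max lexx.
Qed.

End SI_mean.

(** * Polar coordinates *)

Section polar.
Context {R : realType} {n : nat}.
Hypothesis n0 : (0 < n)%N.
Local Notation V := 'rV[R]_n.
Local Notation leb := (@lebesgue_rV R n).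
Local Notation area := (sphere_area n : R).

Definition cball (b : R) : set V := [set x | enorm x <= b].

Lemma leb_cball_fin b : leb (cball b) \is a fin_num.
Proof. by rewrite ge0_fin_numE ?measure_ge0 // leb_ball. Qed.

Lemma cball_integrable (f : V -> R) b : continuous f ->
  (leb : {measure set V -> \bar R}).-integrable (cball b) (EFin \o f).
Proof.
move=> cf; have [M [_ fM]] := continuous_bounded_on (@compact_cball R n b) cf.
apply: (bounded_integrable (measurable_eball b) _ _ fM).
  exact: leb_ball.
by apply: measurable_funTS; exact: continuous_measurable_rV.
Qed.

Lemma continuous_shell_integrable (f : V -> R) a b : continuous f ->
  (leb : {measure set V -> \bar R}).-integrable (shell a b) (EFin \o f).
Proof.
move=> cf; have [M [_ fM]] := continuous_bounded_on (@compact_cball R n b) cf.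
apply: (@shell_integrable _ _ _ a b M); first exact: continuous_measurable_rV.
by move=> x /andP[_ xb]; exact: fM.
Qed.

Lemma cball_shell (f : V -> R) a b : continuous f -> a <= b ->
  \int[leb]_(x in cball b) f x =
  \int[leb]_(x in cball a) f x + \int[leb]_(x in shell a b) f x.
Proof.
move=> cf ab.
have E : cball b = cball a `|` shell a b.
  apply/seteqP; split => x; rewrite /cball /shell /=.
    by move=> xb; case: (leP (enorm x) a) => h; [left|right; rewrite xb].
  by move=> [h|/andP[]//]; exact: le_trans ab.
rewrite E Rintegral_setU //.
- exact: measurable_eball.
- exact: measurable_shell.
- by rewrite -E; exact: cball_integrable.
- apply/disj_setPS => x [/= xa /andP[ax _]].
  by have := le_lt_trans xa ax; rewrite ltxx.
Qed.

Lemma leb_cball_le y b : 0 < b -> y <= b ->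
  fine (leb (cball y)) <= b ^+ n * fine (leb (cball 1)).
Proof.
move=> b0 yb.
have E : affine_rV b 0 @^-1` cball b = cball 1.
  apply/funext => x; rewrite /cball /preimage /affine_rV /mkset addr0 enormZ.
  by rewrite (ger0_norm (ltW b0)) -[X in _ <= X]mulr1 ler_pM2l.
have -> : b ^+ n * fine (leb (cball 1)) = fine (leb (cball b)).
  rewrite -(@leb_affine R n b 0 (cball b)) //; last exact: measurable_eball.
  by rewrite E fineM // leb_cball_fin.
apply: fine_le; rewrite ?leb_cball_fin //; apply: le_measure; rewrite ?inE.
- exact: measurable_eball.
- exact: measurable_eball.
- by move=> x /= h; exact: le_trans yb.
Qed.

Definition ball_integral (h : V -> R) (p : V) (b : R) : R :=
  \int[leb]_(x in cball b) h (p + x).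

Lemma ball_integral_le (h : V -> R) p b M : continuous h ->
  (forall x, cball b x -> `|h (p + x)| <= M) ->
  `|ball_integral h p b| <= M * fine (leb (cball b)).
Proof.
move=> ch hM.
have ch1 : continuous (fun x => h (p + x)).
  by apply: (cf_comp _ ch); apply: cvD; [exact: cvC|exact: cf_id].
apply: le_trans (le_normr_Rintegral _ (cball_integrable _ ch1)) _; first exact: measurable_eball.
rewrite -Rintegral_cst; last exact: measurable_eball.
apply: le_Rintegral => //.
- exact: measurable_eball.
- by apply: (cball_integrable (f := fun x => `|h (p + x)|)); exact: cf_norm.
- by apply: (cball_integrable (f := fun=> M)); exact: cfC.
Qed.

Lemma ball_integral_cont0 (h : V -> R) p : continuous h ->
  {for 0, continuous (ball_integral h p)}.
Proof.
move=> ch.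
have ch1 : continuous (fun x => h (p + x)).
  by apply: (cf_comp _ ch); apply: cvD; [exact: cvC|exact: cf_id].
have [M [M0 hM]] := continuous_bounded_on (@compact_cball R n 1) ch1.
set m1 := fine (leb (cball 1)).
have m10 : 0 <= m1 by apply: fine_ge0; exact: measure_ge0.
have bd y b : 0 < b -> b <= 1 -> y <= b -> `|ball_integral h p y| <= b * (M * m1).
  move=> b0 b1 yb; apply: le_trans (ball_integral_le ch (M := M) _) _.
    by move=> x xy; apply: hM; apply: le_trans (le_trans xy yb) b1.
  rewrite mulrCA ler_wpM2l //; apply: le_trans (leb_cball_le b0 yb) _.
  rewrite ler_wpM2r //; rewrite -[leRHS]expr1; apply: ler_wiXn2l => //; exact: ltW.
apply/cvgrPdist_le => e e0.
pose b := Num.min 1 (e / (2 * (M * m1 + 1))).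
have Mm : 0 < M * m1 + 1 by rewrite ltr_wpDl // mulr_ge0.
have b0 : 0 < b by rewrite lt_min ltr01 divr_gt0 // mulr_gt0.
have b1 : b <= 1 by rewrite ge_min lexx.
have be : b * (M * m1) <= e / 2.
  apply: (@le_trans _ _ (b * (M * m1 + 1))); first by rewrite ler_pM2l // lerDl.
  rewrite -ler_pdivlMr //; apply: le_trans (_ : e / (2 * (M * m1 + 1)) <= _).
    by rewrite ge_min lexx orbT.
  by rewrite invfM mulrA.
near=> y.
have yb : y <= b.
  have : `|0 - y| < b by near: y; apply/nbhs_ballP; exists b.
  by rewrite sub0r normrN => /ltW; apply: le_trans; exact: ler_norm.
apply: le_trans (ler_normB _ _) _; rewrite [leRHS]splitr lerD //;
  by apply: le_trans (bd _ b _ _ _) be => //; exact: ltW.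
Unshelve. all: by end_near.
Qed.

(** On a thin shell near radius a, h (p + x) is uniformly close to its value at p + a x/|x|, whose
    integral is given by [SI_shell]. *)
Lemma ball_integral_derive (h : V -> R) p a : continuous h -> 0 < a ->
  dv (ball_integral h p) a (area * (a ^+ n.-1 * SI (fun w => h (p + a *: w)))).
Proof.
move=> ch a0.
have nR : n%:R != 0 :> R by rewrite pnatr_eq0 -lt0n.
have ar0 := @sphere_area_gt0 R n n0.
have ch1 : continuous (fun x => h (p + x)).
  by apply: (cf_comp _ ch); apply: cvD; [exact: cvC|exact: cf_id].
pose u (r : R) (w : V) := h (p + r *: w).
have cu : continuous (fun z : R * V => u z.1 z.2).
  apply: (cf_comp _ ch); apply: cvD; first exact: cvC.
  by apply: cvZ; [exact: cf_fst cf_id|exact: cf_snd cf_id].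
have cua : continuous (u a) by exact: cf_left.
set K := SI _.
pose c := area / n%:R * K.
(* The term c b^n is what the ball integral would be with h frozen radially at radius a; the
   difference must have derivative 0 there. *)
suff H : dv (fun b => ball_integral h p b - c * b ^+ n) a 0.
  have := dvD H (dvZ c (dvX n (dvId a))).
  rewrite add0r mulr1; under eq_fun do rewrite subrK.
  move=> H2; apply: dv_eq H2 _; rewrite /c; field.
  exact: nR.
apply: dvP => e e0.
pose C := n%:R * (a + 1) ^+ n.-1 + 1.
have C0 : 0 < C by rewrite ltr_wpDl // mulr_ge0 // exprn_ge0 // addr_ge0 // ltW.
pose D := area / n%:R.
have D0 : 0 < D by rewrite divr_gt0 // ltr0n.
pose e1 := e / (D * C).
have e10 : 0 < e1 by rewrite divr_gt0 // mulr_gt0.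
have /nbhs_ballP[d /= d0 hd] := near_compact a (@compact_sphere R n) cu e10.
have xn y : `|y - a| <= 1 -> 0 < y -> `|y ^+ n - a ^+ n| <= C * `|y - a|.
  move=> y1 y0; have [b [ba ->]] := dv_mvt a y (fun x => dvX n (dvId x)).
  rewrite mulr1 normrM ler_wpM2r // normrM ger0_norm // normrX /C.
  rewrite ler_wpDr // ler_wpM2l // lerXn2r ?nnegrE ?addr_ge0 ?(ltW a0) //.
  have := ler_normD (b - a) a; rewrite subrK (ger0_norm (ltW a0)).
  by have := le_trans ba y1; lra.
have main lo hi : 0 < lo -> lo <= hi -> (forall r, lo <= r <= hi -> `|a - r| < d) ->
    `|ball_integral h p hi - ball_integral h p lo - c * (hi ^+ n - lo ^+ n)| <=
    e1 * (D * (hi ^+ n - lo ^+ n)).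
  move=> lo0 lohi hr.
  rewrite /ball_integral (cball_shell ch1 lohi).
  set I0 := \int[leb]_(x in cball lo) _; set I1 := \int[leb]_(x in shell _ _) _.
  have -> : I0 + I1 - I0 = I1 by ring.
  rewrite {}/I0 {}/I1.
  have sh1 := SI_shell n0 cua lo0 lohi.
  have sh2 := SI_shell n0 (@cfC R V 1) lo0 lohi.
  rewrite SI_cst // mulr1 in sh2.
  have -> : c * (hi ^+ n - lo ^+ n) = \int[leb]_(x in shell lo hi) u a (normalize x).
    by apply: (mulfI nR); rewrite sh1 /c /K; field; exact: nR.
  have -> : D * (hi ^+ n - lo ^+ n) = \int[leb]_(x in shell lo hi) (1 : R).
    by apply: (mulfI nR); rewrite sh2 /D; field; exact: nR.
  have mS : measurable (shell lo hi : set V) by exact: measurable_shell.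
  have i1 := continuous_shell_integrable lo hi ch1.
  have i2 := shell_normalize_integrable hi cua lo0.
  have i3 := integrableB mS i1 i2.
  rewrite -RintegralB // -RintegralZl //; last first.
    exact: (continuous_shell_integrable lo hi (@cfC R V 1)).
  apply: le_trans (le_normr_Rintegral mS i3) _.
  apply: le_Rintegral => //.
  - exact: (integrable_norm i3).
  - exact: (continuous_shell_integrable lo hi (@cfC R V (e1 * 1))).
  move=> x xs /=; rewrite mulr1; have /andP[x1 x2] := xs.
  have xz : x != 0 by apply/eqP => x0; move: x1; rewrite x0 enorm0; lra.
  have -> : p + x = p + enorm x *: normalize x.
    by rewrite /normalize scalerA mulfV ?scale1r // enorm_eq0.
  apply/ltW; apply: (hd (enorm x)); last exact: sphere_normalize.
  by apply: hr; rewrite (ltW x1) x2.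
pose r := Num.min (Num.min 1 a) d.
have r0 : 0 < r by rewrite !lt_min ltr01 a0 d0.
have [r1 ra rd] : [/\ r <= 1, r <= a & r <= d].
  by rewrite /r !ge_min !lexx ?orbT; split.
apply/nbhs_ballP; exists r => // y; rewrite /ball /= distrC => yr.
have y0 : 0 < y.
  have h1 := lt_le_trans yr ra.
  by move: h1; rewrite ltr_norml => /andP[]; lra.
rewrite mul0r subr0.
have ee : e1 * (D * (C * `|y - a|)) = e * `|y - a|.
  by rewrite /e1; field; rewrite !lt0r_neq0.
have yx := xn y (ltW (lt_le_trans yr r1)) y0.
have [ya|/ltW ay] := leP y a.
  have := main y a y0 ya _.
  have lp : y ^+ n <= a ^+ n by rewrite lerXn2r // nnegrE ltW.
  move=> main1; rewrite -normrN.
  have -> : - (ball_integral h p y - c * y ^+ n - (ball_integral h p a - c * a ^+ n)) =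
    ball_integral h p a - ball_integral h p y - c * (a ^+ n - y ^+ n) by ring.
  apply: le_trans (main1 _) _.
    move=> s /andP[s1 s2]; rewrite ger0_norm ?subr_ge0 //.
    by have := lt_le_trans yr rd; rewrite ltr_norml => /andP[]; lra.
  rewrite -ee ler_wpM2l ?(ltW e10) // ler_wpM2l ?(ltW D0) //.
  by apply: le_trans yx; rewrite distrC ler_norm.
have main1 := main a y a0 ay _.
have lp : a ^+ n <= y ^+ n by rewrite lerXn2r // nnegrE ltW.
have -> : (ball_integral h p y - c * y ^+ n - (ball_integral h p a - c * a ^+ n)) =
    ball_integral h p y - ball_integral h p a - c * (y ^+ n - a ^+ n) by ring.
apply: le_trans (main1 _) _.
  move=> s /andP[s1 s2]; rewrite ler0_norm ?subr_le0 //.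
  by have := lt_le_trans yr rd; rewrite ltr_norml => /andP[]; lra.
rewrite -ee ler_wpM2l ?(ltW e10) // ler_wpM2l ?(ltW D0) //.
by apply: le_trans yx; rewrite ler_norm.
Qed.

Lemma polar (h : V -> R) p b : continuous h -> 0 <= b ->
  ball_integral h p b =
  ball_integral h p 0 + area * NI (fun t => t ^+ n.-1 * SI (fun w => h (p + t *: w))) 0 b.
Proof.
move=> ch b0.
have cS : continuous (fun t : R => t ^+ n.-1 * SI (fun w => h (p + t *: w))).
  apply: cfM; first by apply: cfX; exact: cf_id.
  apply: (mean_continuous (mean_on_SI n0)).
  apply: (cf_comp _ ch); apply: cvD; first exact: cvC.
  by apply: cvZ; [exact: cf_fst cf_id|exact: cf_snd cf_id].
rewrite -NIZ // (NI_FTC_in (F := ball_integral h p)) //; first by ring.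
- by apply: cfM => //; exact: cfC.
- by move=> x /andP[x0 _]; exact: ball_integral_derive.
- move=> x /andP[x0 _]; move: x0; rewrite le_eqVlt => /predU1P[<-|x0].
    exact: ball_integral_cont0.
  exact: dv_cont (ball_integral_derive _ ch x0).
Qed.

(** The ball of radius 0 is invariant under dilation by 2, so its finite measure equals 2^n times
    itself and is 0. *)
Lemma ball_integral0 (h : V -> R) p : continuous h -> ball_integral h p 0 = 0.
Proof.
move=> ch; apply/eqP; rewrite -normr_le0.
have ch1 : continuous (fun x => h (p + x)).
  by apply: (cf_comp _ ch); apply: cvD; [exact: cvC|exact: cf_id].
have [M [M0 hM]] := continuous_bounded_on (@compact_cball R n 0) ch1.
apply: le_trans (ball_integral_le ch hM) _.
suff -> : fine (leb (cball 0)) = 0 by rewrite mulr0.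
have := @leb_affine R n 2 0 (cball 0) (ltr0n R 2) (measurable_eball 0).
have -> : affine_rV 2 0 @^-1` (cball 0 : set V) = cball 0.
  apply/funext => x; rewrite /cball /preimage /affine_rV /mkset addr0 enormZ.
  by rewrite ger0_norm // pmulr_rle0.
rewrite -(fineK (leb_cball_fin 0)) -EFinM => -[] /= E.
have : 1 < (2 : R) ^+ n by rewrite exprn_egt1 ?ltr1n // -lt0n.
move: E; set z := fine _; set w := 2 ^+ n => E w1.
have : (w - 1) * z = 0 by rewrite mulrBl E mul1r subrr.
by move=> /eqP; rewrite mulf_eq0 => /orP[/eqP|/eqP //]; lra.
Qed.

Lemma ball_integral_translate (h : V -> R) p q b c M : continuous h ->
  (forall x, M < enorm x -> h x = 0) -> enorm p + M <= b -> enorm q + M <= c ->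
  ball_integral h p b = ball_integral h q c.
Proof.
move=> ch hM pb qc.
suff H r d : enorm r + M <= d -> ball_integral h r d = \int[leb]_x h x.
  by rewrite !H.
move=> rd; rewrite /ball_integral.
have E x : ~ cball d x -> h (r + x) = 0.
  move=> /negP; rewrite -ltNge => dx; apply: hM.
  have := enormD (r + x) (- r); rewrite addrC addKr enormN; lra.
have ch1 : continuous (fun x => h (r + x)).
  by apply: (cf_comp _ ch); apply: cvD; [exact: cvC|exact: cf_id].
pose D : set V := affine_rV 1 (- r) @^-1` cball d.
have mD : measurable D.
  rewrite -[X in measurable X]setTI; apply: measurable_affine_rV => //.
  exact: measurable_eball.
have phiD : affine_rV 1 r @^-1` D = cball d.
  by apply/funext => x; rewrite /D /preimage /affine_rV /mkset !scale1r addrK.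
have hE : (EFin \o h) \o affine_rV 1 r = EFin \o (fun x => h (r + x)).
  by apply/funext => x; rewrite /= /affine_rV scale1r addrC.
rewrite /Rintegral; congr fine.
transitivity (\int[pushforward leb (affine_rV 1%R r)]_(y in D) (h y)%:E)%E.
  rewrite (integral_pushforward (measurable_affine_rV 1 r)) //.
  - by rewrite phiD; apply: eq_integral => x _; rewrite /= /affine_rV scale1r addrC.
  - by apply/measurable_EFinP; exact: continuous_measurable_rV.
  - by rewrite phiD hE; exact: cball_integrable.
transitivity (\int[leb]_(y in D) (h y)%:E)%E.
  apply: eq_measure_integral => [|mphi A mA _]; first exact: measurable_affine_rV.
  by have := @leb_affine R n 1 r A ltr01 mA; rewrite expr1n mul1e.
rewrite [LHS]integral_mkcond; apply: eq_integral => y _; rewrite patchE; case: ifPn => //.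
rewrite notin_setE => yD; have := E ((y : V) - r); rewrite (addrC r) subrK => -> //.
by move: yD; rewrite /D /preimage /affine_rV /mkset scale1r.
Qed.

(** Both sides are, up to the area, the integral of [h] over the whole space, taken about two
    centres. From here on Lebesgue measure on R^n enters only through this identity. *)
Lemma polar_translate (h : V -> R) p q b c M : continuous h ->
  (forall x, M < enorm x -> h x = 0) -> enorm p + M <= b -> enorm q + M <= c ->
  0 <= b -> 0 <= c ->
  NI (fun t => t ^+ n.-1 * SI (fun w => h (p + t *: w))) 0 b =
  NI (fun t => t ^+ n.-1 * SI (fun w => h (q + t *: w))) 0 c.
Proof.
move=> ch hM pb qc b0 c0.
have := ball_integral_translate ch hM pb qc.
have a0 : area != 0 by rewrite gt_eqF // sphere_area_gt0.
rewrite (polar p ch b0) (polar q ch c0) (ball_integral0 p ch) (ball_integral0 q ch) !add0r.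
exact: mulfI.
Qed.

End polar.

(** * The Funk-Hecke formula *)

Section positive_part.
Context {R : realType}.

(** The exponent is at least 2, so the truncated power still has derivative 0 where its base
    vanishes. *)
Lemma dv_max0X (f : R -> R) x a k : dv f x a ->
  dv (fun x => Num.max 0 (f x) ^+ k.+2) x (k.+2%:R * Num.max 0 (f x) ^+ k.+1 * a).
Proof.
move=> df; apply: (dv_comp (f := fun y => Num.max 0 y ^+ k.+2) df) => {df a}.
move: (f x) => {f x} y.
have [y0|y0|<-] := ltgtP 0 y.
- have : dv (fun y => y ^+ k.+2) y (k.+2%:R * y ^+ k.+1).
    by apply: dv_eq (dvX k.+2 (dvId y)) _; rewrite mulr1.
  apply: dv_near; near=> z.
  have z0 : 0 < z by near: z; exact: lt_nbhsr.
  by rewrite (elimT max_idPr _) // ltW.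
- rewrite expr0n /= mulr0; have := @dvC _ (0 : R) y.
  apply: dv_near; near=> z.
  have z0 : z < 0 by near: z; exact: lt_nbhsl.
  by rewrite (elimT max_idPl _) ?expr0n // ltW.
- rewrite expr0n /= mulr0; apply: dvP => e e0; apply/nbhs_ballP.
  exists (Num.min 1 e) => /=; first by rewrite lt_min ltr01.
  move=> z; rewrite /ball /= sub0r normrN lt_min => /andP[z1 ze].
  rewrite maxxx expr0n /= subr0 mul0r subr0 subr0.
  have [zp|zn] := leP 0 z; last by rewrite expr0n normr0 mulr_ge0 // ltW.
  rewrite normrX exprS exprS mulrA mulrC -[leRHS]mul1r.
  apply: ler_pM; rewrite ?exprn_ge0 ?mulr_ge0 ?exprn_ile1 ?(ltW z1) //.
  by rewrite ler_wpM2r // ltW.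
Unshelve. all: by end_near.
Qed.

End positive_part.

Section moments.
Context {R : realType} {n : nat}.
Hypothesis n0 : (0 < n)%N.
Local Notation V := 'rV[R]_n.
Implicit Types (th xi : V).

Definition mom th xi a b : R := SI (fun w => dot w th ^+ a * dot w xi ^+ b).

Lemma mom_swap th xi a b : mom th xi a b = mom xi th b a.
Proof. by apply: SI_ext => w _; rewrite mulrC. Qed.

(** The two sides differ by the integral of the derivative of t^k (1 - t^2)_+^2, which vanishes at 0
    and 2. These are the radial integrals met in [mom_rec]. *)
Lemma beta_rel (k : nat) : (0 < k)%N ->
  let I1 := NI (fun t : R => t ^+ k.-1 * Num.max 0 (1 - t ^+ 2) ^+ 2) 0 2 in
  let I2 := NI (fun t : R => t ^+ k.+1 * Num.max 0 (1 - t ^+ 2)) 0 2 in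
  0 < I1 /\ k%:R * I1 = 4 * I2.
Proof.
move=> k0 I1 I2.
have c1 : continuous (fun t : R => t ^+ k.-1 * Num.max 0 (1 - t ^+ 2) ^+ 2) by cts.
have c2 : continuous (fun t : R => t ^+ k.+1 * Num.max 0 (1 - t ^+ 2)) by cts.
split.
  apply: (@NI_gt0 _ _ _ _ (2^-1)) => //.
  - by move=> x /andP[x0 _]; rewrite mulr_ge0 ?exprn_ge0 // le_max lexx.
  - by apply/andP; split; lra.
  - rewrite mulr_gt0 ?exprn_gt0 // lt_max; apply/orP; right.
    by rewrite expr2; lra.
rewrite -!NIZ // -/I2; apply/eqP; rewrite -subr_eq0 -NIB //; try by apply: cfM => //; exact: cfC.
rewrite (NI_FTC (F := fun t => t ^+ k * Num.max 0 (1 - t ^+ 2) ^+ 2)).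
- rewrite [0 ^+ k]expr0n gtn_eqF // mul0r subr0.
  rewrite (elimT max_idPl _) ?expr0n ?mulr0 // expr2; lra.
- by apply: cfB; apply: cfM => //; exact: cfC.
move=> t.
have d1 : dv (fun t : R => 1 - t ^+ 2) t (0 - 2%:R * t ^+ 1 * 1).
  by apply: dvB; [exact: dvC|exact: dvX (dvId t)].
apply: dv_eq (dvM (dvX k (dvId t)) (dv_max0X 0 d1)) _.
case: k k0 {I1 I2 c1 c2} => // k _; rewrite /= !exprS; ring.
Qed.

(** The integral over R^n of (x.th)^a (x.xi)^b (1 - |x|^2)_+^2 does not change when the centre moves
    along [th], so its derivative is 0. In polar coordinates the radial factors split off, and
    [beta_rel] gives their ratio n - 1 + a + b. This does the work of the divergence theorem on the
    sphere. *)
Lemma mom_rec th xi a b : dot th th = 1 ->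
  a%:R * mom th xi a.-1 b + b%:R * dot th xi * mom th xi a b.-1 =
  (n.-1 + a + b)%:R * mom th xi a.+1 b.
Proof.
move=> th1.
pose pp (x : V) := Num.max 0 (1 - dot x x).
pose h (x : V) := dot x th ^+ a * dot x xi ^+ b * pp x ^+ 2.
pose DU (x : V) := a%:R * dot x th ^+ a.-1 * dot x xi ^+ b +
   b%:R * dot x xi ^+ b.-1 * dot th xi * dot x th ^+ a.
pose h' (x : V) := DU x * pp x ^+ 2 - 4 * pp x * dot x th * (dot x th ^+ a * dot x xi ^+ b).
have ch : continuous h by rewrite /h /pp; cts.
have ch' : continuous h' by rewrite /h' /DU /pp; cts.
have dh x s : dv (fun s => h (s *: th + x)) s (h' (s *: th + x)).
  have d1 : dv (fun s => dot (s *: th + x) th) s 1.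
    under eq_fun do rewrite dotDl dotZl th1.
    by apply: dv_eq (dvD (dvM (dvId s) (dvC 1 s)) (dvC (dot x th) s)) _; ring.
  have d2 : dv (fun s => dot (s *: th + x) xi) s (dot th xi).
    under eq_fun do rewrite dotDl dotZl.
    by apply: dv_eq (dvD (dvM (dvId s) (dvC (dot th xi) s)) (dvC (dot x xi) s)) _; ring.
  have d3 : dv (fun s => 1 - dot (s *: th + x) (s *: th + x)) s (- 2 * dot (s *: th + x) th).
    have E t : 1 - dot (t *: th + x) (t *: th + x) = 1 - (t ^+ 2 + 2 * dot x th * t + dot x x).
      by rewrite !dotE th1 (dotC th x) expr2; ring.
    under eq_fun do rewrite E.
    apply: dv_eq (dvB (dvC 1 s) (dvD (dvD (dvX 2 (dvId s)) (dvZ (2 * dot x th) (dvId s))) (dvC _ s))) _.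
    by rewrite !dotE th1 expr1; ring.
  apply: dv_eq (dvM (dvM (dvX a d1) (dvX b d2)) (dv_max0X 0 d3)) _.
  by rewrite /h' /DU /pp /= expr1; ring.
pose u (s t : R) := t ^+ n.-1 * SI (fun w => h (s *: th + t *: w)).
pose u' (s t : R) := t ^+ n.-1 * SI (fun w => h' (s *: th + t *: w)).
have cSI (f : V -> R) : continuous f -> continuous (fun z : R * R => z.2 ^+ n.-1 *
    SI (fun w => f (z.1 *: th + z.2 *: w))).
  move=> cf; apply: cfM; first by apply: cfX; exact: cf_snd cf_id.
  apply: (mean_continuous (mean_on_SI n0) (u := fun (z : R * R) w => f (z.1 *: th + z.2 *: w))).
  by apply: (cf_comp _ cf); cts.
have hs x : 1 < enorm x -> h x = 0.
  move=> x1; rewrite /h /pp (elimT max_idPl _) ?expr0n ?mulr0 //.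
  by rewrite -sqr_enorm expr2; nra.
(* [h] is supported in the unit ball, so radius 2 covers its support from every centre s th with |s|
   <= 1. *)
have J s : `|s| <= 1 -> NI (u s) 0 2 = NI (u 0) 0 2.
  move=> s1; apply: (polar_translate n0 ch hs) => //.
    by rewrite enormZ enormE th1 sqrtr1 mulr1; lra.
  by rewrite scale0r enorm0; lra.
have d0 : dv (fun s => NI (u s) 0 2) 0 (NI (u' 0) 0 2).
  apply: NI_derive => //.
  - move=> t s; apply: dvZ; apply: (SI_derive n0 (u := fun s w => h (s *: th + t *: w))
      (u' := fun s w => h' (s *: th + t *: w))).
    + by move=> w r; exact: dh.
    + by move=> r; apply: (cf_comp _ ch); cts.
    + by apply: (cf_comp _ ch'); cts.
  - have cu : continuous (fun z : R * R => u z.1 z.2) by exact: (cSI h ch).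
    by move=> s; exact: cf_left cu.
  - exact: (cSI _ ch').
have Z : NI (u' 0) 0 2 = 0.
  apply: dv_uniq d0 _; apply: dv_near (dvC (NI (u 0) 0 2) 0).
  apply: (near_dist ltr01) => y; rewrite subr0 => y1.
  by apply: J; exact: ltW.
pose A := SI DU; pose B := SI (fun w => dot w th * (dot w th ^+ a * dot w xi ^+ b)).
have cDU : continuous DU by rewrite /DU; cts.
have cB : continuous (fun w : V => dot w th * (dot w th ^+ a * dot w xi ^+ b)) by cts.
have uE t : u' 0 t = t ^+ (n.-1 + (a + b).-1) * Num.max 0 (1 - t ^+ 2) ^+ 2 * A -
   4 * (t ^+ (n.-1 + (a + b)).+1 * Num.max 0 (1 - t ^+ 2)) * B.
  rewrite /u'; have -> : SI (fun w => h' (0 *: th + t *: w)) =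
     SI (fun w => (t ^+ (a + b).-1 * Num.max 0 (1 - t ^+ 2) ^+ 2) * DU w -
      (4 * (t ^+ (a + b).+1 * Num.max 0 (1 - t ^+ 2))) *
      (dot w th * (dot w th ^+ a * dot w xi ^+ b))).
    apply: SI_ext => w /dot_sphere w1; rewrite scale0r add0r /h' /pp /DU !dotE w1.
    rewrite mulr1 -expr2 !exprMn.
    have E1 : a%:R * (t ^+ a.-1 * dot w th ^+ a.-1) * (t ^+ b * dot w xi ^+ b) =
        t ^+ (a + b).-1 * (a%:R * dot w th ^+ a.-1 * dot w xi ^+ b).
      by case: (a) => [|a']; [ring|rewrite /= exprD; ring].
    have E2 : b%:R * (t ^+ b.-1 * dot w xi ^+ b.-1) * dot th xi * (t ^+ a * dot w th ^+ a) =
        t ^+ (a + b).-1 * (b%:R * dot w xi ^+ b.-1 * dot th xi * dot w th ^+ a).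
      by case: (b) => [|b']; [ring|rewrite addnS /= exprD; ring].
    by rewrite E1 E2 [t ^+ (a + b).+1]exprS [t ^+ (a + b)]exprD; ring.
  rewrite SIB ?SIZ //; last 2 first.
  - by apply: cfM => //; exact: cfC.
  - by apply: cfM => //; exact: cfC.
  rewrite -/A -/B.
  have -> : t ^+ (n.-1 + (a + b)).+1 = t ^+ n.-1 * t ^+ (a + b).+1 by rewrite -exprD addnS.
  by rewrite [t ^+ (n.-1 + _)]exprD; ring.
have Bm : B = mom th xi a.+1 b.
  by apply: SI_ext => w _; rewrite exprS mulrA.
have Am : A = a%:R * mom th xi a.-1 b + b%:R * dot th xi * mom th xi a b.-1.
  rewrite /A /mom -!SIZ -?SID; first (apply: SI_ext => w _; rewrite /DU; ring); by cts.
rewrite -Am -Bm -addnA.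
set k := (n.-1 + (a + b))%N in uE *.
pose I1 := NI (fun t : R => t ^+ (n.-1 + (a + b).-1) * Num.max 0 (1 - t ^+ 2) ^+ 2) 0 2.
pose I2 := NI (fun t : R => t ^+ k.+1 * Num.max 0 (1 - t ^+ 2)) 0 2.
have {Z} : I1 * A - 4 * I2 * B = 0.
  rewrite -Z /I1 /I2 mulrC (mulrC _ B) mulrA (mulrC B) -!NIZ; try by cts.
  rewrite -NIB; try by cts.
  by congr NI; apply/funext => t; rewrite uE; ring.
(* For a + b = 0 the truncated predecessor makes the exponent in [I1] one too large for [beta_rel].
   There A = 0, which forces B = 0 unless k = 0. *)
have [ab0|ab0] := posnP (a + b).
  have A0 : A = 0.
    by rewrite Am; move/eqP: ab0; rewrite addn_eq0 => /andP[/eqP-> /eqP->]; ring.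
  rewrite A0 mulr0 sub0r => /eqP; rewrite oppr_eq0 -mulrA => hz.
  have [->|k_gt0] := posnP k; first by rewrite mul0r.
  have [J1 J12] := beta_rel k_gt0; rewrite -/I2 in J12.
  have : 0 < 4 * I2 by rewrite -J12 mulr_gt0 // ltr0n.
  by move: hz; rewrite mulrA mulf_eq0 => /orP[/eqP->|/eqP->]; rewrite ?ltxx ?mulr0.
have k_gt0 : (0 < k)%N by rewrite /k addn_gt0 ab0 orbT.
have [J1 J12] := beta_rel k_gt0; rewrite -/I2 in J12.
have -> : I1 = NI (fun t : R => t ^+ k.-1 * Num.max 0 (1 - t ^+ 2) ^+ 2) 0 2.
  rewrite /I1 /k; suff -> : (n.-1 + (a + b).-1 = (n.-1 + (a + b)).-1)%N by [].
  by case: (a + b)%N ab0 => // c _; rewrite addnS.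
move: J1 J12; set I := NI _ _ _ => J1 J12.
rewrite -J12 => hz; apply: (mulfI (lt0r_neq0 J1)).
by apply/eqP; rewrite -subr_eq0 -hz; apply/eqP; ring.
Qed.

Lemma mom00 th xi : mom th xi 0 0 = 1.
Proof. by rewrite -[RHS](SI_cst n0); apply: SI_ext => w _; rewrite !expr0 mulr1. Qed.

Lemma mom11 th xi : dot th th = 1 -> n%:R * mom th xi 1 1 = dot th xi.
Proof.
move=> th1; have := @mom_rec th xi 0 1 th1.
by rewrite mul0r add0r mom00 mulr1 addn0 addn1 prednK // mul1r => ->.
Qed.

(* The spherical Laplacian of [(w . th)^j (w . xi)^b] is symmetric in the two factors. *)
Lemma mom_sym th xi j b : dot th th = 1 -> dot xi xi = 1 -> (1 < n)%N ->
  (j * j.-1)%:R * mom th xi j.-2 b - (j * (j + n - 2))%:R * mom th xi j b =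
  (b * b.-1)%:R * mom th xi j b.-2 - (b * (b + n - 2))%:R * mom th xi j b.
Proof.
move=> th1 xi1 n1.
suff H p q i k : dot p p = 1 -> (i * i.-1)%:R * mom p q i.-2 k - (i * (i + n - 2))%:R * mom p q i k =
   (i * k)%:R * (mom p q i k - dot p q * mom p q i.-1 k.-1).
  rewrite H // !(mom_swap th xi _ b.-2) (mom_swap th xi j b) (mom_swap th xi j.-1).
  by rewrite H // mulnC (dotC th xi).
move=> p1; case: i => [|i]; first by rewrite !mul0n !mul0r subrr.
have := @mom_rec p q i k p1.
have -> : (i.+1 + n - 2 = n.-1 + i)%N by case: n n1 => [|[|n']] // _; rewrite addSn !addnS !subSS subn0 addnC.
rewrite /= !natrM !natrD => h.
have -> : i.+1%:R * i%:R * mom p q i.-1 k = i.+1%:R * (i%:R * mom p q i.-1 k) by ring.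
move: h; set A := i%:R * _; set B := mom p q i.+1 k; set C := dot p q => h.
have -> : A = (n.-1%:R + i%:R + k%:R) * B - k%:R * C * mom p q i k.-1 by rewrite -h; ring.
ring.
Qed.

End moments.


(** * Gegenbauer coefficients and moment systems *)

Section zonal_sequences.
Context {R : realType} (n : nat).
Hypothesis n1 : (1 < n)%N.

(* Minus the eigenvalue of the spherical Laplacian on harmonics of degree [j]. *)
Definition lam (j : nat) : R := (j * (j + n - 2))%:R.

Lemma lam_inj j l : lam j = lam l -> j = l.
Proof.
move/eqP; rewrite eqr_nat => /eqP h.
have aux a b : (a < b)%N -> (a * (a + n - 2) < b * (b + n - 2))%N.
  move=> ab; apply: (@leq_ltn_trans (a * (b + n - 2))).
    by rewrite leq_mul2l leq_sub2r ?orbT // leq_add2r ltnW.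
  rewrite ltn_pmul2r // -addnBA //; case: b ab => // b _.
by case: (ltngtP j l) => // /aux; rewrite h ltnn.
Qed.

(** What remains of the self-adjointness of the spherical Laplacian on (w.th)^j (w.xi)^b once the
    symmetric mixed term cancels. The sphere moments and the weighted moments of z^(j+b) on [-1, 1]
    both satisfy it. *)
Definition moment_system (W : nat -> nat -> R) : Prop := forall j b,
  (j * j.-1)%:R * W j.-2 b - lam j * W j b =
  (b * b.-1)%:R * W j b.-2 - lam b * W j b.

Context (l : nat).

(** Coefficient of z^(l-k): the recursion runs down from the leading coefficient 1, in steps of
    two. *)
Fixpoint zcoef_rev (k : nat) : R :=
  match k with
  | 0 => 1
  | 1 => 0
  | k'.+2 => ((l - k') * (l - k').-1)%:R * zcoef_rev k' / (lam (l - k').-2 - lam l)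
  end.

(* Coefficients of the monic Gegenbauer polynomial of degree [l], the zonal harmonic. *)
Definition zcoef (b : nat) : R := if (b <= l)%N then zcoef_rev (l - b) else 0.

Lemma zcoef_lead : zcoef l = 1.
Proof. by rewrite /zcoef leqnn subnn. Qed.

(** The Gegenbauer equation, coefficient by coefficient. At b = l and b = l - 1 the left side is cut
    off; the right side then vanishes, by the eigenvalue and by parity respectively. *)
Lemma zcoef_rec b : (b.+2 * b.+1)%:R * zcoef b.+2 = (lam b - lam l) * zcoef b.
Proof.
rewrite /zcoef; have [bl|lb] := leqP b.+2 l.
  have bl2 : (b <= l)%N by lia.
  rewrite bl2; have [k kE] : exists k, l = (b.+2 + k)%N.
    by exists (l - b.+2)%N; rewrite subnKC.
  have -> : (l - b = k.+2)%N by lia.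
  have -> : (l - b.+2 = k)%N by rewrite kE addKn.
  rewrite /=; have -> : (l - k = b.+2)%N by rewrite kE addnK.
  rewrite /= [RHS]mulrC mulfVK // subr_eq0; apply/eqP => /lam_inj E.
  by move: bl; rewrite -E; lia.
rewrite mulr0; have [bl|//] := leqP b l; last by rewrite mulr0.
have [->|bl'] := eqVneq b l; first by rewrite subrr mul0r.
have -> : (l - b = 1)%N by lia.
by rewrite /= mulr0.
Qed.

Definition zsum (W : nat -> nat -> R) (j : nat) : R := \sum_(b < l.+1) zcoef b * W j b.

(** The symmetry moves the Laplacian from z^j to the Gegenbauer factor, which is an eigenfunction
    for [lam l]. *)
Lemma zsum_rec W j : moment_system W ->
  (j * j.-1)%:R * zsum W j.-2 = (lam j - lam l) * zsum W j.
Proof.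
move=> mW.
suff : (j * j.-1)%:R * zsum W j.-2 - lam j * zsum W j = - lam l * zsum W j by move=> h; lra.
rewrite /zsum !mulr_sumr -sumrB.
under eq_bigr => b _.
  rewrite mulrCA (mulrCA (lam j)) -mulrBr mW; over.
pose f b : R := zcoef b * (b * b.-1)%:R * W j b.-2.
pose g b : R := zcoef b * lam b * W j b.
transitivity (\sum_(b < l.+3) f b - \sum_(b < l.+1) g b).
  have f1 : f l.+1 = 0 by rewrite /f /zcoef ltnn !mul0r.
  have f2 : f l.+2 = 0 by rewrite /f /zcoef ltnNge leqnSn /= !mul0r.
  rewrite [\sum_(b < l.+3) _]big_ord_recr [\sum_(b < l.+2) _]big_ord_recr /= f1 f2 !addr0.
  rewrite -sumrB; apply: eq_bigr => b _; rewrite /f /g; ring.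
have -> : \sum_(b < l.+3) f b = \sum_(b < l.+1) f b.+2.
  have g0 : f 0%N = 0 by rewrite /f mul0n mulr0 mul0r.
  have g1 : f 1%N = 0 by rewrite /f muln0 mulr0 mul0r.
  by rewrite big_ord_recl [X in _ + X]big_ord_recl /= g0 g1 !add0r.
rewrite -sumrB; apply: eq_bigr => b _; rewrite /f /g /=.
have := zcoef_rec b; set Z := zcoef b.+2 => h.
have -> : Z * (b.+2 * b.+1)%:R = (lam b - lam l) * zcoef b by rewrite -h mulrC.
ring.
Qed.

(** By [zsum_rec], the value at j != l is a multiple of the value at j - 2, with a factor common to
    all systems; so the value at j = l fixes the rest. This proportionality is Funk-Hecke for
    monomials. *)
Lemma zsum_prop W W' j : moment_system W -> moment_system W' ->
  zsum W l * zsum W' j = zsum W' l * zsum W j.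
Proof.
move=> mW mW'; have [k] := ubnP j; elim: k j => // k IH j jk.
have [->|jl] := eqVneq j l; first by rewrite mulrC.
have lj : lam j - lam l != 0.
  by rewrite subr_eq0; apply: contra jl => /eqP/lam_inj->.
apply: (mulfI lj); rewrite !(mulrCA (lam j - lam l)) -!zsum_rec //.
case: j jk jl lj => [|[|j]] jk jl lj; rewrite ?mul0n ?muln0 ?mul0r ?mulr0 //=.
by rewrite mulrCA (mulrCA (zsum W' l)) IH //; lia.
Qed.

End zonal_sequences.

Section funk_hecke_poly.
Context {R : realType} (m : nat).
Local Notation n := (2 * m + 3)%N.
Local Notation V := 'rV[R]_n.
Implicit Types (th xi : V).

Let n0 : (0 < n)%N. Proof. by rewrite addnS. Qed.
Let n1 : (1 < n)%N. Proof. by rewrite !addnS. Qed.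

Definition wt (z : R) : R := (1 - z ^+ 2) ^+ m.

Definition bmom (k : nat) : R := NI (fun z => z ^+ k * wt z) (-1) 1.

(** The function z^k (1 - z^2)^(m+1) vanishes at both ends, so its derivative integrates to 0. *)
Lemma bmom_rec k : k%:R * bmom k.-1 = (k + n.-1)%:R * bmom k.+1.
Proof.
have : NI (fun z => k%:R * (z ^+ k.-1 * wt z) - (k + n.-1)%:R * (z ^+ k.+1 * wt z)) (-1) 1 = 0.
  rewrite (NI_FTC (F := fun z => z ^+ k * (1 - z ^+ 2) ^+ m.+1)).
  - by rewrite sqrrN !expr1n subrr expr0n /= !mulr0 subrr.
  - by rewrite /wt; cts.
  move=> z; have d1 : dv (fun z : R => 1 - z ^+ 2) z (0 - 2%:R * z ^+ 1 * 1).
    by apply: dvB; [exact: dvC|exact: dvX (dvId z)].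
  apply: dv_eq (dvM (dvX k (dvId z)) (dvX m.+1 d1)) _.
  rewrite /wt /= expr1 exprS; have -> : z ^+ k.+1 = z * z ^+ k by rewrite exprS.
  have -> : (k + n.-1)%:R = k%:R + 2 * m.+1%:R :> R by rewrite -natrM -natrD; congr (_%:R); lia.
  case: k => [|k] /=; first by ring.
  by rewrite [z ^+ k.+1]exprS; ring.
rewrite NIB ?NIZ -/(bmom _); try by rewrite /wt; cts.
by move=> /eqP; rewrite subr_eq0 => /eqP.
Qed.

Lemma moment_system_bmom : moment_system n (fun j b => bmom (j + b)).
Proof.
move=> j b; rewrite /lam.
have jE (i : nat) : (i + n - 2 = i + (2 * m + 1))%N by lia.
rewrite !jE.
have pE (i : nat) : (i * i.-1)%:R = i%:R * (i%:R - 1) :> R.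
  by case: i => [|i] /=; rewrite ?mul0n ?mul0r // natrM -natr1; ring.
have -> : (j * j.-1)%:R * bmom (j.-2 + b) = (j * j.-1)%:R * bmom (j + b).-2.
  by case: j => [|[|j]]; rewrite ?mul0n ?muln0 ?mul0r.
have -> : (b * b.-1)%:R * bmom (j + b.-2) = (b * b.-1)%:R * bmom (j + b).-2.
  by case: b => [|[|b]]; rewrite ?mul0n ?muln0 ?mul0r // !addnS.
have [jb|jb] := posnP (j + b).
  by have [-> ->] : (j = 0 /\ b = 0)%N by lia.
have h := bmom_rec (j + b).-1; rewrite prednK // in h.
rewrite !pE !natrM !natrD; have sE : (j + b).-1%:R = j%:R + b%:R - 1 :> R.
  by rewrite -natrD -[in RHS](prednK jb) -natr1; ring.
have h2 : (j%:R + b%:R - 1) * bmom (j + b).-2 =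
   (j%:R + b%:R + (2 * m%:R + 1)) * bmom (j + b).
  have -> : (2 * m%:R + 1 : R) = (2 * m + 1)%:R by rewrite natrD natrM.
  rewrite -sE h natrD sE; congr (_ * _).
  have -> : n.-1 = (2 * m + 1).+1 by lia.
  by rewrite -natr1; ring.
have : (j%:R - b%:R) * ((j%:R + b%:R - 1) * bmom (j + b).-2) =
  (j%:R - b%:R) * ((j%:R + b%:R + (2 * m%:R + 1)) * bmom (j + b)) by rewrite h2.
by move=> h3; apply/eqP; rewrite -subr_eq0; move/eqP: h3; rewrite -subr_eq0 => /eqP <-; apply/eqP; ring.
Qed.


Lemma moment_system_mom th xi : dot th th = 1 -> dot xi xi = 1 ->
  moment_system n (mom th xi).
Proof. by move=> th1 xi1 j b; exact: mom_sym. Qed.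

End funk_hecke_poly.

(** * Weierstrass approximation *)

Section bernstein.
Context {R : realType}.

(** Bernstein polynomial with node values [phi k], by the de Casteljau recursion: monotonicity,
    linearity and moments then follow by induction without binomial sums. *)
Fixpoint bern (N : nat) (phi : nat -> R) : {poly R} :=
  if N is N'.+1 then (1 - 'X) * bern N' phi + 'X * bern N' (fun k => phi k.+1)
  else (phi 0%N)%:P.

Lemma bernS N phi x : (bern N.+1 phi).[x] =
  (1 - x) * (bern N phi).[x] + x * (bern N (fun k => phi k.+1)).[x].
Proof. by rewrite /= !hornerE. Qed.

Lemma bern_le N phi psi x : 0 <= x <= 1 -> (forall k, (k <= N)%N -> phi k <= psi k) ->
  (bern N phi).[x] <= (bern N psi).[x].
Proof.
move=> /andP[x0 x1]; elim: N phi psi => [|N IH] phi psi h.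
  by rewrite /= !hornerE h.
rewrite !bernS; apply: lerD; (apply: ler_wpM2l; [by lra|]); apply: IH => k kN.
  by apply: h; exact: leqW.
exact: h.
Qed.

Lemma bern_lin N phi psi c d x :
  (bern N (fun k => c * phi k + d * psi k)).[x] =
  c * (bern N phi).[x] + d * (bern N psi).[x].
Proof.
elim: N phi psi => [|N IH] phi psi; first by rewrite /= !hornerE.
by rewrite !bernS IH (IH (fun k => phi k.+1) (fun k => psi k.+1)); ring.
Qed.

Lemma bern_sqr N c x : (bern N (fun k => (k%:R - c) ^+ 2)).[x] =
  N%:R * x * (1 - x) + (N%:R * x - c) ^+ 2.
Proof.
elim: N c => [|N IH] c; first by rewrite /= !hornerE; ring.
rewrite bernS IH.
have -> : (fun k : nat => (k.+1%:R - c) ^+ 2) = (fun k : nat => (k%:R - (c - 1)) ^+ 2).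
  by apply/funext => k; rewrite -natr1; ring.
by rewrite IH -natr1; ring.
Qed.

Lemma bern_cst N c x : (bern N (fun=> c)).[x] = c.
Proof.
elim: N => [|N IH]; first by rewrite /= hornerE.
by rewrite bernS IH; ring.
Qed.

(** Bernstein's argument: |f y - f x| is at most e/2 + K (y - x)^2, where K pays for the points at
    distance at least d, and the Bernstein operator turns the square into a variance of order
    1/N. *)
Lemma weierstrass01 (f : R -> R) e : continuous f -> 0 < e ->
  exists p : {poly R}, forall x, 0 <= x <= 1 -> `|f x - p.[x]| <= e.
Proof.
move=> cf e0.
have ck : compact [set` `[(0:R), 1]] by exact: segment_compact.
have [M M0 hM] : exists2 M, 0 <= M & forall x, 0 <= x <= 1 -> `|f x| <= M.
  have [M [_ h]] : bounded_set (f @` [set` `[(0:R), 1]]).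
    apply: compact_bounded; apply: continuous_compact => //.
    exact: continuous_subspaceT.
  exists (`|M| + 1); first by rewrite addr_ge0.
  move=> x x01; apply: (h (`|M| + 1)); last by exists x => //=; rewrite in_itv.
  by rewrite (le_lt_trans (ler_norm _)) // ltrDl.
have e2 : 0 < e / 2 by rewrite divr_gt0.
have cu : continuous (fun z : R * R => f (z.2 + z.1)).
  by apply: (cf_comp _ cf); cts.
have [d d0 hd] := dist_near (near_compact (u := fun t x => f (x + t)) 0 ck cu e2).
pose K := 2 * M / d ^+ 2.
have K0 : 0 <= K by rewrite divr_ge0 ?sqr_ge0 // mulr_ge0.
have fb x y : 0 <= x <= 1 -> 0 <= y <= 1 -> `|f y - f x| <= e / 2 + K * (y - x) ^+ 2.
  move=> x01 y01; have [h|h] := ltP `|y - x| d.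
    have := hd (y - x); rewrite subr0 => /(_ h x) /=; rewrite in_itv /=.
    rewrite addr0 (_ : x + (y - x) = y) => [/(_ x01) /ltW|]; last by ring.
    move/le_trans; apply.
    by rewrite lerDl mulr_ge0 ?sqr_ge0.
  apply: (@le_trans _ _ (2 * M)).
    by apply: le_trans (ler_normB _ _) _; have := hM _ x01; have := hM _ y01; lra.
  apply: (@le_trans _ _ (K * (y - x) ^+ 2)); last by rewrite lerDr ltW.
  rewrite /K mulrAC ler_pdivlMr ?exprn_gt0 // ler_wpM2l ?mulr_ge0 //.
  by rewrite -[leRHS]real_normK ?num_real // lerXn2r // nnegrE ltW.
pose N := (Num.truncn (2 * K / e)).+1.
have Ne : 2 * K / e < N%:R := truncnS_gt _.
have N0 : 0 < N%:R :> R by rewrite ltr0n.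
exists (bern N (fun k => f (k%:R / N%:R))) => x x01; have /andP[x0 x1] := x01.
have kN k : (k <= N)%N -> 0 <= (k%:R / N%:R : R) <= 1.
  by move=> h; rewrite divr_ge0 //= ler_pdivrMr // mul1r ler_nat.
(* The sign s lets one monotonicity argument serve both sides of the absolute value. *)
have bound (s : R) : `|s| = 1 -> s * ((bern N (fun k => f (k%:R / N%:R))).[x] - f x) <= e.
  move=> s1.
  have -> : s * ((bern N (fun k => f (k%:R / N%:R))).[x] - f x) =
      (bern N (fun k => s * f (k%:R / N%:R) + (- s * f x) * 1)).[x].
    by rewrite bern_lin bern_cst; ring.
  apply: (@le_trans _ _ (bern N (fun k => (e / 2) * 1 + K / N%:R ^+ 2 * (k%:R - N%:R * x) ^+ 2)).[x]).
    apply: bern_le => // k /kN k01; rewrite !mulr1 mulNr -mulrBr.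
    apply: le_trans (ler_norm _) _; rewrite normrM s1 mul1r.
    apply: le_trans (fb _ _ x01 k01) _; rewrite lerD2l //.
    have -> : k%:R / N%:R - x = (k%:R - N%:R * x) / N%:R by field; rewrite lt0r_neq0.
    by rewrite expr_div_n mulrA mulrAC.
  rewrite bern_lin bern_cst bern_sqr subrr expr0n /= addr0 mulr1.
  have x2 : x * (1 - x) <= 1 by nra.
  have : K / N%:R <= e / 2.
    rewrite ler_pdivrMr //; move: Ne; rewrite ltr_pdivrMr // => h.
    by rewrite mulrAC ler_pdivlMr // mulrC (mulrC e) ltW.
  have -> : K / N%:R ^+ 2 * (N%:R * x * (1 - x)) = K / N%:R * (x * (1 - x)).
    by field; rewrite lt0r_neq0.
  have : 0 <= K / N%:R by rewrite divr_ge0 // ltW.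
  move: (K / N%:R) => q q0 qe; nra.
rewrite distrC ler_norml; apply/andP; split.
  by have := bound (-1); rewrite normrN1 => /(_ erefl); lra.
by have := bound 1; rewrite normr1 => /(_ erefl); lra.
Qed.

Lemma weierstrass (f : R -> R) e : continuous f -> 0 < e ->
  exists p : {poly R}, forall x, -1 <= x <= 1 -> `|f x - p.[x]| <= e.
Proof.
move=> cf e0.
have cg : continuous (fun x : R => f (2 * x - 1)) by apply: (cf_comp _ cf); cts.
have [p hp] := weierstrass01 cg e0.
exists (p \Po (2^-1 *: ('X + 1))) => x /andP[x0 x1].
have := hp (2^-1 * (x + 1)); rewrite horner_comp !hornerE /=.
have -> : 2 / 2 * (x + 1) - 1 = x by field.
by apply; apply/andP; split; lra.
Qed.

End bernstein.


Section funk_hecke.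
Context {R : realType} (m : nat).
Local Notation n := (2 * m + 3)%N.
Local Notation V := 'rV[R]_n.
Implicit Types (th xi : V).

Let n0 : (0 < n)%N. Proof. by rewrite addnS. Qed.
Let n1 : (1 < n)%N. Proof. by rewrite !addnS. Qed.

Local Notation wm := (@wt R m).
Local Notation bsys := (fun j b => @bmom R m (j + b)).

Definition zpoly (l : nat) (z : R) : R := \sum_(b < l.+1) zcoef n l b * z ^+ b.

Lemma cf_zpoly (T : topologicalType) l (f : T -> R) : continuous f ->
  continuous (fun x => zpoly l (f x)).
Proof. by move=> cf; apply: cf_sum => i; cts. Qed.

Lemma cf_wt (T : topologicalType) (f : T -> R) : continuous f ->
  continuous (fun x => wm (f x)).
Proof. by move=> cf; rewrite /wt; cts. Qed.

Lemma SI_zpoly_mom l th xi j :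
  SI (fun w => zpoly l (dot w xi) * dot w th ^+ j) = zsum n l (mom th xi) j.
Proof.
transitivity (\sum_(b < l.+1) SI (fun w => zcoef n l b * (dot w th ^+ j * dot w xi ^+ b)));
  last by apply: eq_bigr => b _; rewrite SIZ //; cts.
rewrite -SI_sum //; last by move=> i; cts.
by apply: SI_ext => w _; rewrite mulr_suml; apply: eq_bigr => i _; ring.
Qed.

Lemma NI_zpoly_bmom l j :
  NI (fun z => z ^+ j * (zpoly l z * wm z)) (-1) 1 = zsum n l bsys j.
Proof.
rewrite /zsum /bmom; under [RHS]eq_bigr => i _.
  rewrite -NIZ; last by rewrite /wt; cts.
  over.
rewrite -NI_sum; last by move=> i; rewrite /wt; cts.
congr NI; apply/funext => z; rewrite mulr_suml mulr_sumr.
by apply: eq_bigr => i _; rewrite exprD; ring.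
Qed.

(** The integral of z^l [zpoly l z] against the weight; it normalises [fhc]. *)
Definition fhN l : R := zsum n l bsys l.

Lemma wt_ge0 z : -1 <= z <= 1 -> 0 <= wm z.
Proof. by move=> /andP[h1 h2]; rewrite exprn_ge0 // expr2; nra. Qed.

(** A nonzero polynomial [p] cannot vanish at [size p] distinct points; the points (i+1)/(size p +
    1) all lie in (0, 1). *)
Lemma zpoly_neq0 l : exists z : R, -1 < z < 1 /\ zpoly l z != 0.
Proof.
pose p : {poly R} := \poly_(b < l.+1) zcoef n l b.
have pE z : zpoly l z = p.[z] by rewrite horner_poly.
have p0 : p != 0.
  by apply/eqP => /(congr1 (fun q : {poly R} => q`_l)); rewrite coef_poly ltnSn coef0
    zcoef_lead => /eqP; rewrite oner_eq0.
have : exists2 i : 'I_(size p), true & p.[i.+1%:R / (size p).+1%:R] != 0.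
  apply: contrapT => h.
  have h2 (i : 'I_(size p)) : root p (i.+1%:R / (size p).+1%:R).
    by apply/rootP/eqP; apply/negPn/negP => hi; apply: h; exists i.
  have := @max_poly_roots _ p [seq (i.+1%:R / (size p).+1%:R : R) | i : 'I_(size p) <- enum 'I_(size p)] p0.
  rewrite size_map size_enum_ord ltnn => H; suff : false by [].
  apply: H; first by apply/allP => z /mapP[i _ ->].
  rewrite map_inj_uniq ?enum_uniq // => i j.
  move=> /(congr1 (fun z => z * (size p).+1%:R)); rewrite !mulfVK ?pnatr_eq0 //.
  by move=> /eqP; rewrite eqr_nat eqSS => /eqP/val_inj.
move=> [i _ h]; exists (i.+1%:R / (size p).+1%:R); rewrite pE; split => //.
have s0 : 0 < (size p).+1%:R :> R by rewrite ltr0n.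
apply/andP; split; first by apply: lt_trans (divr_gt0 _ s0); rewrite ?ltr0n // ltrN10.
by rewrite ltr_pdivrMr // mul1r ltr_nat ltnS.
Qed.

(** Otherwise [zsum_rec] would make [zpoly l] orthogonal to every power of z, hence to itself. *)
Lemma fhN_neq0 l : fhN l != 0.
Proof.
apply/eqP => N0.
have mB := @moment_system_bmom R m.
have Nj j : zsum n l bsys j = 0.
  have [k] := ubnP j; elim: k j => // k IH j jk.
  have [->//|jl] := eqVneq j l.
  have lj : lam n j - lam n l != 0 :> R.
    by rewrite subr_eq0; apply: contra jl => /eqP/(lam_inj n1)->.
  apply: (mulfI lj); rewrite -zsum_rec // mulr0.
  case: j jk jl {lj} => [|[|j]] jk jl; rewrite ?mul0n ?muln0 ?mul0r //=.
  by rewrite IH ?mulr0 //; lia.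
have : NI (fun z => zpoly l z * (zpoly l z * wm z)) (-1) 1 = 0.
  transitivity (\sum_(j < l.+1) zcoef n l j * zsum n l bsys j : R); last first.
    by rewrite big1 // => j _; rewrite Nj mulr0.
  under [RHS]eq_bigr => i _.
    rewrite -NI_zpoly_bmom -NIZ; last first.
      by apply: cfM; [cts|apply: cfM; [apply: cf_zpoly|apply: cf_wt]; exact: cf_id].
    over.
  rewrite -NI_sum; last first.
    by move=> i; apply: cfM; [cts|apply: cfM; [cts|apply: cfM; [apply: cf_zpoly|apply: cf_wt]; exact: cf_id]].
  congr NI; apply/funext => z; rewrite {1}/zpoly mulr_suml.
  by apply: eq_bigr => i _; ring.
apply/eqP/lt0r_neq0; have [c [c1 c0]] := zpoly_neq0 l.
apply: (@NI_gt0 _ _ _ _ c) => //.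
- by apply: cfM; [apply: cf_zpoly|apply: cfM; [apply: cf_zpoly|apply: cf_wt]]; exact: cf_id.
- by move=> z /wt_ge0 h; rewrite mulrA -expr2 mulr_ge0 // sqr_ge0.
- rewrite mulrA -expr2 mulr_gt0 //; first by rewrite lt_def sqrf_eq0 c0 sqr_ge0.
  by rewrite exprn_gt0 // expr2; move/andP: c1 => [? ?]; nra.
Qed.

(** Angular factor of Funk-Hecke. As a ratio of moments it is visibly continuous in [th] and the
    same for every profile; for l = 0 it is the constant [kap m]. *)
Definition fhc l th xi : R := zsum n l (mom th xi) l / fhN l.

Lemma sphere_dot_itv th xi : esphere R n th -> esphere R n xi -> -1 <= dot th xi <= 1.
Proof.
move=> h1 h2; rewrite -ler_norml; apply: le_trans (dot_le _ _) _.
by rewrite h1 h2 mulr1.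
Qed.

Lemma funk_hecke_poly l th xi (p : {poly R}) : esphere R n th -> esphere R n xi ->
  SI (fun w => zpoly l (dot w xi) * p.[dot w th]) =
  fhc l th xi * NI (fun z => p.[z] * (zpoly l z * wm z)) (-1) 1.
Proof.
move=> Sth Sxi.
have mM : moment_system n (mom th xi).
  by apply: moment_system_mom; exact: dot_sphere.
have mB := @moment_system_bmom R m.
have E j : zsum n l (mom th xi) j = fhc l th xi * zsum n l bsys j.
  rewrite /fhc mulrAC (zsum_prop n1 l j mM mB) -/(fhN l) mulrAC mulfV ?mul1r //.
  exact: fhN_neq0.
transitivity (\sum_(i < size p) p`_i * zsum n l (mom th xi) i).
  under [RHS]eq_bigr => i _.
    rewrite -SI_zpoly_mom -SIZ //; last first.
      by apply: cfM; [apply: cf_zpoly|]; cts.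
    over.
  rewrite -SI_sum //; last by move=> i; apply: cfM; [cts|apply: cfM; [apply: cf_zpoly|]; cts].
  apply: SI_ext => w _; rewrite horner_coef mulr_sumr.
  by apply: eq_bigr => i _; ring.
transitivity (fhc l th xi * \sum_(i < size p) p`_i * zsum n l bsys i).
  by rewrite mulr_sumr; apply: eq_bigr => i _; rewrite E; ring.
congr (_ * _); under eq_bigr => i _.
  rewrite -NI_zpoly_bmom -NIZ; last first.
    by apply: cfM; [cts|apply: cfM; [apply: cf_zpoly|apply: cf_wt]; exact: cf_id].
  over.
rewrite -NI_sum; last first.
  by move=> i; apply: cfM; [cts|apply: cfM; [cts|apply: cfM; [apply: cf_zpoly|apply: cf_wt]; exact: cf_id]].
congr NI; apply/funext => z; rewrite horner_coef [RHS]mulr_suml.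
by apply: eq_bigr => i _; ring.
Qed.

Lemma continuous_itv_bounded (f : R -> R) a b : continuous f ->
  exists2 M, 0 <= M & forall x, a <= x <= b -> `|f x| <= M.
Proof.
move=> cf.
have [M [_ h]] : bounded_set (f @` [set` `[a, b]]).
  apply: compact_bounded; apply: continuous_compact; last exact: segment_compact.
  exact: continuous_subspaceT.
exists (`|M| + 1); first by rewrite addr_ge0.
move=> x xab; apply: (h (`|M| + 1)); last by exists x => //=; rewrite in_itv.
by rewrite (le_lt_trans (ler_norm _)) // ltrDl.
Qed.

Lemma cf_horner (T : topologicalType) (p : {poly R}) (f : T -> R) : continuous f ->
  continuous (fun x => p.[f x]).
Proof. by move=> cf; under eq_fun do rewrite horner_coef; apply: cf_sum => i; cts. Qed.

(** Both sides are linear in [psi] and bounded by a multiple of its supremum on [-1, 1], so the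
    polynomial case extends by Weierstrass. *)
Theorem funk_hecke l th xi (psi : R -> R) : esphere R n th -> esphere R n xi ->
  continuous psi ->
  SI (fun w => zpoly l (dot w xi) * psi (dot w th)) =
  fhc l th xi * NI (fun z => psi z * (zpoly l z * wm z)) (-1) 1.
Proof.
move=> Sth Sxi cpsi.
have cz : continuous (fun z => zpoly l z * wm z).
  by apply: cfM; [apply: cf_zpoly|apply: cf_wt]; exact: cf_id.
have czp : continuous (zpoly l) by apply: cf_zpoly; exact: cf_id.
have [M1 M10 hM1] := @continuous_itv_bounded _ (-1) 1 czp.
have [M2 M20 hM2] := @continuous_itv_bounded _ (-1) 1 cz.
set b := fhc l th xi.
apply/eqP; rewrite -subr_eq0 -normr_le0; apply/ler_addgt0Pl => e e0; rewrite addr0.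
pose C := M1 + `|b| * (M2 * 2) + 1.
have C0 : 0 < C by rewrite ltr_wpDl // addr_ge0 // mulr_ge0 // mulr_ge0.
have [p hp] := weierstrass cpsi (divr_gt0 e0 C0).
have cwx (v : V) : continuous (fun w : V => dot w v) by cts.
have cS (q : R -> R) : continuous q ->
    continuous (fun w : V => zpoly l (dot w xi) * q (dot w th)).
  move=> cq; apply: cfM; first exact: cf_zpoly.
  exact: (cf_comp (cwx th) cq).
have cN (q : R -> R) : continuous q -> continuous (fun z => q z * (zpoly l z * wm z)).
  by move=> cq; exact: cfM.
have cp : continuous (fun z => p.[z]) by apply: cf_horner; exact: cf_id.
have := funk_hecke_poly l p Sth Sxi; rewrite -/b => E.
have -> : SI (fun w => zpoly l (dot w xi) * psi (dot w th)) -
    b * NI (fun z => psi z * (zpoly l z * wm z)) (-1) 1 =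
    SI (fun w => zpoly l (dot w xi) * (psi (dot w th) - p.[dot w th])) -
    b * NI (fun z => (psi z - p.[z]) * (zpoly l z * wm z)) (-1) 1.
  have -> : SI (fun w => zpoly l (dot w xi) * (psi (dot w th) - p.[dot w th])) =
      SI (fun w => zpoly l (dot w xi) * psi (dot w th) - zpoly l (dot w xi) * p.[dot w th]).
    by apply: SI_ext => w _; rewrite mulrBr.
  have -> : NI (fun z => (psi z - p.[z]) * (zpoly l z * wm z)) (-1) 1 =
      NI (fun z => psi z * (zpoly l z * wm z) - p.[z] * (zpoly l z * wm z)) (-1) 1.
    by congr NI; apply/funext => z; rewrite mulrBl.
  rewrite SIB ?NIB ?E; try exact: cN; try exact: cS.
  by ring.
set e1 := e / C in hp.
have e10 : 0 <= e1 by apply/ltW/divr_gt0.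
have cd : continuous (fun z => psi z - p.[z]) by exact: cfB.
apply: le_trans (ler_normB _ _) _.
have h1 : `|SI (fun w => zpoly l (dot w xi) * (psi (dot w th) - p.[dot w th]))| <= M1 * e1.
  apply: (SI_norm_le n0); first exact: (cS _ cd).
  move=> w Sw; rewrite normrM; apply: ler_pM => //.
    by apply: hM1; exact: sphere_dot_itv.
  by apply: hp; exact: sphere_dot_itv.
have h2 : `|NI (fun z => (psi z - p.[z]) * (zpoly l z * wm z)) (-1) 1| <= e1 * M2 * (1 - -1).
  apply: NI_norm_le; [exact: (cN _ cd)|lra|].
  by move=> z z1; rewrite normrM; apply: ler_pM => //; [exact: hp|exact: hM2].
have h3 : `|b * NI (fun z => (psi z - p.[z]) * (zpoly l z * wm z)) (-1) 1| <=
   `|b| * (e1 * M2 * 2).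
  rewrite normrM ler_wpM2l //; apply: le_trans h2 _; rewrite le_eqVlt; apply/orP; left.
  by apply/eqP; ring.
apply: le_trans (lerD h1 h3) _.
have -> : e = e1 * C by rewrite /e1 mulfVK // lt0r_neq0.
have -> : M1 * e1 + `|b| * (e1 * M2 * 2) = e1 * (M1 + `|b| * (M2 * 2)) by ring.
by rewrite ler_wpM2l // /C lerDl.
Qed.

Lemma cf_fhc (T : topologicalType) l (f : T -> V) xi : continuous f ->
  continuous (fun x => fhc l (f x) xi).
Proof.
move=> cf; rewrite /fhc; apply: cfM; last exact: cst_continuous.
under eq_fun do rewrite -SI_zpoly_mom.
apply: (mean_continuous (mean_on_SI n0)
  (u := fun x w => zpoly l (dot w xi) * dot w (f x) ^+ l)).
apply: cfM; first by apply: cf_zpoly; cts.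
apply: cfX; apply: cf_dot; first by cts.
by move=> z; apply: (@continuous_comp _ _ _ fst f); [exact: cvg_fst|exact: cf].
Qed.

Definition kap : R := (NI wm (-1) 1)^-1.

Lemma NI_wt_gt0 : 0 < NI wm (-1) 1.
Proof.
apply: (@NI_gt0 _ _ _ _ 0).
- by apply: cf_wt; exact: cf_id.
- exact: wt_ge0.
- by rewrite ltrN10 ltr01.
- by rewrite /wt expr0n subr0 expr1n.
Qed.

Lemma kap_gt0 : 0 < kap.
Proof. by rewrite invr_gt0 NI_wt_gt0. Qed.

Lemma zpoly0 z : zpoly 0 z = 1.
Proof. by rewrite /zpoly big_ord_recl big_ord0 addr0 expr0 mulr1 zcoef_lead. Qed.

Lemma fhc0 th xi : fhc 0 th xi = kap.
Proof.
rewrite /fhc /fhN /kap /zsum !big_ord_recl !big_ord0 !addr0 !zcoef_lead !mul1r mom00 //.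
by rewrite mul1r /bmom; congr (NI _ _ _)^-1; apply/funext => z; rewrite mul1r.
Qed.

Lemma SI_zonal th (psi : R -> R) : esphere R n th -> continuous psi ->
  SI (fun w => psi (dot w th)) = kap * NI (fun z => psi z * wm z) (-1) 1.
Proof.
move=> Sth cpsi; have := @funk_hecke 0 th th psi Sth Sth cpsi; rewrite fhc0.
under eq_fun do rewrite zpoly0 mul1r.
move=> ->; congr (_ * NI _ _ _); apply/funext => z; by rewrite zpoly0 mul1r.
Qed.

(** The case of degree 1, where [mom11] makes [fhc 1 th xi] proportional to th . xi; taking xi = th
    reduces the remaining constant to [SI_zonal]. *)
Lemma SI_zonal1 th xi (psi : R -> R) : esphere R n th -> esphere R n xi -> continuous psi ->
  SI (fun w => dot w xi * psi (dot w th)) =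
  dot th xi * (kap * NI (fun z => psi z * (z * wm z)) (-1) 1).
Proof.
move=> Sth Sxi cpsi.
have z1 z : zpoly 1 z = z.
  rewrite /zpoly !big_ord_recl big_ord0 addr0 /= expr0 expr1 /zcoef /= mul0r add0r.
  by rewrite mul1r.
have FH xi' : esphere R n xi' -> SI (fun w => dot w xi' * psi (dot w th)) =
    fhc 1 th xi' * NI (fun z => psi z * (z * wm z)) (-1) 1.
  move=> Sxi'; have := @funk_hecke 1 th xi' psi Sth Sxi' cpsi.
  under eq_fun do rewrite z1; move=> ->.
  by congr (_ * NI _ _ _); apply/funext => z; rewrite z1.
have c1 : fhc 1 th xi = dot th xi * fhc 1 th th.
  rewrite /fhc mulrA; congr (_ / _).
  rewrite /zsum !big_ord_recl !big_ord0 /= /zcoef /bump /= ?addn0 !mul0r !add0r !addr0 !mul1r.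
  have nR : n%:R != 0 :> R by rewrite pnatr_eq0 addnS.
  have h1 := mom11 n0 xi (dot_sphere Sth); have h2 := mom11 n0 th (dot_sphere Sth).
  apply: (mulfI nR); rewrite h1 mulrCA h2 (dot_sphere Sth) mulr1 //.
rewrite FH // c1 -mulrA -FH //; congr (_ * _).
have cz : continuous (fun z : R => z * psi z) by apply: cfM => //; exact: cf_id.
rewrite (SI_zonal Sth cz); congr (_ * NI _ _ _); apply/funext => z; ring.
Qed.

End funk_hecke.

(** * Uniqueness *)

Section density.
Context {R : realType} (m : nat).
Local Notation n := (2 * m + 3)%N.
Local Notation V := 'rV[R]_n.

Let n0 : (0 < n)%N. Proof. by rewrite addnS. Qed.

Lemma SI_norm_le_fun (f g : V -> R) : continuous f -> continuous g ->
  (forall x, esphere R n x -> `|f x| <= g x) -> `|SI f| <= SI g.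
Proof.
move=> cf cg fg; rewrite ler_norml; apply/andP; split.
  rewrite -(SIN cg); apply: (SI_le n0) => //; first exact: cfN.
  by move=> x /fg; rewrite ler_norml => /andP[].
by apply: (SI_le n0) => // x /fg; rewrite ler_norml => /andP[].
Qed.

Lemma SI_powers_continuous (h : V -> R) xi (psi : R -> R) : continuous h ->
  esphere R n xi -> (forall l, SI (fun w => dot w xi ^+ l * h w) = 0) ->
  continuous psi -> SI (fun w => psi (dot w xi) * h w) = 0.
Proof.
move=> ch Sxi hl cpsi.
have [M [M0 hM]] := continuous_bounded_on (@compact_sphere R n) ch.
have cwx : continuous (fun w : V => dot w xi) by cts.
apply/eqP; rewrite -normr_le0; apply/ler_addgt0Pl => e e0; rewrite addr0.
have M1 : 0 < M + 1 by rewrite ltr_wpDl.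
have [p hp] := weierstrass cpsi (divr_gt0 e0 M1).
have cp : continuous (fun w : V => p.[dot w xi]) by exact: cf_horner.
have p0 : SI (fun w => p.[dot w xi] * h w) = 0.
  transitivity (SI (fun w => \sum_(i < size p) p`_i * (dot w xi ^+ i * h w))).
    by apply: SI_ext => w _; rewrite horner_coef mulr_suml; apply: eq_bigr => i _; rewrite mulrA.
  rewrite SI_sum //; last by move=> i; cts.
  by rewrite big1 // => i _; rewrite SIZ ?hl ?mulr0 //; cts.
have cpsi' : continuous (fun w : V => psi (dot w xi)) by exact: (cf_comp cwx cpsi).
rewrite -[SI _]subr0 -p0 -SIB; [|exact: cfM|exact: cfM].
apply: (@le_trans _ _ (e / (M + 1) * M)).
  apply: (SI_norm_le n0); first by apply: cfB; exact: cfM.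
  move=> w Sw; rewrite -mulrBl normrM; apply: ler_pM => //; last exact: hM.
  by apply: hp; exact: sphere_dot_itv.
by rewrite mulrAC ler_pdivrMr // ler_wpM2l ?(ltW e0) // lerDl.
Qed.

(** By Weierstrass, powers of w . xi may be replaced by any continuous profile of w . xi, in
    particular by a bump concentrated at [xi]. *)
Theorem SI_powers_eq0 (h : V -> R) xi : continuous h -> esphere R n xi ->
  (forall l, SI (fun w => dot w xi ^+ l * h w) = 0) -> h xi = 0.
Proof.
move=> ch Sxi hl; apply/eqP; apply/negPn/negP => h0.
have h1 : 0 < `|h xi| / 2 by rewrite divr_gt0 // normr_gt0.
have [r r0 hr] : exists2 r, 0 < r & forall w, enorm (w - xi) < r -> `|h w - h xi| <= `|h xi| / 2.
  have /cvgrPdist_le /(_ _ h1) /nbhs_ballP[r /= r0 hr] := ch xi.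
  exists r => // w wr; rewrite distrC; apply: hr; split => // i j.
  rewrite (ord1 i) /ball /=; apply: le_lt_trans wr; rewrite distrC.
  by have := normr_le_enorm (w - xi) j; rewrite !mxE.
(* On the sphere w . xi > 1 - d means |w - xi|^2 < 2 d <= r^2. *)
pose d := Num.min 1 (r ^+ 2 / 2).
have d0 : 0 < d by rewrite lt_min ltr01 divr_gt0 // exprn_gt0.
have d1 : d <= 1 by rewrite ge_min lexx.
have dr : d <= r ^+ 2 / 2 by rewrite ge_min lexx orbT.
pose psi (z : R) := Num.max 0 (z - 1 + d).
have cpsi : continuous psi by rewrite /psi; cts.
have cpsi' : continuous (fun w : V => psi (dot w xi)) by apply: (cf_comp _ cpsi); cts.
have psi0 z : 0 <= psi z by rewrite le_max lexx.
have S0 : 0 < SI (fun w : V => psi (dot w xi)).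
  rewrite (SI_zonal Sxi cpsi) mulr_gt0 ?kap_gt0 //.
  apply: (@NI_gt0 _ _ _ _ (1 - d / 2)).
  - by apply: cfM => //; apply: cf_wt; exact: cf_id.
  - by move=> z z1; rewrite mulr_ge0 ?wt_ge0.
  - by apply/andP; split; lra.
  - rewrite mulr_gt0 //; first by rewrite lt_max; apply/orP; right; lra.
    by rewrite exprn_gt0 // expr2; nra.
have Z := SI_powers_continuous ch Sxi hl cpsi.
have E : SI (fun w : V => psi (dot w xi) * (h xi - h w)) = h xi * SI (fun w : V => psi (dot w xi)).
  rewrite -SIZ // -[LHS]addr0 -Z -SID; [|by apply: cfM => //; cts|exact: cfM].
  by apply: SI_ext => w _; ring.
have : `|h xi| * SI (fun w : V => psi (dot w xi)) <=
    `|h xi| / 2 * SI (fun w : V => psi (dot w xi)).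
  rewrite -[X in _ * X](ger0_norm (ltW S0)) -normrM -E -SIZ //.
  apply: SI_norm_le_fun; [by apply: cfM => //; cts|by cts|].
  move=> w Sw; rewrite normrM (ger0_norm (psi0 _)) mulrC.
  have [zd|zd] := leP (dot w xi - 1 + d) 0.
    by rewrite /psi (elimT max_idPl _) // mulr0 mulr0.
  rewrite ler_wpM2r // distrC; apply: hr.
  rewrite enorm_lt ?(ltW r0) // !dotE (dotC xi w) (dot_sphere Sw) (dot_sphere Sxi).
  by move: dr; lra.
rewrite ler_pM2r // => h2; have : 0 < `|h xi| by rewrite normr_gt0.
by lra.
Qed.

End density.

(** * Descent in the exponent of the weight *)

Section chains.
Context {R : realType}.

Lemma poly_itv_eq0 (p : {poly R}) a b : a < b ->
  (forall x, a < x < b -> p.[x] = 0) -> p = 0.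
Proof.
move=> ab h; apply/eqP/negPn/negP => p0.
pose pt (i : 'I_(size p)) : R := a + (b - a) * (i.+1%:R / (size p).+1%:R).
have s0 : 0 < (size p).+1%:R :> R by rewrite ltr0n.
have := @max_poly_roots _ p [seq pt i | i : 'I_(size p) <- enum 'I_(size p)] p0.
rewrite size_map size_enum_ord ltnn => H; suff : false by [].
apply: H.
  apply/allP => z /mapP[i _ ->]; apply/rootP/h; rewrite /pt.
  have q0 : 0 < (i.+1%:R / (size p).+1%:R : R) by rewrite divr_gt0 // ltr0n.
  have q1 : (i.+1%:R / (size p).+1%:R : R) < 1 by rewrite ltr_pdivrMr // mul1r ltr_nat ltnS.
  by move: q0 q1; set q := _ / _ => q0 q1; apply/andP; split; nra.
rewrite map_inj_uniq ?enum_uniq // => i j /addrI.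
have ba : b - a != 0 by rewrite subr_eq0 gt_eqF.
move=> /(mulfI ba) /(congr1 (fun z => z * (size p).+1%:R)); rewrite !mulfVK ?pnatr_eq0 //.
by move=> /eqP; rewrite eqr_nat eqSS => /eqP/val_inj.
Qed.

Definition chain (k : nat -> R -> R) : Prop := forall j s, dv (k j) s (k j.+1 s).

Lemma chain_continuous k j : chain k -> continuous (k j).
Proof. by move=> ck; exact: dv_continuous (ck j). Qed.

Lemma dv_quad (k : nat -> R -> R) j r z : chain k ->
  dv (fun z => k j (r ^+ 2 + 1 - 2 * r * z)) z (k j.+1 (r ^+ 2 + 1 - 2 * r * z) * (- (2 * r))).
Proof.
move=> ck; apply: (dv_comp (f := k j)) (ck _ _).
apply: dv_eq (dvB (dvC _ z) (dvZ (2 * r) (dvId z))) _; ring.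
Qed.

Lemma dv_quad_r (k : nat -> R -> R) j r z : chain k ->
  dv (fun r => k j (r ^+ 2 + 1 - 2 * r * z)) r
    (k j.+1 (r ^+ 2 + 1 - 2 * r * z) * (2 * r - 2 * z)).
Proof.
move=> ck; apply: (dv_comp (f := k j)) (ck _ _).
apply: dv_eq (dvB (dvD (dvX 2 (dvId r)) (dvC 1 r)) (dvM (dvZ 2 (dvId r)) (dvC z r))) _.
by rewrite /= expr1; ring.
Qed.

Lemma cf_quad (T : topologicalType) (k : nat -> R -> R) j (f : T -> R) : chain k ->
  continuous f -> continuous (fun x => k j (f x)).
Proof. by move=> ck cf; exact: (cf_comp cf (@chain_continuous k j ck)). Qed.

(** The r-derivative of k_j (r^2 + 1 - 2 r z) carries the factor 2 r - 2 z, and the part with 2 r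
    integrates to 0 by the hypothesis for j + 1. *)
Lemma descent_step (k : nat -> R -> R) mu : chain k ->
  (forall j r, 0 < r < 1 ->
    NI (fun z => k j (r ^+ 2 + 1 - 2 * r * z) * (1 - z ^+ 2) ^+ mu) (-1) 1 = 0) ->
  forall j r, 0 < r < 1 ->
    NI (fun z => k j.+1 (r ^+ 2 + 1 - 2 * r * z) * (z * (1 - z ^+ 2) ^+ mu)) (-1) 1 = 0.
Proof.
move=> ck H j r r01; have /andP[r0 r1] := r01.
pose u' (r z : R) := k j.+1 (r ^+ 2 + 1 - 2 * r * z) * (2 * r - 2 * z) * (1 - z ^+ 2) ^+ mu.
have D : dv (fun r => NI (fun z => k j (r ^+ 2 + 1 - 2 * r * z) * (1 - z ^+ 2) ^+ mu) (-1) 1) r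
    (NI (u' r) (-1) 1).
  apply: (NI_derive (u' := u')); first by lra.
  - move=> z s; apply: dv_eq (dvM (dv_quad_r j s z ck) (dvC _ s)) _.
    by rewrite /u' mulr0 addr0.
  - by move=> s; apply: cfM; [apply: cf_quad => //|]; cts.
  - by rewrite /u'; apply: cfM; [apply: cfM; [apply: cf_quad => //|]|]; cts.
have Z : NI (u' r) (-1) 1 = 0.
  apply: dv_uniq D _; apply: dv_near (dvC 0 r).
  apply: (@near_dist _ r (Num.min r (1 - r))); first by rewrite lt_min r0 subr_gt0.
  move=> y; rewrite lt_min !ltr_norml => /andP[/andP[? ?] /andP[? ?]].
  by apply: H; apply/andP; split; lra.
have h1 := H j.+1 r r01.
have c1 : continuous (fun z => k j.+1 (r ^+ 2 + 1 - 2 * r * z) * (1 - z ^+ 2) ^+ mu).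
  by apply: cfM; [apply: cf_quad => //|]; cts.
have c2 : continuous (fun z => k j.+1 (r ^+ 2 + 1 - 2 * r * z) * (z * (1 - z ^+ 2) ^+ mu)).
  by apply: cfM; [apply: cf_quad => //|]; cts.
have : NI (u' r) (-1) 1 = 2 * r * NI (fun z => k j.+1 (r ^+ 2 + 1 - 2 * r * z) * (1 - z ^+ 2) ^+ mu) (-1) 1
   - 2 * NI (fun z => k j.+1 (r ^+ 2 + 1 - 2 * r * z) * (z * (1 - z ^+ 2) ^+ mu)) (-1) 1.
  rewrite -!NIZ // -NIB; [|by apply: cfM; [cts|]|by apply: cfM; [cts|]].
  by congr NI; apply/funext => z; rewrite /u'; ring.
by rewrite Z h1; lra.
Qed.

(** Integration by parts against z (1 - z^2)^(mu+1): [descent_step] kills one side, and the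
    derivative of this function combines the weights of exponents mu + 1 and mu, the first of which
    already integrates to 0. *)
Lemma descent_succ (k : nat -> R -> R) mu : chain k ->
  (forall j r, 0 < r < 1 ->
    NI (fun z => k j (r ^+ 2 + 1 - 2 * r * z) * (1 - z ^+ 2) ^+ mu.+1) (-1) 1 = 0) ->
  forall j r, 0 < r < 1 ->
    NI (fun z => k j (r ^+ 2 + 1 - 2 * r * z) * (1 - z ^+ 2) ^+ mu) (-1) 1 = 0.
Proof.
move=> ck H j r r01; have /andP[r0 r1] := r01.
have Z := descent_step ck H j r01.
pose f z := k j (r ^+ 2 + 1 - 2 * r * z).
pose f' z := k j.+1 (r ^+ 2 + 1 - 2 * r * z) * (- (2 * r)).
pose g (z : R) := z * (1 - z ^+ 2) ^+ mu.+1.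
pose g' (z : R) := (1 - z ^+ 2) ^+ mu.+1 * (2 * mu.+1%:R + 1) - 2 * mu.+1%:R * (1 - z ^+ 2) ^+ mu.
have cf' : continuous f' by rewrite /f'; apply: cfM; [apply: cf_quad => //|]; cts.
have cg' : continuous g' by rewrite /g'; cts.
have cf : continuous f by apply: cf_quad => //; cts.
have df z : dv f z (f' z) by exact: dv_quad.
have dg z : dv g z (g' z).
  have d1 : dv (fun z : R => 1 - z ^+ 2) z (0 - 2%:R * z ^+ 1 * 1).
    by apply: dvB; [exact: dvC|exact: dvX (dvId z)].
  apply: dv_eq (dvM (dvId z) (dvX mu.+1 d1)) _.
  by rewrite /g' /= exprS; ring.
have := NI_IBP (-1) 1 cf' cg' df dg.
have -> : NI (fun z => f' z * g z) (-1) 1 = 0.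
  transitivity (NI (fun z => (- (2 * r)) * (k j.+1 (r ^+ 2 + 1 - 2 * r * z) * (z * (1 - z ^+ 2) ^+ mu.+1))) (-1) 1).
    by congr NI; apply/funext => z; rewrite /f' /g; ring.
  rewrite NIZ ?Z ?mulr0 //; apply: cfM; [apply: cf_quad => //|]; cts.
have -> : g 1 = 0 by rewrite /g expr1n subrr expr0n mulr0.
have -> : g (-1) = 0 by rewrite /g sqrrN expr1n subrr expr0n mulr0.
rewrite !mulr0 subrr sub0r => /esym/eqP; rewrite oppr_eq0 => /eqP.
have -> : NI (fun x => f x * g' x) (-1) 1 =
   (2 * mu.+1%:R + 1) * NI (fun z => f z * (1 - z ^+ 2) ^+ mu.+1) (-1) 1 -
   2 * mu.+1%:R * NI (fun z => f z * (1 - z ^+ 2) ^+ mu) (-1) 1.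
  rewrite -!NIZ; [|by cts|by cts]; rewrite -NIB; [|by cts|by cts].
  by congr NI; apply/funext => z; rewrite /g'; ring.
rewrite H // mulr0 sub0r => /eqP; rewrite oppr_eq0 mulf_eq0 => /orP[|/eqP //].
by rewrite mulf_eq0 !pnatr_eq0.
Qed.

(** With constant weight everything is elementary: the hypothesis for j = 1 gives the difference of
    the endpoint values, and integration by parts against z gives their sum. *)
Lemma descent0 (k : nat -> R -> R) : chain k ->
  (forall j r, 0 < r < 1 ->
    NI (fun z => k j (r ^+ 2 + 1 - 2 * r * z) * (1 - z ^+ 2) ^+ 0) (-1) 1 = 0) ->
  forall r, 0 < r < 1 -> k 0%N ((1 - r) ^+ 2) = 0 /\ k 0%N ((1 + r) ^+ 2) = 0.
Proof.
move=> ck H r r01; have /andP[r0 r1] := r01.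
have Z := descent_step ck H 0 r01.
pose f z := k 0%N (r ^+ 2 + 1 - 2 * r * z).
pose f' z := k 1%N (r ^+ 2 + 1 - 2 * r * z) * (- (2 * r)).
have cf' : continuous f' by rewrite /f'; apply: cfM; [apply: cf_quad => //|]; cts.
have cf : continuous f by apply: cf_quad => //; cts.
have df z : dv f z (f' z) by exact: dv_quad.
have f1 : f 1 = k 0%N ((1 - r) ^+ 2) by rewrite /f; congr (k 0%N _); ring.
have f2 : f (-1) = k 0%N ((1 + r) ^+ 2) by rewrite /f; congr (k 0%N _); ring.
have e1 : f 1 - f (-1) = 0.
  rewrite -(NI_FTC _ _ cf' df).
  transitivity (NI (fun z => (- (2 * r)) * (k 1%N (r ^+ 2 + 1 - 2 * r * z) * (1 - z ^+ 2) ^+ 0)) (-1) 1).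
    by congr NI; apply/funext => z; rewrite /f'; ring.
  by rewrite NIZ ?H ?mulr0 //; apply: cfM; [apply: cf_quad => //|]; cts.
have e2 : f 1 + f (-1) = 0.
  have := NI_IBP (-1) 1 cf' (@cfC R R 1) df (fun z => dvId z).
  have -> : NI (fun z => f' z * z) (-1) 1 = 0.
    transitivity (NI (fun z => (- (2 * r)) * (k 1%N (r ^+ 2 + 1 - 2 * r * z) * (z * (1 - z ^+ 2) ^+ 0))) (-1) 1).
      by congr NI; apply/funext => z; rewrite /f'; ring.
    by rewrite NIZ ?Z ?mulr0 //; apply: cfM; [apply: cf_quad => //|]; cts.
  have -> : NI (fun x => f x * 1) (-1) 1 = 0.
    by rewrite -[RHS](H 0%N r r01); congr NI; apply/funext => z; rewrite expr0.
  by move=> ?; lra.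
by rewrite -f1 -f2; split; lra.
Qed.

(** For 0 < r < 1 the squares (1 - r)^2 and (1 + r)^2 cover (0, 1) and (1, 4); the point s = 1
    follows by continuity. *)
Lemma descent (k : nat -> R -> R) mu : chain k ->
  (forall j r, 0 < r < 1 ->
    NI (fun z => k j (r ^+ 2 + 1 - 2 * r * z) * (1 - z ^+ 2) ^+ mu) (-1) 1 = 0) ->
  forall s, 0 < s < 4 -> k 0%N s = 0.
Proof.
move=> ck H.
have {H} H0 : forall j r, 0 < r < 1 ->
    NI (fun z => k j (r ^+ 2 + 1 - 2 * r * z) * (1 - z ^+ 2) ^+ 0) (-1) 1 = 0.
  by elim: mu H => // mu IH H; apply: IH; exact: descent_succ.
have K s : 0 < s < 4 -> s != 1 -> k 0%N s = 0.
  move=> /andP[s0 s4] s1.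
  have q0 : 0 < Num.sqrt s by rewrite sqrtr_gt0.
  have q2 : Num.sqrt s ^+ 2 = s by rewrite sqr_sqrtr // ltW.
  have q1 : Num.sqrt s != 1 by apply: contra s1 => /eqP h; rewrite -q2 h expr1n.
  have qq : Num.sqrt s < 2 by rewrite -(@ltr_pXn2r _ 2) ?nnegrE ?(ltW q0) // q2; lra.
  move: q0 q2 q1 qq; set q := Num.sqrt s => q0 q2 q1 qq.
  case: (ltgtP q 1) q1 => // q1 _.
    have [|h _] := descent0 ck H0 (r := 1 - q); first by apply/andP; split; lra.
    by rewrite -q2 -h; congr (k 0%N (_ ^+ 2)); ring.
  have [|_ h] := descent0 ck H0 (r := q - 1); first by apply/andP; split; lra.
  by rewrite -q2 -h; congr (k 0%N (_ ^+ 2)); ring.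
move=> s s04; have [->|s1] := eqVneq s 1; last exact: K.
apply/eqP; rewrite -normr_le0; apply/ler_addgt0Pl => e e0; rewrite addr0.
have /cvgrPdist_le /(_ e e0) /dist_near[d d0 hd] := @chain_continuous _ 0 ck 1.
pose t := 1 + Num.min (d / 2) 1.
have t1 : 0 < Num.min (d / 2) 1 by rewrite lt_min ltr01 divr_gt0.
have t2 : Num.min (d / 2) 1 <= 1 by rewrite ge_min lexx orbT.
have t3 : Num.min (d / 2) 1 <= d / 2 by rewrite ge_min lexx.
have := hd t; rewrite (K t) ?subr0; first (apply; rewrite /t addrAC subrr add0r gtr0_norm //; lra).
  by rewrite /t; apply/andP; split; lra.
by rewrite /t gt_eqF // ltrDl.
Qed.

End chains.


(** * Moment integrals for radii close to 1 *)

Section annulus_moments.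
Context {R : realType} (P : {poly R}) (e : R).
Hypothesis e0 : 0 < e.
Hypothesis P0 : P != 0.

Definition slab (G : R -> R) : Prop :=
  continuous G /\ forall s, s <= e \/ 4 - e <= s -> G s = 0.

(** Centred at 1 because the substitution s = r^2 + 1 - 2 r z gives z = (r^2 - (s - 1)) / (2 r). *)
Definition pmom (G : R -> R) (i : nat) : R := NI (fun s => G s * (s - 1) ^+ i) 0 4.

(** The image [(1 - r)^2, (1 + r)^2] of [-1, 1] contains the support of [G], so after substitution
    the limits are free of r, and r remains only inside [P]. *)
Lemma NI_quad (G : R -> R) r : slab G -> 0 < r < 1 -> (1 - r) ^+ 2 <= e ->
  4 - e <= (1 + r) ^+ 2 ->
  2 * r * NI (fun z => G (r ^+ 2 + 1 - 2 * r * z) * P.[z]) (-1) 1 =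
  NI (fun s => G s * P.[(r ^+ 2 - (s - 1)) / (2 * r)]) 0 4.
Proof.
move=> [cG G0] /andP[r0 r1] re1 re2.
have r20 : 2 * r != 0 by rewrite mulf_neq0 // ?pnatr_eq0 // gt_eqF.
pose f s := G s * P.[(r ^+ 2 - (s - 1)) / (2 * r)].
have cf : continuous f by apply: cfM => //; apply: cf_horner; cts.
have fz a b : a <= b -> (forall s, a <= s <= b -> G s = 0) -> NI f a b = 0.
  move=> ab h; rewrite (NI_ext cf (g := fun=> 0) _ ab) ?NI_cst ?mul0r //.
    exact: cst_continuous.
  by move=> s sab; rewrite /f h ?mul0r.
have E1 : NI f 0 4 = NI f ((1 - r) ^+ 2) ((1 + r) ^+ 2).
  rewrite (NI_split f 0 ((1 - r) ^+ 2) 4) (NI_split f ((1 - r) ^+ 2) ((1 + r) ^+ 2) 4).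
  rewrite (fz 0 ((1 - r) ^+ 2)) ?sqr_ge0 //; last first.
    by move=> s /andP[_ s1]; apply: G0; left; exact: le_trans re1.
  rewrite (fz ((1 + r) ^+ 2) 4); last first.
  - by move=> s /andP[s1 _]; apply: G0; right; exact: le_trans s1.
  - by rewrite expr2; nra.
  by rewrite add0r addr0.
rewrite -/f E1.
have := @NI_affine _ f (-1) 1 (- (2 * r)) (r ^+ 2 + 1) cf.
have -> : - (2 * r) * -1 + (r ^+ 2 + 1) = (1 + r) ^+ 2 by ring.
have -> : - (2 * r) * 1 + (r ^+ 2 + 1) = (1 - r) ^+ 2 by ring.
rewrite (NIC f ((1 + r) ^+ 2)) => /(congr1 (fun x => - x)); rewrite opprK => <-.
have cq : continuous (fun z => G (r ^+ 2 + 1 - 2 * r * z) * P.[z]).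
  by apply: cfM; [apply: (cf_comp _ cG)|apply: cf_horner]; cts.
rewrite -NIZ // -NIN; last by apply: cfM; [apply: (cf_comp _ cf)|]; cts.
congr NI; apply/funext => z; rewrite /f.
have -> : (r ^+ 2 - (- (2 * r) * z + (r ^+ 2 + 1) - 1)) / (2 * r) = z.
  by field; rewrite gt_eqF.
have -> : - (2 * r) * z + (r ^+ 2 + 1) = r ^+ 2 + 1 - 2 * r * z by ring.
by ring.
Qed.

Lemma NI_pmom (G : R -> R) r : continuous G -> 0 < r ->
  NI (fun s => G s * P.[(r ^+ 2 - (s - 1)) / (2 * r)]) 0 4 =
  \sum_(j < size P) \sum_(i < j.+1)
    P`_j / (2 * r) ^+ j * (r ^+ 2) ^+ (j - i) * (-1) ^+ i * 'C(j, i)%:R * pmom G i.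
Proof.
move=> cG r0.
under [RHS]eq_bigr => j _.
  under eq_bigr => i _.
    rewrite -NIZ; last by cts.
    over.
  rewrite -NI_sum; last by move=> i; cts.
  over.
rewrite -NI_sum; last first.
  by move=> j; apply: cf_sum => i; cts.
congr NI; apply/funext => s; rewrite horner_coef mulr_sumr; apply: eq_bigr => j _.
rewrite expr_div_n exprDn mulr_suml !mulr_sumr; apply: eq_bigr => i _.
rewrite -[_ *+ 'C(j, i)]mulr_natr [(- (s - 1)) ^+ i]exprNn.
set a := r ^+ 2 ^+ (j - i); set b := (s - 1) ^+ i; set c := (-1) ^+ i.
by set d := (2 * r) ^+ j; ring.
Qed.

(** Multiplied by (2 r)^d, d the degree of [P], the integral is a polynomial in r that vanishes on
    an interval, so each of its coefficients is 0. *)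
Lemma pmom_eq0 (G : R -> R) (dl : R) : continuous G -> 0 < dl < 1 ->
  (forall r, 1 - dl < r < 1 ->
    NI (fun s => G s * P.[(r ^+ 2 - (s - 1)) / (2 * r)]) 0 4 = 0) ->
  forall i, (i < size P)%N -> pmom G i = 0.
Proof.
move=> cG /andP[dl0 dl1] H.
have [d dE] : exists d, size P = d.+1.
  by exists (size P).-1; rewrite prednK // size_poly_gt0.
pose cc (j i : nat) := P`_j * 2 ^+ (d - j) * (-1) ^+ i * 'C(j, i)%:R * pmom G i.
pose Q : {poly R} := \sum_(j < d.+1) \sum_(i < j.+1) (cc j i)%:P * 'X^(d - j + 2 * (j - i)).
have Q0 : Q = 0.
  apply: (@poly_itv_eq0 _ _ (1 - dl) 1); first by lra.
  move=> r /[dup] r01 /andP[r1 r2]; have r0 : 0 < r by lra.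
  have := H r r01; rewrite NI_pmom // dE => /(congr1 (fun x => (2 * r) ^+ d * x)).
  rewrite mulr0 => <-; rewrite /Q horner_sum mulr_sumr; apply: eq_bigr => j _.
  rewrite horner_sum mulr_sumr; apply: eq_bigr => i _.
  rewrite hornerM hornerC hornerXn /cc.
  have jd : (j <= d)%N by rewrite -ltnS.
  have -> : (2 * r) ^+ d = 2 ^+ (d - j) * r ^+ (d - j) * (2 * r) ^+ j.
    by rewrite -exprMn -exprD subnK.
  rewrite exprD exprM; field.
  by rewrite expf_neq0 // mulf_neq0 ?pnatr_eq0 // gt_eqF.
move=> i; rewrite dE ltnS; have [k] := ubnP i; elim: k i => // k IH i ik id_.
(* The term (j, i') has degree d + j - 2 i'. Degree 2 d - 2 i comes from (d, i) and otherwise only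
   from j < d with i' < i, where the induction hypothesis applies. *)
have : Q`_(2 * d - 2 * i) = 0 by rewrite Q0 coef0.
have -> : Q`_(2 * d - 2 * i) = cc d i.
  rewrite /Q coef_sum (bigD1 ord_max) //= [X in _ + X]big1 ?addr0; last first.
    move=> j; rewrite -val_eqE /= => jd; rewrite coef_sum big1 // => i' _.
    rewrite coefCM coefXn; case: eqP => [E|_]; last by rewrite mulr0.
    have jd' : (j < d)%N by rewrite ltn_neqAle jd -ltnS ltn_ord.
    have ij := ltn_ord i'; rewrite /cc IH ?mulr0 ?mul0r //; lia.
  rewrite coef_sum (bigD1 (inord i : 'I_d.+1)) //= [X in _ + X]big1 ?addr0.
    by rewrite coefCM coefXn inordK ?ltnS // (_ : _ == _) ?mulr1 //; apply/eqP; lia.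
  move=> i'; rewrite -val_eqE /= inordK ?ltnS // => ii.
  rewrite coefCM coefXn; case: eqP => [E|_]; last by rewrite mulr0.
  by have ij := ltn_ord i'; exfalso; move/eqP: ii; lia.
rewrite /cc subnn expr0 mulr1 => /eqP; rewrite mulf_eq0 => /orP[|/eqP //].
rewrite !mulf_eq0 -[P`_d](_ : lead_coef P = _) ?lead_coef_eq0 ?(negPf P0) /=; last first.
  by rewrite lead_coefE dE.
by rewrite signr_eq0 pnatr_eq0 -leqn0 leqNgt bin_gt0 id_.
Qed.

(** By parts, the moment of order i of G1 is -i times the moment of order i - 1 of G0, so every
    moment that enters is 0 again. *)
Lemma annulus_moments (G0 G1 : R -> R) (dl : R) : slab G0 -> slab G1 ->
  (forall s, dv G0 s (G1 s)) -> 0 < dl < 1 ->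
  (forall r, 1 - dl < r < 1 -> (1 - r) ^+ 2 <= e /\ 4 - e <= (1 + r) ^+ 2) ->
  (forall r, 1 - dl < r < 1 ->
    NI (fun z => G0 (r ^+ 2 + 1 - 2 * r * z) * P.[z]) (-1) 1 = 0) ->
  forall r, 1 - dl < r < 1 ->
    NI (fun z => G1 (r ^+ 2 + 1 - 2 * r * z) * P.[z]) (-1) 1 = 0.
Proof.
move=> s0 s1 dG /[dup] dl01 /andP[dl0 dl1] He H r /[dup] r1 /andP[r2 r3].
have r0 : 0 < r by lra.
have M0 := pmom_eq0 s0.1 dl01.
have {M0} M0 : forall i, (i < size P)%N -> pmom G0 i = 0.
  apply: M0 => t t1; have [h1 h2] := He t t1; have /andP[t2 t3] := t1.
  have t01 : 0 < t < 1 by apply/andP; split; lra.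
  by rewrite -(NI_quad s0 t01 h1 h2) H ?mulr0.
have M1 i : (i < size P)%N -> pmom G1 i = 0.
  move=> iP; rewrite /pmom.
  have cg : continuous (fun s : R => i%:R * (s - 1) ^+ i.-1) by cts.
  have dg s : dv (fun s : R => (s - 1) ^+ i) s (i%:R * (s - 1) ^+ i.-1).
    by apply: dv_eq (dvX i (dvB (dvId s) (dvC 1 s))) _; rewrite subr0 mulr1.
  have g0 : G0 0 = 0 by apply: s0.2; left; exact: ltW.
  have g4 : G0 4 = 0 by apply: s0.2; right; rewrite gerBl ltW.
  rewrite (NI_IBP 0 4 s1.1 cg dG dg) g0 g4.
  rewrite !mul0r subrr sub0r.
  transitivity (- (i%:R * pmom G0 i.-1)); last first.
    by rewrite M0 ?mulr0 ?oppr0 //; apply: leq_ltn_trans iP; exact: leq_pred.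
  congr (- _); rewrite /pmom -NIZ; last by apply: cfM; [exact: s0.1|cts].
  by congr NI; apply/funext => s; ring.
have [h1 h2] := He r r1; have r01 : 0 < r < 1 by apply/andP; split; lra.
have r20 : 2 * r != 0 by rewrite mulf_neq0 // ?pnatr_eq0 // gt_eqF.
apply: (mulfI r20); rewrite (NI_quad s1 r01 h1 h2) NI_pmom ?mulr0 //; last exact: s1.1.
rewrite big1 // => j _; rewrite big1 // => i _.
by rewrite M1 ?mulr0 //; apply: leq_trans (ltn_ord j); exact: ltn_ord.
Qed.

End annulus_moments.

(** * Families in s and their weighted backprojections *)

Section backprojected_family.
Context {R : realType} (m : nat).
Local Notation n := (2 * m + 3)%N.
Local Notation V := 'rV[R]_n.

Let n0 : (0 < n)%N. Proof. by rewrite addnS. Qed.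

(** The families G_j(theta, s), s = t^2, taken for all vectors and all real s so that continuity and
    derivatives are global. Support in [e, 4 - e] reflects compact support in 0 < t < 2. *)
Definition sfam (e : R) (G : nat -> V -> R -> R) : Prop :=
  [/\ forall j, continuous (fun z : V * R => G j z.1 z.2),
      forall j x s, dv (G j x) s (G j.+1 x s) &
      forall j x s, s <= e \/ 4 - e <= s -> G j x s = 0].

(* For [th] on the sphere, [sqd x th] is [|x - th|^2]. *)
Definition sqd (x th : V) : R := dot x x + 1 - 2 * dot x th.

(** The mean F_j with an additional weight [q] in theta, on which x-derivatives act by
    multiplication with linear forms. *)
Definition bpf (G : nat -> V -> R -> R) (q : V -> R) (j : nat) (x : V) : R :=
  SI (fun th => q th * G j th (sqd x th)).

Context (e : R) (G : nat -> V -> R -> R).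
Hypothesis e0 : 0 < e.
Hypothesis sG : sfam e G.

Lemma cf_G (T : topologicalType) j (f : T -> V) (g : T -> R) :
  continuous f -> continuous g -> continuous (fun x => G j (f x) (g x)).
Proof. by have [cG _ _] := sG; move=> cf cg; exact: (cf2 (cG j)). Qed.

Lemma cf_sqd (T : topologicalType) (f g : T -> V) :
  continuous f -> continuous g -> continuous (fun x => sqd (f x) (g x)).
Proof. by move=> cf cg; rewrite /sqd; cts. Qed.

Lemma cf_q (T : topologicalType) (f : T -> V) (q : V -> R) :
  continuous q -> continuous f -> continuous (fun x => q (f x)).
Proof. by move=> cq cf; exact: (cf_comp cf cq). Qed.

Lemma cf_bpf_in (q : V -> R) j x : continuous q ->
  continuous (fun th : V => q th * G j th (sqd x th)).
Proof. by move=> cq; apply: cfM => //; apply: cf_G; [|apply: cf_sqd]; cts. Qed.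

Lemma cf_bpf (q : V -> R) j : continuous q -> continuous (bpf G q j).
Proof.
move=> cq; apply: (mean_continuous (mean_on_SI n0)
  (u := fun x th => q th * G j th (sqd x th))).
apply: cfM; first by apply: cf_q => //; cts.
by apply: cf_G; [|apply: cf_sqd]; cts.
Qed.

Lemma dv_bpf (q : V -> R) j x v t : continuous q ->
  dv (fun t => bpf G q j (x + t *: v)) t
    (2 * dot (x + t *: v) v * bpf G q j.+1 (x + t *: v) -
     2 * bpf G (fun th => dot v th * q th) j.+1 (x + t *: v)).
Proof.
move=> cq; have [_ dG _] := sG.
have dB th s : dv (fun s => sqd (x + s *: v) th) s (2 * dot (x + s *: v) v - 2 * dot v th).
  have E r : sqd (x + r *: v) th = r ^+ 2 * dot v v + r * (2 * dot x v - 2 * dot v th) +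
      (dot x x + 1 - 2 * dot x th).
    by rewrite /sqd !dotE (dotC v x); ring.
  under eq_fun do rewrite E.
  apply: dv_eq (dvD (dvD (dvM (dvX 2 (dvId s)) (dvC _ s)) (dvM (dvId s) (dvC _ s))) (dvC _ s)) _.
  by rewrite /= expr1 !dotE; ring.
pose u s th := q th * G j th (sqd (x + s *: v) th).
pose u' s th := q th * (G j.+1 th (sqd (x + s *: v) th) * (2 * dot (x + s *: v) v - 2 * dot v th)).
have D : dv (fun s => SI (u s)) t (SI (u' t)).
  apply: (SI_derive n0).
  - by move=> th s; apply: dvZ; exact: dv_comp (dB th s) (dG _ _ _).
  - by move=> s; exact: cf_bpf_in.
  - apply: cfM; first by apply: cf_q => //; cts.
    apply: cfM; last by cts.
    by apply: cf_G; [|apply: cf_sqd]; cts.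
apply: dv_eq D _; rewrite /bpf -!SIZ; first last.
- by apply: cf_bpf_in.
- by apply: cf_bpf_in; cts.
rewrite -SIB; first last.
- by apply: cfM; [cts|apply: cf_bpf_in; cts].
- by apply: cfM; [cts|apply: cf_bpf_in].
by apply: SI_ext => th _; rewrite /u'; ring.
Qed.

Definition bzero q j : Prop := forall x, enorm x < 1 -> bpf G q j x = 0.

Lemma dv_ball_eq0 (f : V -> R) x v l : (forall x, enorm x < 1 -> f x = 0) -> enorm x < 1 ->
  dv (fun t => f (x + t *: v)) 0 l -> l = 0.
Proof.
move=> f0 x1 /dv_uniq; apply; apply: dv_near (dvC 0 0).
have d0 : 0 < (1 - enorm x) / (enorm v + 1).
  by rewrite divr_gt0 // ?subr_gt0 // ltr_wpDl // enorm_ge0.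
apply: (near_dist d0) => t; rewrite subr0 ltr_pdivlMr; last first.
  by rewrite ltr_wpDl // enorm_ge0.
move=> h; apply: f0; apply: le_lt_trans (enormD _ _) _; rewrite enormZ.
have := normr_ge0 t; have := enorm_ge0 v; nra.
Qed.

(** The derivative along [v] of a function that is 0 on the ball, written out by [dv_bpf]:
    multiplication by x . v is traded for the weight v . theta. *)
Lemma bzero_derive (q : V -> R) j v x : continuous q -> bzero q j -> enorm x < 1 ->
  dot x v * bpf G q j.+1 x = bpf G (fun th => dot v th * q th) j.+1 x.
Proof.
move=> cq z x1; have := dv_ball_eq0 z x1 (dv_bpf j x v 0 cq).
by rewrite scale0r addr0 => h; lra.
Qed.

Lemma bpf_ext (q q' : V -> R) j x : (forall th, esphere R n th -> q th = q' th) ->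
  bpf G q j x = bpf G q' j x.
Proof. by move=> h; apply: SI_ext => th Sth; rewrite h. Qed.

Lemma bpf_sum (I : Type) (r : seq I) (c : I -> R) (q : I -> V -> R) j x :
  (forall i, continuous (q i)) ->
  bpf G (fun th => \sum_(i <- r) c i * q i th) j x = \sum_(i <- r) c i * bpf G (q i) j x.
Proof.
move=> cq; rewrite /bpf; under [RHS]eq_bigr => i _.
  rewrite -SIZ; last exact: cf_bpf_in.
  over.
rewrite -SI_sum //; last by move=> i; apply: cfM; [cts|exact: cf_bpf_in].
by apply: SI_ext => th _; rewrite mulr_suml; apply: eq_bigr => i _; ring.
Qed.

Local Notation one := (fun _ : V => 1 : R).

(* Both [|x|^2 F] and [F] equal the sum of [x_i bpf theta_i] for [F = bpf 1]. *)
Lemma bzero_step j : bzero one j -> bzero one j.+1 -> bzero one j.+2.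
Proof.
move=> z0 z1 x x1.
have c1 : continuous one by exact: cst_continuous.
pose ei i : V := delta_mx ord0 i.
have zv v : bzero (fun th => dot v th * 1) j.+1.
  by move=> y y1; rewrite -(bzero_derive v c1 z0 y1) z1 // mulr0.
have cv v : continuous (fun th : V => dot v th * 1) by cts.
have E1 : bpf G one j.+2 x = \sum_i x ord0 i * bpf G (fun th => dot (ei i) th * 1) j.+2 x.
  transitivity (\sum_i bpf G (fun th => dot (ei i) th * (dot (ei i) th * 1)) j.+2 x).
    transitivity (\sum_i 1 * bpf G (fun th => dot (ei i) th * (dot (ei i) th * 1)) j.+2 x);
      last by apply: eq_bigr => i _; rewrite mul1r.
    rewrite -(@bpf_sum _ _ (fun=> 1) (fun i th => dot (ei i) th * (dot (ei i) th * 1)));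
      last by move=> i; cts.
    apply: bpf_ext => th Sth; rewrite -[LHS](dot_sphere Sth) {1}/dot; apply: eq_bigr => i _.
    by rewrite mul1r mulr1 (dotC (ei i)) dot_delta.
  apply: eq_bigr => i _; rewrite -(bzero_derive (ei i) (cv (ei i)) (zv (ei i)) x1).
  by rewrite dot_delta.
have E2 : \sum_i x ord0 i * bpf G (fun th => dot (ei i) th * 1) j.+2 x =
    dot x x * bpf G one j.+2 x.
  rewrite /dot mulr_suml; apply: eq_bigr => i _.
  by rewrite -(bzero_derive (ei i) c1 z1 x1) dot_delta mulrA.
have x2 : dot x x < 1 by move: x1; rewrite enorm_lt // expr1n.
have : (1 - dot x x) * bpf G one j.+2 x = 0 by rewrite mulrBl mul1r -E2 -E1 subrr.
by move=> /eqP; rewrite mulf_eq0 => /orP[/eqP|/eqP //]; lra.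
Qed.

Lemma bzero_all : bzero one 0 -> bzero one 1 -> forall j, bzero one j.
Proof.
move=> z0 z1 j; suff : bzero one j /\ bzero one j.+1 by case.
by elim: j => // j [h1 h2]; split => //; exact: bzero_step.
Qed.

(** Each factor xi . theta costs one derivative through [bzero_derive]; hence the index l + j. *)
Lemma bzero_powers xi : bzero one 0 -> bzero one 1 ->
  forall l j, bzero (fun th => dot xi th ^+ l) (l + j).
Proof.
move=> z0 z1; elim=> [|l IH] j; first exact: bzero_all.
move=> x x1; have cq : continuous (fun th : V => dot xi th ^+ l) by cts.
have := bzero_derive xi cq (IH j) x1.
have -> : (l + j).+1 = (l + j.+1)%N by rewrite addnS.
rewrite (IH j.+1 x x1) mulr0 addSn -addnS => ->.
by apply: bpf_ext => th _; rewrite exprS.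
Qed.

(** Once the two means are exchanged, the inner one over w is of Funk-Hecke type, with profile
    [G j th (r ^+ 2 + 1 - 2 * r * z)]. *)
Lemma zonal_average l xi (q : V -> R) j r : continuous q -> esphere R n xi ->
  SI (fun w => zpoly m l (dot w xi) * bpf G q j (r *: w)) =
  NI (fun z => SI (fun th => q th * fhc l th xi * G j th (r ^+ 2 + 1 - 2 * r * z)) *
      (zpoly m l z * wt m z)) (-1) 1.
Proof.
move=> cq Sxi.
have cF : continuous (fun th : V => fhc l th xi) by apply: cf_fhc; exact: cf_id.
pose u (w th : V) := zpoly m l (dot w xi) * (q th * G j th (r ^+ 2 + 1 - 2 * r * dot w th)).
have cu : continuous (fun z : V * V => u z.1 z.2).
  apply: cfM; first by apply: cf_zpoly; cts.
  by apply: cfM; [apply: cf_q => //|apply: cf_G]; cts.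
transitivity (SI (fun w => SI (fun th => u w th))).
  apply: SI_ext => w Sw; rewrite /bpf -SIZ; last exact: cf_bpf_in.
  apply: SI_ext => th _; rewrite /u /sqd !dotE (dot_sphere Sw).
  by congr (_ * (_ * G j th _)); ring.
rewrite SI_SI //.
pose v (z : R) (th : V) := (q th * fhc l th xi * G j th (r ^+ 2 + 1 - 2 * r * z)) *
   (zpoly m l z * wt m z).
transitivity (SI (fun th => NI (fun z => v z th) (-1) 1)).
  apply: SI_ext => th Sth; rewrite /u.
  have cpsi : continuous (fun z => q th * G j th (r ^+ 2 + 1 - 2 * r * z)).
    by apply: cfM; [cts|apply: cf_G; cts].
  rewrite (@funk_hecke _ m l th xi (fun z => q th * G j th (r ^+ 2 + 1 - 2 * r * z))) //.
  rewrite -NIZ; last by apply: cfM => //; apply: cfM; [apply: cf_zpoly|apply: cf_wt]; exact: cf_id.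
  by congr NI; apply/funext => z; rewrite /v; ring.
have cz : continuous (fun z : R => zpoly m l z * wt m z).
  by apply: cfM; [apply: cf_zpoly|apply: cf_wt]; exact: cf_id.
have cqf : continuous (fun th => q th * fhc l th xi) by exact: cfM.
have cv : continuous (fun z : R * V => v z.1 z.2).
  apply: cfM.
    by apply: cfM; [apply: (cf_q cqf)|apply: cf_G]; cts.
  by apply: (cf_comp (h := fun z : R => zpoly m l z * wt m z)) => //; cts.
rewrite (SI_NI n0 _ _ cv); congr NI; apply/funext => z; rewrite /v.
rewrite [RHS]mulrC -SIZ; last by apply: cfM => //; apply: cf_G; cts.
by apply: SI_ext => th _; rewrite mulrC.
Qed.

End backprojected_family.


(** * Consequences of vanishing backprojections *)

Section kernel_of_backprojection.
Context {R : realType} (m : nat).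
Local Notation n := (2 * m + 3)%N.
Local Notation V := 'rV[R]_n.

Let n0 : (0 < n)%N. Proof. by rewrite addnS. Qed.

Context (e : R) (G : nat -> V -> R -> R).
Hypothesis e0 : 0 < e.
Hypothesis sG : sfam e G.

Local Notation one := (fun _ : V => 1 : R).

Definition kf (b : V -> R) (j : nat) (s : R) : R := SI (fun th => b th * G j th s).

Lemma cf_kf_in (b : V -> R) j s : continuous b -> continuous (fun th : V => b th * G j th s).
Proof. by move=> cb; apply: cfM => //; apply: (cf_G sG); cts. Qed.

Lemma chain_kf (b : V -> R) l : continuous b -> chain (fun j => kf b (l + j)).
Proof.
move=> cb j s; have [_ dG _] := sG; rewrite /kf (addnS l j).
apply: (SI_derive n0 (u := fun s th => b th * G (l + j) th s)
  (u' := fun s th => b th * G (l + j).+1 th s)).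
- by move=> th t; apply: dvZ; exact: dG.
- by move=> t; exact: cf_kf_in.
- by apply: cfM; [apply: (cf_q cb)|apply: (cf_G sG)]; cts.
Qed.

Lemma kf_out b j s : s <= e \/ 4 - e <= s -> kf b j s = 0.
Proof.
move=> h; have [_ _ G0] := sG; rewrite -[RHS](SI_cst n0); apply: SI_ext => th _.
by rewrite G0 // mulr0.
Qed.

Theorem bzero_unique : bzero G one 0 -> bzero G one 1 ->
  forall xi s, esphere R n xi -> G 0 xi s = 0.
Proof.
move=> z0 z1 xi s Sxi.
have cG s' : continuous (fun th => G 0 th s') by apply: (cf_G sG); cts.
apply: (SI_powers_eq0 (h := fun th => G 0 th s) (cG s) Sxi) => l.
pose b th := dot xi th ^+ l.
have cb : continuous b by rewrite /b; cts.
have ck := chain_kf l cb.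
(* Induction down the index: [descent] settles index l. The mean at index l - i - 1 then has
   derivative 0 and vanishes at s = 0, so it is 0 as well, until index 0 is reached. *)
suff H i : (i <= l)%N -> forall t, kf b (l - i) t = 0.
  have := H l (leqnn l) s; rewrite subnn /kf => <-; apply: SI_ext => w _.
  by rewrite /b dotC.
elim: i => [_ t|i IH il t].
  rewrite subn0; case: (leP t e) => [te|et]; first by apply: kf_out; left.
  case: (leP (4 - e) t) => [te|te]; first by apply: kf_out; right.
  rewrite -[l]addn0; apply: (descent (mu := m) ck); last first.
    by rewrite (lt_trans e0 et) (lt_trans te) // gtrBl.
  move=> j r /andP[r0 r1].
  have := zonal_average sG 0 (l + j) r cb Sxi.
  have -> : SI (fun w => zpoly m 0 (dot w xi) * bpf G b (l + j) (r *: w)) = 0.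
    rewrite -[RHS](SI_cst n0); apply: SI_ext => w Sw; rewrite (bzero_powers sG xi z0 z1) ?mulr0 //.
    by rewrite enormZ Sw mulr1 ger0_norm // ltW.
  move=> /esym; have -> : NI (fun z => SI (fun th => b th * fhc 0 th xi * G (l + j) th (r ^+ 2 + 1 - 2 * r * z)) *
      (zpoly m 0 z * wt m z)) (-1) 1 =
      kap m * NI (fun z => kf b (l + j) (r ^+ 2 + 1 - 2 * r * z) * (1 - z ^+ 2) ^+ m) (-1) 1.
    rewrite -NIZ; last first.
      apply: cfM; last by cts.
      apply: (cf_comp (h := kf b (l + j)) (f := fun z : R => r ^+ 2 + 1 - 2 * r * z) _ (@chain_continuous _ _ j ck)).
      by cts.
    congr NI; apply/funext => z; rewrite zpoly0 mul1r mulrA; congr (_ * _).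
    rewrite -SIZ; last exact: cf_kf_in.
    by apply: SI_ext => th _; rewrite fhc0; ring.
  by move=> /eqP; rewrite mulf_eq0 gt_eqF ?kap_gt0 //= => /eqP.
have E : (l - i = (l - i.+1).+1)%N by lia.
rewrite -(kf_out b (l - i.+1) (s := 0)); last by left; exact: ltW.
apply: is_derive_0_is_cst => x.
have := chain_kf (l - i.+1) cb 0 x; rewrite addn0 addnS addn0 -E IH //; lia.
Qed.

Lemma zpoly_polyE l z : zpoly m l z * wt m z =
  ((\poly_(b < l.+1) zcoef n l b) * (1 - 'X^2) ^+ m : {poly R}).[z].
Proof. by rewrite hornerM horner_poly horner_exp !hornerE. Qed.

(** By density it is enough to kill the zonal coefficients of F_1 on each sphere of radius r near 1.
    By [zonal_average] each is an integral in z with a polynomial kernel, so [annulus_moments]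
    carries the vanishing from F_0 to F_1. *)
Lemma bpf_annulus : bzero G one 0 ->
  exists2 dl : R, 0 < dl < 1 & forall x, 1 - dl < enorm x < 1 -> bpf G one 1 x = 0.
Proof.
move=> z0.
(* For 1 - dl < t < 1 this gives (1 - t)^2 <= dl^2 <= e and (1 + t)^2 >= (2 - dl)^2 >= 4 - 4 dl >= 4
   - e. *)
pose dl := Num.min (2^-1) (e / 4).
have dl0 : 0 < dl by rewrite lt_min invr_gt0 ltr0n divr_gt0.
have dl2 : dl <= 2^-1 by rewrite ge_min lexx.
have dle : dl <= e / 4 by rewrite ge_min lexx orbT.
have dl1 : 0 < dl < 1 by rewrite dl0 /=; lra.
exists dl => // x /andP[x1 x2].
have xz : x != 0 by apply/eqP => h; move: x1; rewrite h enorm0; lra.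
suff H r xi : 1 - dl < r < 1 -> esphere R n xi -> bpf G one 1 (r *: xi) = 0.
  have -> : x = enorm x *: normalize x by rewrite /normalize scalerA mulfV ?scale1r // enorm_eq0.
  by apply: H; [rewrite x1 x2|exact: sphere_normalize].
move=> {x x1 x2 xz} r1 Sxi.
have c1 : continuous one by exact: cst_continuous.
have ch : continuous (fun w : V => bpf G one 1 (r *: w)).
  by apply: (cf_comp _ (cf_bpf sG c1)); cts.
apply: (SI_powers_eq0 (h := fun w => bpf G one 1 (r *: w)) ch Sxi) => l.
have Z l' : SI (fun w => zpoly m l' (dot w xi) * bpf G one 1 (r *: w)) = 0.
  pose b th : R := 1 * fhc l' th xi.
  have cb : continuous b by apply: cfM => //; apply: cf_fhc; exact: cf_id.
  pose P : {poly R} := (\poly_(b < l'.+1) zcoef n l' b) * (1 - 'X^2) ^+ m.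
  have P0 : P != 0.
    have [z [z1 zl]] := @zpoly_neq0 R m l'.
    apply/eqP => h; have := zpoly_polyE l' z; rewrite -/P h horner0 => /eqP.
    rewrite mulf_eq0 (negPf zl) /= /wt expf_eq0 => /andP[_].
    by rewrite subr_eq0 => /eqP; rewrite expr2; move/andP: z1 => [? ?]; nra.
  have sl j : slab e (kf b j).
    split; last by move=> s; exact: kf_out.
    by have := @chain_continuous _ (fun j => kf b (j + 0)) _; move=> _ y;
      have := @chain_continuous _ _ 0 (chain_kf j cb) y; rewrite addn0.
  have dk s : dv (kf b 0) s (kf b 1 s) by exact: (chain_kf 0 cb 0 s).
  have He t : 1 - dl < t < 1 -> (1 - t) ^+ 2 <= e /\ 4 - e <= (1 + t) ^+ 2.
    by move=> /andP[t1 t2]; rewrite !expr2; split; nra.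
  rewrite (zonal_average sG l' 1 r c1 Sxi).
  under eq_fun do rewrite zpoly_polyE -/P.
  apply: (annulus_moments e0 P0 (sl 0%N) (sl 1%N) dk dl1 He _ r1) => t t1.
  have := zonal_average sG l' 0 t c1 Sxi.
  under [X in _ = NI X _ _ -> _]eq_fun do rewrite zpoly_polyE -/P.
  move=> <-; rewrite -[RHS](SI_cst n0); apply: SI_ext => w Sw; rewrite z0 ?mulr0 //.
  by move/andP: t1 => [? ?]; rewrite enormZ Sw mulr1 ger0_norm //; lra.
(* [zpoly l] is monic of degree l, so the pairing with the l-th power follows from the lower ones by
   strong induction. *)
have [k] := ubnP l; elim: k l => // k IH l lk.
have := Z l; rewrite /zpoly.
have -> : SI (fun w => (\sum_(b < l.+1) zcoef n l b * dot w xi ^+ b) * bpf G one 1 (r *: w)) =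
    \sum_(b < l.+1) zcoef n l b * SI (fun w => dot w xi ^+ b * bpf G one 1 (r *: w)).
  under [RHS]eq_bigr => b _.
    rewrite -SIZ; last by apply: cfM => //; cts.
    over.
  rewrite -SI_sum //; last by move=> b; apply: cfM; [cts|apply: cfM => //; cts].
  by apply: SI_ext => w _; rewrite mulr_suml; apply: eq_bigr => b _; rewrite mulrA.
rewrite big_ord_recr /= zcoef_lead mul1r big1 ?add0r // => b _.
by rewrite IH ?mulr0 //; apply: leq_trans (ltn_ord b) _; rewrite -ltnS.
Qed.

End kernel_of_backprojection.

(** * The range condition *)

Section test_kernel.
Context {R : realType}.
Implicit Types (p Q : {poly R}) (u : R).

Lemma dv_horner p (x : R) : dv (fun u => p.[u]) x p^`().[x].
Proof.
elim/poly_ind: p => [|p c IH].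
  under eq_fun do rewrite horner0.
  by apply: dv_eq (dvC 0 x) _; rewrite deriv0 horner0.
under eq_fun do rewrite hornerMXaddC.
apply: dv_eq (dvD (dvM IH (dvId x)) (dvC c x)) _.
by rewrite derivMXaddC !hornerE addrC.
Qed.

Lemma NI_sqr (f : R -> R) b : continuous f ->
  NI (fun t => f (t ^+ 2) * (2 * t)) 0 b = NI f 0 (b ^+ 2).
Proof.
move=> cf; rewrite (@NI_FTC _ _ (fun t => primitive f (t ^+ 2))).
- by rewrite /NI expr0n.
- by apply: cfM; [apply: (cf_comp _ cf)|]; cts.
- move=> t; apply: dv_eq (dv_comp (dvX 2 (dvId t)) (primitiveP cf _)) _.
  by rewrite /= expr1; ring.
Qed.

Lemma NI_support (f : R -> R) a b c d : continuous f -> a <= c -> c <= d -> d <= b ->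
  (forall x, x <= c \/ d <= x -> f x = 0) -> NI f a b = NI f c d.
Proof.
move=> cf ac cd db f0; rewrite (NI_split _ a c b) (NI_split _ c d b).
have c0 : continuous (fun _ : R => 0 : R) by cts.
rewrite (NI_ext cf c0 ac); last by move=> x /andP[_ xc]; apply: f0; left.
rewrite (NI_ext cf c0 db); last by move=> x /andP[dx _]; apply: f0; right.
by rewrite !NI_cst !mul0r add0r addr0.
Qed.

Lemma continuous_bound_eq0 (k : R -> R) (d C : R) : continuous k -> 0 < d ->
  (forall x, 0 < x < d -> `|k x| <= C * x) -> k 0 = 0.
Proof.
move=> ck d0 h; apply/eqP; apply: contraT => k0.
have k0' : 0 < `|k 0| / 2 by rewrite divr_gt0 // normr_gt0.
have /cvgrPdist_lt /(_ _ k0') /dist_near[r r0 hr] : {for 0, continuous (fun x => `|k x|)} by exact: (cf_norm ck).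
pose C' := `|C| + 1; have C0 : 0 < C' by rewrite ltr_wpDl.
have kC : 0 < `|k 0| / (2 * C') by rewrite divr_gt0 ?normr_gt0 // mulr_gt0.
pose x := Num.min (Num.min (d / 2) (r / 2)) (`|k 0| / (2 * C')).
have x0 : 0 < x by rewrite !lt_min kC !divr_gt0.
have [x1 x2 x3] : [/\ x <= d / 2, x <= r / 2 & x <= `|k 0| / (2 * C')].
  by rewrite /x !ge_min !lexx !orbT.
have := hr x; rewrite subr0 gtr0_norm // => /(_ ltac:(lra)).
have := h x; rewrite x0 => /(_ ltac:(lra)) kx.
move: x3; rewrite ler_pdivlMr ?mulr_gt0 // => x3.
have : C * x <= C' * x - x.
  by rewrite /C' mulrDl mul1r addrK ler_wpM2r ?ler_norm // ltW.
move=> h1 h2; have := ler_norm (`|k 0| - `|k x|); lra.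
Qed.

Context (N : nat).

(** The exponent N + 1 leaves all derivatives of order at most N equal to 0 at the ends: N
    integrations by parts have no boundary terms, and the N-th derivative extends continuously by
    0. *)
Definition tpoly : {poly R} := (1 - 'X^2) ^+ N.+1.

Lemma tpoly_derivn i : (i <= N.+1)%N -> exists Q, tpoly^`(i) = (1 - 'X^2) ^+ (N.+1 - i) * Q.
Proof.
elim: i => [_|i IH iN]; first by exists 1; rewrite derivn0 subn0 mulr1.
have [Q E] := IH (ltnW iN); have S : (N.+1 - i = (N.+1 - i.+1).+1)%N by lia.
exists ((1 - 'X^2)^`() *+ (N.+1 - i) * Q + (1 - 'X^2) * Q^`()).
rewrite derivnS E derivM deriv_exp S /= (exprS _ (N.+1 - i.+1)).
move: (_ ^+ _) (_^`()) (_^`()) => d a b; move: (1 - _) (_ - _).+1 => p k.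
rewrite mulrDr mulrnAl -mulrA -mulrnAl (mulrC p) !mulrA; congr (_ + _).
by rewrite -!mulrA !mulrnAl !mulrnAr mulrCA.
Qed.

Lemma tpoly_root i u : (i <= N)%N -> u ^+ 2 = 1 -> (tpoly^`(i)).[u] = 0.
Proof.
move=> iN u1; have [Q ->] := tpoly_derivn (leqW iN).
have -> : (N.+1 - i = (N - i).+1)%N by lia.
by rewrite hornerM horner_exp !hornerE u1 subrr expr0n mul0r.
Qed.

Lemma tpoly_IBP (k : nat -> R -> R) i j : chain k -> (i <= N)%N ->
  NI (fun u => (tpoly^`(i)).[u] * k j u) (-1) 1 =
  (-1) ^+ i * NI (fun u => tpoly.[u] * k (j + i)%N u) (-1) 1.
Proof.
move=> ck; elim: i j => [|i IH] j iN.
  by rewrite expr0 mul1r addn0 derivn0.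
have cp q : continuous (fun u : R => q.[u]) by apply: cf_horner; exact: cf_id.
rewrite (@NI_IBP _ (fun u => (tpoly^`(i)).[u]) _ _ (k j.+1)).
- rewrite !tpoly_root ?expr1n ?sqrrN ?expr1n // 1?ltnW // !mul0r subrr sub0r.
  by rewrite IH 1?ltnW // exprS mulN1r mulNr addSnnS.
- exact: cp.
- exact: chain_continuous.
- by move=> x; rewrite derivnS; exact: dv_horner.
- by move=> x; exact: ck.
Qed.

(* The [N]-th derivative of the bump [tpoly], extended by 0: the argument is [u]
   clipped to [-1, 1], at whose ends that derivative vanishes. *)
Definition tker u : R :=
  (tpoly^`(N)).[Num.max 0 (u + 1) - Num.max 0 (u - 1) - 1].

Lemma cf_tker (T : topologicalType) (f : T -> R) : continuous f -> continuous (fun x => tker (f x)).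
Proof. by move=> cf; apply: cf_horner; do 2 (apply: cfB; last by cts); apply: cf_max0; cts. Qed.

Lemma tker_out u : 1 <= `|u| -> tker u = 0.
Proof.
rewrite ler_normr /tker => /orP[h|h].
  rewrite (max_idPr _) ?(max_idPr _) ?subr_ge0 //; last by lra.
  by apply: tpoly_root => //; rewrite expr2; ring.
rewrite (max_idPl _) ?(max_idPl _); [|lra|lra].
by apply: tpoly_root => //; rewrite expr2; ring.
Qed.

Lemma tker_in u : `|u| <= 1 -> tker u = (tpoly^`(N)).[u].
Proof.
rewrite ler_norml /tker => /andP[h1 h2].
rewrite (max_idPr _) ?(max_idPl _); [|lra|lra].
by congr horner; ring.
Qed.

Lemma tker_IBP (k : nat -> R -> R) : chain k ->
  NI (fun u => tker u * k 0%N u) (-1) 1 = (-1) ^+ N * NI (fun u => tpoly.[u] * k N u) (-1) 1.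
Proof.
move=> ck; rewrite -(@tpoly_IBP k N 0) //; apply: NI_ext.
- by apply: cfM; [apply: cf_tker; exact: cf_id|exact: chain_continuous].
- by apply: cfM; [apply: cf_horner; exact: cf_id|exact: chain_continuous].
- by rewrite lerN10 || lra.
- by move=> x h; rewrite tker_in // ler_norml.
Qed.

Definition tmass : R := NI (fun u => tpoly.[u]) (-1) 1.

Lemma tmass_gt0 : 0 < tmass.
Proof.
have E u : tpoly.[u] = (1 - u ^+ 2) ^+ N.+1 by rewrite horner_exp !hornerE.
apply: (@NI_gt0 _ _ _ _ 0); first by apply: cf_horner; exact: cf_id.
- by move=> x /andP[h1 h2]; rewrite E exprn_ge0 // subr_ge0 expr2; nra.
- by lra.
- by rewrite E expr0n subr0 expr1n.
Qed.

Lemma derivn_size Q u : (size Q <= N.+1)%N -> (Q^`(N)).[u] = N`!%:R * Q`_N.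
Proof.
move=> sQ; have -> : Q^`(N) = (Q`_N *+ N`!)%:P.
  apply/polyP => i; rewrite coef_derivn coefC; case: i => [|i].
    by rewrite addn0 ffactnn eqxx.
  by rewrite nth_default ?mul0rn //; apply: leq_trans sQ _; lia.
by rewrite hornerC mulr_natl.
Qed.

(** N integrations by parts replace [Q] by its N-th derivative, a constant because deg Q <= N. The
    bound on c and h keeps the window [c - h, c + h] inside [-1, 1]. *)
Lemma tker_poly Q c h : (size Q <= N.+1)%N -> 0 < h -> `|c| + h <= 1 ->
  NI (fun z => tker ((c - z) / h) * Q.[z]) (-1) 1 = h ^+ N.+1 * N`!%:R * Q`_N * tmass.
Proof.
move=> sQ h0 ch.
pose f z := tker ((c - z) / h) * Q.[z].
have cf : continuous f.
  by apply: cfM; [apply: cf_tker|apply: cf_horner; exact: cf_id]; cts.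
have h00 : h != 0 by rewrite gt_eqF.
have /andP[c1 c2] : - (1 - h) <= c <= 1 - h by rewrite -ler_norml; lra.
rewrite -/f (@NI_support f _ _ (c - h) (c + h)) //; [|lra|lra|lra|]; last first.
  move=> x hx; rewrite /f tker_out ?mul0r // normrM normfV (gtr0_norm h0).
  rewrite ler_pdivlMr // mul1r ler_normr; apply/orP; case: hx => ?; [left|right]; lra.
have -> : NI f (c - h) (c + h) = - NI (fun x => f (- h * x + c) * - h) (-1) 1.
  by rewrite NI_affine // mulrN1 opprK mulr1 (addrC h) (addrC _ c) NIC.
rewrite -NIN; last by apply: cfM; [apply: (cf_comp _ cf)|]; cts.
pose k i u := h * ((- h) ^+ i * (Q^`(i)).[- h * u + c]).
have ck : chain k.
  move=> i x; rewrite /k; apply: dvZ; rewrite exprSr -mulrA [- h * _]mulrC; apply: dvZ.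
  apply: dv_affine; rewrite derivnS; exact: dv_horner.
transitivity (NI (fun u => tker u * k 0%N u) (-1) 1).
  congr NI; apply/funext => u; rewrite /f /k expr0 derivn0.
  have -> : (c - (- h * u + c)) / h = u by field.
  ring.
rewrite tker_IBP // /k.
under eq_fun do rewrite derivn_size // mulrC.
rewrite NIZ; last by apply: cf_horner; exact: cf_id.
rewrite -/tmass [in RHS]exprS mulrA; congr (_ * tmass).
rewrite mulrCA (mulrA ((-1) ^+ N)) -exprMn mulN1r opprK; ring.
Qed.

End test_kernel.


(** * Change of centre and the limit of the smoothed mean *)

Section spherical_mean_family.
Context {R : realType} (m : nat).
Local Notation n := (2 * m + 3)%N.
Local Notation N := (2 * m + 1)%N.
Local Notation V := 'rV[R]_n.

Let n0 : (0 < n)%N. Proof. by rewrite addnS. Qed.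

Context (e : R) (A : nat -> V -> R -> R).
Hypothesis sA : sfam e A.

Context (f : V -> R) (dl : R).
Hypothesis cf : continuous f.
Hypothesis dl1 : 0 < dl < 1.
Hypothesis f0 : forall y, 1 - dl <= enorm y -> f y = 0.
Hypothesis A0 : forall th t, esphere R n th -> 0 <= t ->
  A 0 th (t ^+ 2) = t ^+ N * SI (fun w => f (th + t *: w)).

(** The shift a is the variable in which to smooth: its derivatives raise the index, and a = 0
    returns [bpf]. *)
Definition shifted_bpf (q : V -> R) (x : V) j a : R := SI (fun th => q th * A j th (sqd x th + a)).

Lemma chain_shifted_bpf q x : continuous q -> chain (shifted_bpf q x).
Proof.
move=> cq j a; have [_ dA _] := sA.
apply: (SI_derive n0 (u := fun a th => q th * A j th (sqd x th + a))
  (u' := fun a th => q th * A j.+1 th (sqd x th + a))).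
- move=> th s; apply: dvZ; have := @dv_affine _ (A j th) s (A j.+1 th (1 * s + sqd x th)) 1 (sqd x th) (dA _ _ _).
  by rewrite mulr1; under eq_fun do rewrite mul1r addrC; rewrite mul1r addrC.
- move=> s; apply: cfM => //; apply: (cf_G sA); first by cts.
  by apply: cfD; [apply: cf_sqd; cts|cts].
- apply: cfM; first by apply: (cf_q cq); cts.
  by apply: (cf_G sA); [|apply: cfD; [apply: cf_sqd|]]; cts.
Qed.

Lemma sqd_sphere (x th : V) : esphere R n th -> sqd x th = dot (x - th) (x - th).
Proof. by move=> Sth; rewrite /sqd !dotE (dot_sphere Sth) (dotC th x); ring. Qed.

Lemma sqd_bounds (x th : V) : enorm x < 1 -> esphere R n th ->
  (1 - enorm x) ^+ 2 <= sqd x th <= (1 + enorm x) ^+ 2.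
Proof.
move=> x1 Sth; rewrite /sqd; have := dot_le x th; rewrite Sth mulr1 ler_norml => /andP[h1 h2].
have := sqr_enorm x; rewrite !expr2 => E; apply/andP; split; lra.
Qed.

Definition ccoef (x eta : V) (r : R) : R := dot eta x + r / 2.

(* Polar coordinates about [th] on the left, about [x] on the right, where
   [|y - th|^2 - |x - th|^2 = 2 r (ccoef x eta r - th . eta)] at [y = x + r eta]. *)
Lemma shift_to_center (q : V -> R) (x : V) (psi : R -> R) (d : R) :
  continuous q -> continuous psi -> enorm x < 1 -> 0 < d -> d <= (1 - enorm x) ^+ 2 ->
  (forall a, d <= `|a| -> psi a = 0) ->
  NI (fun a => psi a * shifted_bpf q x 0 a) (- d) d =
  2 * NI (fun r => r ^+ n.-1 * SI (fun eta => f (x + r *: eta) *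
      SI (fun th => q th * psi (2 * r * (ccoef x eta r - dot th eta))))) 0 3.
Proof.
move=> cq cpsi x1 d0 dx psi0.
have cpsi' (T : topologicalType) (g : T -> R) : continuous g -> continuous (fun x => psi (g x)).
  by move=> cg; exact: (cf_comp cg cpsi).
have cf' (T : topologicalType) (g : T -> V) : continuous g -> continuous (fun x => f (g x)).
  by move=> cg; exact: (cf_comp cg cf).
have cq' (T : topologicalType) (g : T -> V) : continuous g -> continuous (fun x => q (g x)).
  by move=> cg; exact: (cf_comp cg cq).
pose h (th y : V) := psi (dot (y - th) (y - th) - sqd x th) * f y.
have ch th : continuous (h th) by apply: cfM => //; apply: cpsi'; cts.
have step th : esphere R n th ->
    NI (fun a => psi a * A 0 th (sqd x th + a)) (- d) d =
    2 * NI (fun r => r ^+ n.-1 * SI (fun eta => h th (x + r *: eta))) 0 3.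
  move=> Sth; have /andP[s1 s2] := sqd_bounds x1 Sth.
  have s4 : (1 + enorm x) ^+ 2 < 4 by have := enorm_ge0 x; rewrite expr2; nra.
  have d1 : d <= 1 by apply: le_trans dx _; have := enorm_ge0 x; rewrite expr2; nra.
  have cA : continuous (fun a => A 0 th a) by apply: (cf_G sA); cts.
  have cF : continuous (fun a => psi a * A 0 th (sqd x th + a)).
    by apply: cfM => //; apply: (cf_comp _ cA); cts.
  (* [psi] is 0 beyond |a| = d, so the interval may grow until s = sqd x th + a runs over [0, 9] and
     t = sqrt s over [0, 3]. Radius 3 covers the unit ball from every centre of norm at most 1. *)
  rewrite -(@NI_support _ _ (- sqd x th) (9 - sqd x th)) //; [|lra|lra|lra|]; last first.
    move=> a ha; rewrite psi0 ?mul0r // ler_normr; apply/orP; case: ha => ?; [right|left]; lra.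
  have cF' : continuous (fun s => psi (s - sqd x th) * A 0 th s).
    by apply: cfM => //; apply: cpsi'; cts.
  have := @NI_affine _ _ (- sqd x th) (9 - sqd x th) 1 (sqd x th) cF'.
  rewrite !mul1r subrK addNr.
  under [in X in X = _ -> _]eq_fun do rewrite !mul1r mulr1 addrK addrC.
  under [in X in X = _ -> _]eq_fun do rewrite addrC.
  move=> E; transitivity (NI (fun x0 => psi x0 * A 0 th (x0 + sqd x th)) (- sqd x th) (9 - sqd x th)).
    by congr NI; apply/funext => a; rewrite addrC.
  rewrite E; have -> : (9 : R) = 3 ^+ 2 by rewrite expr2; lra.
  rewrite -NI_sqr // -(@polar_translate _ _ n0 (h th) th x 3 3 1) //; first last.
  - lra.
  - by rewrite Sth; lra.
  - by move=> y y1; rewrite /h f0 ?mulr0 //; move: dl1 => /andP[? ?]; lra.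
  rewrite -NIZ; last first.
    apply: cfM; first by cts.
    apply: (SI_continuous n0 (u := fun (t : R) w => h th (th + t *: w))).
    by apply: cfM; [apply: cpsi'|apply: cf']; cts.
  apply: NI_ext.
  - apply: cfM; last by cts.
    by apply: (cf_comp _ cF'); cts.
  - apply: cfM; first by cts.
    apply: cfM; first by cts.
    apply: (SI_continuous n0 (u := fun (t : R) w => h th (th + t *: w))).
    by apply: cfM; [apply: cpsi'|apply: cf']; cts.
  - by lra.
  move=> t /andP[t0 _]; rewrite A0 //.
  have -> : SI (fun w => h th (th + t *: w)) = psi (t ^+ 2 - sqd x th) * SI (fun w => f (th + t *: w)).
    rewrite -SIZ; last by apply: cf'; cts.
    apply: SI_ext => w Sw; rewrite /h; congr (psi (_ - _) * _).
    by rewrite addrAC subrr add0r !dotE (dot_sphere Sw); ring.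
  (* The factor t^N from [A0] and 2 t from s = t^2 make up twice the polar Jacobian t^(n-1). *)
  have -> : n.-1 = N.+1 by rewrite !addnS.
  by rewrite (exprS t N); move: (t ^+ N) (psi _) => T Y; ring.
transitivity (SI (fun th => NI (fun a => psi a * (q th * A 0 th (sqd x th + a))) (- d) d)).
  rewrite (SI_NI n0 (u := fun a th => psi a * (q th * A 0 th (sqd x th + a)))); last first.
    apply: cfM; first by apply: cpsi'; cts.
    apply: cfM; first by apply: cq'; cts.
    by apply: (cf_G sA); [|apply: cfD; [apply: cf_sqd|]]; cts.
  congr NI; apply/funext => a; rewrite -SIZ //; apply: cfM => //.
  by apply: (cf_G sA); [|apply: cfD; [apply: cf_sqd|]]; cts.
pose u (r : R) (th : V) := q th * (r ^+ n.-1 * SI (fun eta => h th (x + r *: eta))).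
have ch3 : continuous (fun z : (R * V) * V => h z.1.2 (x + z.1.1 *: z.2)).
  apply: cfM; last by apply: cf'; cts.
  by apply: cpsi'; apply: cfB; [|apply: cf_sqd]; cts.
have cu : continuous (fun z : R * V => u z.1 z.2).
  apply: cfM; first by apply: cq'; cts.
  apply: cfM; first by cts.
  exact: (SI_continuous n0 (u := fun (z : R * V) eta => h z.2 (x + z.1 *: eta))).
transitivity (SI (fun th => 2 * NI (fun r => u r th) 0 3)).
  apply: SI_ext => th Sth.
  transitivity (q th * NI (fun a => psi a * A 0 th (sqd x th + a)) (- d) d).
    rewrite -NIZ; last first.
      by apply: cfM => //; apply: (cf_G sA); cts.
    by congr NI; apply/funext => a; ring.
  rewrite step // mulrCA; congr (_ * _); rewrite -NIZ //.
  apply: cfM; first by cts.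
  apply: (SI_continuous n0 (u := fun (t : R) w => h th (x + t *: w))).
  by apply: cfM; [apply: cpsi'|apply: cf']; cts.
rewrite SIZ; last first.
  by apply: (NI_continuous (u := fun (th : V) r => u r th)); exact: (@cf_swap _ _ _ u cu).
rewrite (SI_NI n0 _ _ cu); congr (_ * NI _ _ _); apply/funext => r.
have ch2 : continuous (fun z : V * V => q z.1 * h z.1 (x + r *: z.2)).
  apply: cfM; first by apply: cq'; cts.
  apply: cfM; last by apply: cf'; cts.
  by apply: cpsi'; apply: cfB; [|apply: cf_sqd]; cts.
rewrite /u; transitivity (r ^+ n.-1 * SI (fun th => SI (fun eta => q th * h th (x + r *: eta)))).
  rewrite -SIZ; last first.
    exact: (SI_continuous n0 (u := fun th eta => q th * h th (x + r *: eta)) ch2).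
  apply: SI_ext => th _; rewrite SIZ; first by ring.
  by apply: cfM; [apply: cpsi'|apply: cf']; cts.
rewrite (SI_SI n0 (u := fun th eta => q th * h th (x + r *: eta))) //; congr (_ * _).
apply: SI_ext => eta Seta; rewrite -SIZ; last by apply: cfM => //; apply: cpsi'; cts.
apply: SI_ext => th Sth; rewrite /h.
have -> : dot (x + r *: eta - th) (x + r *: eta - th) - sqd x th = 2 * r * (ccoef x eta r - dot th eta).
  rewrite /sqd /ccoef !dotE (dot_sphere Sth) (dot_sphere Seta).
  by rewrite (dotC th x) (dotC th eta) (dotC eta x); field.
by ring.
Qed.

(** With y = x + r eta the coefficient is eta . (x + y) / 2, less than 1 - dl/2 in absolute value
    since |x| < 1 and |y| < 1 - dl. The second term is at most dl/2. *)
Lemma ccoef_bound (x eta : V) (r d : R) : enorm x < 1 -> esphere R n eta -> dl * r >= d -> 0 < d ->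
  enorm (x + r *: eta) < 1 - dl -> `|ccoef x eta r| + d / (2 * r) <= 1.
Proof.
move=> x1 Seta dr d0 xr; have /andP[l0 l1] := dl1.
have r0 : 0 < r by rewrite -(pmulr_rgt0 _ l0); lra.
have -> : ccoef x eta r = 2^-1 * dot eta (x + (x + r *: eta)).
  by rewrite /ccoef !dotE (dot_sphere Seta); field.
have h : d / (2 * r) <= dl / 2 by rewrite ler_pdivrMr ?mulr_gt0 //; lra.
have := dot_le eta (x + (x + r *: eta)); rewrite Seta mul1r => h1.
have := enormD x (x + r *: eta) => h2.
rewrite normrM gtr0_norm ?invr_gt0 //; lra.
Qed.

Context (Q : {poly R}).
Hypothesis sQ : (size Q <= N.+1)%N.

(* Smooth [A N] by the kernel [tker N (. / d)] and let [d] tend to 0. After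
   [shift_to_center], the integral over the sphere is exactly a constant times
   [(d / r)^(N+1)] as soon as [r >= d / dl], and the rest is [O(d)]. *)
Lemma center_value (q : V -> R) (x : V) : continuous q ->
  (forall eta psi, esphere R n eta -> continuous psi ->
    SI (fun th => q th * psi (dot th eta)) = q eta * (kap m * NI (fun z => psi z * Q.[z]) (-1) 1)) ->
  enorm x < 1 ->
  bpf A q N x = - (2 * kap m * N`!%:R * Q`_N / 2 ^+ N.+1) *
    NI (fun r => SI (fun eta => f (x + r *: eta) * q eta)) 0 3.
Proof.
move=> cq zq x1; have /andP[l0 l1] := dl1.
have cf' (T : topologicalType) (g : T -> V) : continuous g -> continuous (fun x => f (g x)).
  by move=> cg; exact: (cf_comp cg cf).
have cq' (T : topologicalType) (g : T -> V) : continuous g -> continuous (fun x => q (g x)).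
  by move=> cg; exact: (cf_comp cg cq).
pose Phi := shifted_bpf q x; have cPhi : chain Phi by exact: chain_shifted_bpf.
pose P := tpoly N : {poly R}; pose D := tmass N : R.
pose B := N`!%:R * Q`_N * D / 2 ^+ N.+1.
pose S r := SI (fun eta => f (x + r *: eta) * q eta).
have cS : continuous S.
  apply: (SI_continuous n0 (u := fun (r : R) eta => f (x + r *: eta) * q eta)).
  by apply: cfM; [apply: cf'|apply: cq']; cts.
have n1 : n.-1 = N.+1 by rewrite !addnS.
(* The first term is the smoothed mean; at d = 0 it is [tmass N] times [bpf A q N x]. So k 0 = 0 is
   the claim. *)
pose k d := NI (fun u => P.[u] * Phi N (d * u)) (-1) 1 + 2 * kap m * B * NI S 0 3.
have ck : continuous k.
  apply: cfD; last by cts.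
  apply: (NI_continuous (u := fun (d : R) u => P.[u] * Phi N (d * u))).
  apply: cfM; first by apply: cf_horner; cts.
  by apply: (cf_comp _ (@chain_continuous _ _ N cPhi)); cts.
have cball1 : compact [set y : V | enorm y <= 1] by exact: compact_cball.
have [Mf [Mf0 hMf']] := continuous_bounded_on cball1 cf.
have hMf y : `|f y| <= Mf.
  case: (leP (enorm y) 1) => h; first exact: hMf'.
  by rewrite f0 ?normr0 //; lra.
have [Mq [Mq0 hMq]] := continuous_bounded_on (@compact_sphere R n) cq.
have [MT MT0 hMT'] : exists2 M : R, 0 <= M & forall u : R, -1 <= u <= 1 -> `|tker N u| <= M.
  by apply: continuous_itv_bounded; apply: cf_tker; exact: cf_id.
have hMT u : `|tker N u : R| <= MT.
  case: (leP 1 `|u|) => h; first by rewrite tker_out // normr0.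
  by apply: hMT'; rewrite -ler_norml ltW.
have [MQ MQ0 hMQ] : exists2 M : R, 0 <= M & forall u : R, -1 <= u <= 1 -> `|Q.[u]| <= M.
  by apply: continuous_itv_bounded; apply: cf_horner; exact: cf_id.
pose C0 := `|B| * (Mf * Mq) + dl^-1 ^+ N.+1 * (Mf * Mq * (MT * MQ * 2)).
have C00 : 0 <= C0 by rewrite addr_ge0 ?mulr_ge0 // exprn_ge0 // invr_ge0 ltW.
suff k0 : k 0 = 0.
  have -> : bpf A q N x = Phi N 0.
    by rewrite /Phi /shifted_bpf; apply: SI_ext => th _; rewrite addr0.
  move: k0; rewrite /k.
  under eq_fun do rewrite mul0r mulrC.
  rewrite NIZ; last by apply: cf_horner; exact: cf_id.
  rewrite -/(tmass N) -/D -/S /B => /eqP; rewrite addr_eq0 => /eqP E.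
  have D0 : D != 0 by rewrite gt_eqF // tmass_gt0.
  by apply: (mulIf D0); rewrite E; ring.
have x0 : 0 < (1 - enorm x) ^+ 2 by rewrite exprn_gt0 // subr_gt0.
(* d < (1 - |x|)^2 is the condition of [shift_to_center], and d < 3 dl puts the threshold d / dl
   below the outer radius 3. *)
pose d0 := Num.min ((1 - enorm x) ^+ 2) (3 * dl).
apply: (@continuous_bound_eq0 _ k d0 (2 * kap m * C0 / dl) ck).
  by rewrite lt_min x0 /=; lra.
move=> d /andP[dp]; rewrite lt_min => /andP[dx d3].
have d00 : d != 0 by rewrite gt_eqF.
pose psi a := tker N (a / d).
have cpsi' (T : topologicalType) (g : T -> R) : continuous g -> continuous (fun x => psi (g x)).
  by move=> cg; apply: cf_tker; cts.
have cpsi : continuous psi by apply: cpsi'; exact: cf_id.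
have psi0 a : d <= `|a| -> psi a = 0.
  by move=> h; apply: tker_out; rewrite normrM normfV (gtr0_norm dp) ler_pdivlMr ?mul1r.
pose J r eta := NI (fun z => psi (2 * r * (ccoef x eta r - z)) * Q.[z]) (-1) 1.
have cJ : continuous (fun z : R * V => J z.1 z.2).
  apply: (NI_continuous (u := fun (w : R * V) z => psi (2 * w.1 * (ccoef x w.2 w.1 - z)) * Q.[z])).
  by apply: cfM; [apply: cpsi'; rewrite /ccoef|apply: cf_horner]; cts.
(* The N derivatives move from the kernel to [Phi]; N is odd, whence the minus sign. *)
have E1 : NI (fun a => psi a * Phi 0%N a) (- d) d =
    - (d ^+ N.+1 * NI (fun u => P.[u] * Phi N (d * u)) (-1) 1).
  have cpP : continuous (fun a => psi a * Phi 0%N a).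
    by apply: cfM => //; exact: chain_continuous.
  have := @NI_affine _ _ (-1) 1 d 0 cpP; rewrite mulrN1 mulr1 !addr0 => <-.
  pose kk i u := d ^+ i.+1 * Phi i (d * u).
  have ckk : chain kk.
    move=> i u; rewrite /kk (exprSr d i.+1) -mulrA; apply: dvZ; rewrite mulrC.
    have := @dv_affine _ (Phi i) u (Phi i.+1 (d * u + 0)) d 0 (cPhi _ _).
    by under eq_fun do rewrite addr0; rewrite addr0.
  transitivity (NI (fun u => tker N u * kk 0%N u) (-1) 1).
    congr NI; apply/funext => u; rewrite /psi /kk addr0 expr1.
    have -> : d * u / d = u by field.
    by ring.
  rewrite tker_IBP // -signr_odd oddD oddM /= expr1 mulN1r /kk -NIZ.
    by congr (- NI _ _ _); apply/funext => u; rewrite mulrCA.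
  apply: cfM; first by apply: cf_horner; exact: cf_id.
  by apply: (cf_comp _ (@chain_continuous _ _ N cPhi)); cts.
have := shift_to_center cq cpsi x1 dp (ltW dx) psi0; rewrite -/Phi E1 n1 => {}E1.
(* [T] is 0 for r >= d / dl by [tker_poly] and of size d^(N+1) below. Its integral is thus of order
   d^(N+2), and dividing by d^(N+1) bounds k d by a multiple of d. *)
pose T r := d ^+ N.+1 * (B * S r) - r ^+ N.+1 * SI (fun eta => f (x + r *: eta) * (q eta * J r eta)).
have cfJ : continuous (fun z : R * V => f (x + z.1 *: z.2) * (q z.2 * J z.1 z.2)).
  by apply: cfM; [apply: cf'|apply: cfM => //; apply: cq']; cts.
have cfJr (r : R) : continuous (fun eta : V => f (x + r *: eta) * (q eta * J r eta)).
  apply: cfM; first by apply: cf'; cts.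
  by apply: cfM => //; apply: (cf2 cJ); cts.
have cSJ : continuous (fun r : R => SI (fun eta => f (x + r *: eta) * (q eta * J r eta))).
  exact: (SI_continuous n0 (u := fun (r : R) eta => f (x + r *: eta) * (q eta * J r eta))).
have cT : continuous T by apply: cfB; apply: cfM; cts => //; apply: cfM => //; cts.
have E2 : d ^+ N.+1 * k d = 2 * kap m * NI T 0 3.
  have -> : NI T 0 3 = d ^+ N.+1 * (B * NI S 0 3) -
      NI (fun r => r ^+ N.+1 * SI (fun eta => f (x + r *: eta) * (q eta * J r eta))) 0 3.
    rewrite -NIZ // -NIZ; last by apply: cfM => //; cts.
    by rewrite -NIB //; apply: cfM; cts => //; apply: cfM => //; cts.
  rewrite /k mulrDr -[d ^+ N.+1 * NI _ _ _]opprK E1.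
  have -> : NI (fun r => r ^+ N.+1 * SI (fun eta => f (x + r *: eta) *
      SI (fun th => q th * psi (2 * r * (ccoef x eta r - dot th eta))))) 0 3 =
    kap m * NI (fun r => r ^+ N.+1 * SI (fun eta => f (x + r *: eta) * (q eta * J r eta))) 0 3.
    rewrite -NIZ; last by apply: cfM => //; cts.
    congr NI; apply/funext => r; rewrite [RHS]mulrCA; congr (_ * _).
    rewrite -SIZ; last exact: cfJr.
    apply: SI_ext => eta Seta.
    rewrite (zq eta (fun z => psi (2 * r * (ccoef x eta r - z))) Seta); last by apply: cpsi'; cts.
    by rewrite -/(J r eta); ring.
  by ring.
have kp := kap_gt0 m : 0 < kap m :> R.
have rho3 : d / dl <= 3 by rewrite ler_pdivrMr //; exact: ltW.
have rho0 : 0 <= d / dl by rewrite divr_ge0 // ltW.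
have T0 r : d / dl <= r -> T r = 0.
  rewrite ler_pdivrMr // => hr; have r0 : 0 < r by rewrite -(pmulr_lgt0 _ l0); lra.
  have r00 : r != 0 by rewrite gt_eqF.
  have cfq : continuous (fun eta : V => f (x + r *: eta) * q eta) by apply: cfM => //; apply: cf'; cts.
  rewrite /T /S mulrA -(SIZ (d ^+ N.+1 * B) cfq) -(SIZ (r ^+ N.+1) (cfJr r)).
  apply/eqP; rewrite subr_eq0; apply/eqP.
  apply: SI_ext => eta Seta.
  case: (leP (1 - dl) (enorm (x + r *: eta))) => hy; first by rewrite f0 // !mul0r !mulr0.
  have h0 : 0 < d / (2 * r) by rewrite divr_gt0 // mulr_gt0.
  have cb := @ccoef_bound x eta r d x1 Seta; rewrite mulrC in cb.
  have -> : J r eta = (d / (2 * r)) ^+ N.+1 * N`!%:R * Q`_N * D.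
    rewrite -(tker_poly sQ h0 (cb hr dp hy)).
    congr NI; apply/funext => z; rewrite /psi; congr (tker N _ * _); field.
    by rewrite d00 r00.
  rewrite /B expr_div_n exprMn; have := expf_neq0 N.+1 r00; have : (2 : R) ^+ N.+1 != 0 by rewrite expf_neq0.
  move: (r ^+ N.+1) (2 ^+ N.+1) (d ^+ N.+1) (N`!%:R : R) => a b c g b0 a0.
  by field; rewrite a0 b0.
have TC r : 0 <= r <= d / dl -> `|T r| <= C0 * d ^+ N.+1.
  move=> /andP[r0 rd]; apply: le_trans (ler_normB _ _) _; rewrite /C0 mulrDl.
  have dN : 0 < d ^+ N.+1 by exact: exprn_gt0.
  apply: lerD.
    rewrite normrM (gtr0_norm dN) mulrC ler_wpM2r ?(ltW dN) // normrM ler_wpM2l //.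
    apply: (SI_norm_le n0); first by apply: cfM => //; apply: cf'; cts.
    by move=> eta Seta; rewrite normrM ler_pM // hMq.
  rewrite normrM ger0_norm ?exprn_ge0 //.
  have -> : dl^-1 ^+ N.+1 * (Mf * Mq * (MT * MQ * 2)) * d ^+ N.+1 =
      (d / dl) ^+ N.+1 * (Mf * Mq * (MT * MQ * 2)) by rewrite exprMn; ring.
  apply: ler_pM => //; first by rewrite exprn_ge0.
    by rewrite lerXn2r // nnegrE.
  apply: (SI_norm_le n0); first exact: cfJr.
  move=> eta Seta; rewrite normrM -mulrA; apply: ler_pM => //.
  rewrite normrM; apply: ler_pM => //; first exact: hMq.
  have -> : (2 : R) = 1 - -1 by ring.
  apply: NI_norm_le; [|lra|].
    by apply: cfM; [apply: cpsi'|apply: cf_horner]; cts.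
  by move=> z hz; rewrite normrM; apply: ler_pM => //; (exact: hMT || exact: hMQ).
have dN : 0 < d ^+ N.+1 by exact: exprn_gt0.
have : `|NI T 0 3| <= C0 * d ^+ N.+1 * (d / dl - 0).
  rewrite (NI_split _ 0 (d / dl) 3).
  have c00 : continuous (fun _ : R => 0 : R) by cts.
  rewrite (NI_ext cT c00 rho3); last by move=> r /andP[hr _]; exact: T0.
  by rewrite NI_cst mul0r addr0; apply: NI_norm_le.
rewrite subr0 -(ler_pM2l dN) => h.
rewrite -(ler_pM2l dN) -[d ^+ N.+1 * `|_|](_ : `|d ^+ N.+1 * k d| = _); last first.
  by rewrite normrM (gtr0_norm dN).
rewrite E2 normrM gtr0_norm ?mulr_gt0 //.
move: h; rewrite ler_pM2l // => h.
have -> : d ^+ N.+1 * (2 * kap m * C0 / dl * d) = 2 * kap m * (C0 * d ^+ N.+1 * (d / dl)) by ring.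
by rewrite ler_wpM2l // ltW // mulr_gt0.
Qed.

End spherical_mean_family.


(** * Backprojections of the family of a spherical mean *)

Section range_condition.
Context {R : realType} (m : nat).
Local Notation n := (2 * m + 3)%N.
Local Notation N := (2 * m + 1)%N.
Local Notation V := 'rV[R]_n.

Let n0 : (0 < n)%N. Proof. by rewrite addnS. Qed.

Local Notation one := (fun _ : V => 1 : R).

Context (e : R) (A : nat -> V -> R -> R) (f : V -> R) (dl : R).
Hypothesis sA : sfam e A.
Hypothesis cf : continuous f.
Hypothesis dl1 : 0 < dl < 1.
Hypothesis f0 : forall y, 1 - dl <= enorm y -> f y = 0.
Hypothesis A0 : forall th t, esphere R n th -> 0 <= t ->
  A 0 th (t ^+ 2) = t ^+ N * SI (fun w => f (th + t *: w)).

Let size_quadratic : (size ((1 - 'X^2)%R : {poly R}) <= 3)%N.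
Proof. by apply: leq_trans (size_polyD _ _) _; rewrite size_polyN size_polyXn size_poly1. Qed.

Lemma size_wt : (size ((1 - 'X^2) ^+ m : {poly R}) <= N)%N.
Proof.
apply: leq_trans (size_poly_exp_leq _ _) _.
by move: size_quadratic; move: (size _) => k; nia.
Qed.

Lemma coef_wt : ((1 - 'X^2) ^+ m : {poly R})`_(2 * m) = (-1) ^+ m.
Proof.
elim: (m) => [|k IH]; first by rewrite expr0 coef1.
rewrite exprSr mulrBr mulr1 coefB coefMXn mulnS addnC addn2 /= !subSS subn0 IH.
rewrite nth_default; first by rewrite sub0r exprS mulN1r.
apply: leq_trans (size_poly_exp_leq _ _) _.
by move: size_quadratic; move: (size _) => l; nia.
Qed.

Lemma mean_bzero : bzero A one N.
Proof.
move=> x x1; pose Q : {poly R} := (1 - 'X^2) ^+ m.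
rewrite (@center_value _ m e A sA f dl cf dl1 f0 A0 Q) //.
- by rewrite nth_default ?size_wt // mulr0 !mul0r oppr0 mul0r.
- exact: leqW size_wt.
- exact: cst_continuous.
move=> eta psi Seta cpsi; rewrite mul1r.
transitivity (SI (fun th => psi (dot th eta))).
  by apply: SI_ext => th _; rewrite mul1r.
rewrite (SI_zonal Seta cpsi); congr (_ * NI _ _ _); apply/funext => z.
by rewrite /Q /wt horner_exp !hornerE.
Qed.

(** The constant of [center_value], up to sign, for Q = X (1 - X^2)^m, whose coefficient at N = 2 m
    + 1 is (-1)^m. *)
Definition rconst : R := 2 * kap m * N`!%:R * (-1) ^+ m / 2 ^+ N.+1.

Lemma rconst_neq0 : rconst != 0.
Proof.
have k0 : kap m != 0 :> R by rewrite gt_eqF // kap_gt0.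
have f0' : N`!%:R != 0 :> R by rewrite pnatr_eq0 -lt0n fact_gt0.
by rewrite /rconst !mulf_neq0 // ?invr_eq0 ?expf_neq0 ?oppr_eq0 ?oner_eq0.
Qed.

Lemma mean_bpf_dot v x : esphere R n v -> enorm x < 1 ->
  bpf A (dot v) N x = - rconst * NI (fun r => SI (fun eta => f (x + r *: eta) * dot v eta)) 0 3.
Proof.
move=> Sv x1; pose Q : {poly R} := 'X * (1 - 'X^2) ^+ m.
have E := @center_value _ m e A sA f dl cf dl1 f0 A0 Q.
rewrite E //.
- have -> : Q`_N = (-1) ^+ m by rewrite /Q addn1 coefXM /= coef_wt.
  by [].
- rewrite /Q mulrC; apply: leq_trans (size_polyMleq _ _) _.
  by rewrite size_polyX addn2 /=; have := size_wt; rewrite ltnS.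
- by cts.
move=> eta psi Seta cpsi; rewrite (dotC v eta).
transitivity (SI (fun th => dot th v * psi (dot th eta))).
  by apply: SI_ext => th _; rewrite dotC.
rewrite (SI_zonal1 Seta Sv cpsi); congr (_ * (_ * NI _ _ _)); apply/funext => z.
by rewrite /Q /wt hornerM horner_exp !hornerE.
Qed.

Context (p : 'I_n -> V -> R).
Hypothesis cp : forall i, continuous (p i).
Hypothesis gf : forall y v t,
  dv (fun t => f (y + t *: v)) t (\sum_i v ord0 i * p i (y + t *: v)).

Let ei (i : 'I_n) : V := delta_mx ord0 i.

Lemma sphere_delta i : esphere R n (ei i).
Proof. by apply: sphere_dot; rewrite dot_delta mxE !eqxx. Qed.

(* Both sides are the divergence of [x |-> bpf A theta N x]. *)
Theorem mean_bpf x : enorm x < 1 ->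
  2 * (dot x x - 1) * bpf A one N.+1 x = rconst * f x.
Proof.
move=> x1; have c1 : continuous one by exact: cst_continuous.
have cd i : continuous (fun th : V => dot (ei i) th) by cts.
have cdd i : continuous (fun th : V => dot (ei i) th * dot (ei i) th) by cts.
(* The divergence as given by [dv_bpf]. By [mean_bzero] the weight theta_i may be replaced by the
   factor x_i, which produces |x|^2, and the squares theta_i^2 add up to 1. *)
have L : \sum_i (2 * dot x (ei i) * bpf A (fun th => dot (ei i) th) N.+1 x -
     2 * bpf A (fun th => dot (ei i) th * dot (ei i) th) N.+1 x) =
   2 * (dot x x - 1) * bpf A one N.+1 x.
  rewrite sumrB; have -> : \sum_i 2 * bpf A (fun th => dot (ei i) th * dot (ei i) th) N.+1 x = 2 * bpf A one N.+1 x.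
    rewrite -(bpf_sum sA _ (fun=> 2)) //.
    rewrite -[2 * _](big_seq1 (@GRing.add R) tt (fun=> 2 * bpf A one N.+1 x)).
    rewrite -(bpf_sum sA _ (fun=> 2) (q := fun=> one)) //.
    apply: (bpf_ext A) => th Sth; rewrite big_seq1 mulr1 -mulr_sumr -[RHS](mulr1 2); congr (_ * _).
    by rewrite -(dot_sphere Sth) {3}/dot; apply: eq_bigr => i _; rewrite (dotC (ei i)) dot_delta.
  rewrite mulrBr mulr1 mulrBl; congr (_ - _).
  have Ed : dot x x = \sum_i x ord0 i * x ord0 i by [].
  rewrite Ed mulr_sumr mulr_suml; apply: eq_bigr => i _.
  have := bzero_derive sA (ei i) c1 mean_bzero x1 => E.
  have -> : bpf A (fun th => dot (ei i) th) N.+1 x = dot x (ei i) * bpf A one N.+1 x.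
    by rewrite E; apply: (bpf_ext A) => th _; rewrite mulr1.
  by rewrite dot_delta; ring.
rewrite -L; pose F i y := NI (fun r => SI (fun eta => f (y + r *: eta) * dot (ei i) eta)) 0 3.
pose F' i y := NI (fun r => SI (fun eta => p i (y + r *: eta) * dot (ei i) eta)) 0 3.
have cpp (T : topologicalType) i (g : T -> V) : continuous g -> continuous (fun x => p i (g x)).
  by move=> cg; exact: (cf_comp cg (@cp i)).
have cff (T : topologicalType) (g : T -> V) : continuous g -> continuous (fun x => f (g x)).
  by move=> cg; exact: (cf_comp cg cf).
have dF i : dv (fun t => F i (x + t *: ei i)) 0 (F' i x).
  rewrite -[x in F' i x]addr0 -[X in F' i (x + X)](scale0r (ei i)).
  apply: (NI_derive (u := fun t r => SI (fun eta => f (x + t *: ei i + r *: eta) * dot (ei i) eta))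
    (u' := fun t r => SI (fun eta => p i (x + t *: ei i + r *: eta) * dot (ei i) eta))).
  - lra.
  - move=> r t; apply: (SI_derive n0 (u := fun t eta => f (x + t *: ei i + r *: eta) * dot (ei i) eta)
      (u' := fun t eta => p i (x + t *: ei i + r *: eta) * dot (ei i) eta)).
    + move=> eta s; apply: dv_eq (dvM _ (dvC _ s)) _; last by rewrite mulr0 addr0.
      have := gf (x + r *: eta) (ei i) s.
      have -> : \sum_j (ei i) ord0 j * p j (x + r *: eta + s *: ei i) = p i (x + s *: ei i + r *: eta).
        rewrite (bigD1 i) //= big1 ?addr0; last first.
          by move=> j ji; rewrite mxE eqxx /= (negPf ji) mul0r.
        by rewrite mxE !eqxx mul1r addrAC.
      by under eq_fun do rewrite addrAC.
    + by move=> s; apply: cfM; [apply: cff|]; cts.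
    + by apply: cfM; [apply: cpp|]; cts.
  - move=> t; apply: (SI_continuous n0 (u := fun (r : R) eta => f (x + t *: ei i + r *: eta) * dot (ei i) eta)).
    by apply: cfM; [apply: cff|]; cts.
  - apply: (SI_continuous n0 (u := fun (z : R * R) eta => p i (x + z.1 *: ei i + z.2 *: eta) * dot (ei i) eta)).
    by apply: cfM; [apply: cpp|]; cts.
have E i : 2 * dot x (ei i) * bpf A (fun th => dot (ei i) th) N.+1 x -
     2 * bpf A (fun th => dot (ei i) th * dot (ei i) th) N.+1 x = - rconst * F' i x.
  have D1 := dv_bpf sA N x (ei i) 0 (cd i); rewrite scale0r addr0 in D1.
  apply: (dv_uniq D1); apply: (dv_near _ (dvZ (- rconst) (dF i))).
  have d0 : 0 < 1 - enorm x by rewrite subr_gt0.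
  apply: (near_dist d0) => t; rewrite subr0 => h; apply: mean_bpf_dot; first exact: sphere_delta.
  apply: le_lt_trans (enormD _ _) _; rewrite enormZ sphere_delta; lra.
under eq_bigr do rewrite E.
rewrite -mulr_sumr /F' -NI_sum; last first.
  move=> i; apply: (SI_continuous n0 (u := fun (r : R) eta => p i (x + r *: eta) * dot (ei i) eta)).
  by apply: cfM; [apply: cpp|]; cts.
(* The sum over i is the r-derivative of the mean of f (x + r eta), a function equal to f x at r = 0
   and to 0 at r = 3. *)
rewrite (@NI_FTC _ _ (fun r => SI (fun eta => f (x + r *: eta)))).
- rewrite (_ : SI (fun eta => f (x + 3 *: eta)) = 0).
    rewrite (_ : SI (fun eta => f (x + 0 *: eta)) = f x); first by ring.
    by rewrite -[RHS](SI_cst n0); apply: SI_ext => eta _; rewrite scale0r addr0.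
  rewrite -[RHS](SI_cst n0); apply: SI_ext => eta Seta; apply: f0.
  have := enormD (x + 3 *: eta) (- x); rewrite addrAC subrr add0r enormN enormZ Seta.
  by rewrite ger0_norm //; have /andP[? ?] := dl1; lra.
- apply: cf_sum => i; apply: (SI_continuous n0 (u := fun (r : R) eta => p i (x + r *: eta) * dot (ei i) eta)).
  by apply: cfM; [apply: cpp|]; cts.
move=> r; apply: dv_eq.
  apply: (SI_derive n0 (u := fun r eta => f (x + r *: eta))
    (u' := fun r eta => \sum_i eta ord0 i * p i (x + r *: eta))).
  - by move=> eta s; exact: gf.
  - by move=> s; apply: cff; cts.
  - by apply: cf_sum => i; apply: cfM; [cts|apply: cpp; cts].
rewrite -SI_sum //; last by move=> i; apply: cfM; [apply: cpp|]; cts.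
apply: SI_ext => eta _; apply: eq_bigr => i _.
by rewrite (dotC (ei i)) dot_delta mulrC.
Qed.

End range_condition.

(** * Smoothness *)

Section cylinder_functions.
Context {R : realType} (m : nat).
Local Notation n := (2 * m + 3)%N.
Local Notation V := 'rV[R]_n.

(* Radial extension of a function on the cylinder; the cut-off makes it continuous at the origin. *)
Definition sphere_ext (u : V -> R -> R) (x : V) (t : R) : R :=
  Num.max 0 (2 * enorm x - 1) * u (normalize x) t.

Lemma sphere_normalize_id th : esphere R n th -> normalize th = th.
Proof. by move=> Sth; rewrite /normalize Sth invr1 scale1r. Qed.

Lemma sphere_extE u th t : esphere R n th -> sphere_ext u th t = u th t.
Proof.
move=> Sth; rewrite /sphere_ext sphere_normalize_id // Sth.
by rewrite (max_idPr _) ?mulr1; [ring|lra].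
Qed.

Lemma sphere_ext_small u x t : enorm x <= 2^-1 -> sphere_ext u x t = 0.
Proof. by move=> h; rewrite /sphere_ext (max_idPl _) ?mul0r //; lra. Qed.

Lemma sphere_ext_eq u v : (forall th, esphere R n th -> u th = v th) ->
  sphere_ext u = sphere_ext v.
Proof.
move=> uv; apply/funext => x; apply/funext => t.
have [->|x0] := eqVneq x 0; first by rewrite !sphere_ext_small // enorm0 invr_ge0.
by rewrite /sphere_ext uv //; exact: sphere_normalize.
Qed.

Lemma normalize_continuous (x : V) : x != 0 -> {for x, continuous (@normalize R n)}.
Proof.
move=> x0; have cz := @cf_enorm _ _ _ _ (@cf_id V) x.
have e0 : enorm x != 0 by rewrite enorm_eq0.
exact: (cvgZ (cvgV e0 cz) cvg_id).
Qed.

Lemma cylinder_normalize_continuous (z : V * R) : z.1 != 0 ->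
  {for z, continuous (fun y : V * R => (normalize y.1, y.2))}.
Proof.
move=> z0; have c1 : {for z, continuous (fun y : V * R => normalize y.1)}.
  by apply: continuous_comp; [exact: cvg_fst|exact: normalize_continuous].
have c2 : {for z, continuous (fun y : V * R => y.2)} by exact: cvg_snd.
exact: (cvg_pair c1 c2).
Qed.

Lemma sphere_ext_continuous u :
  (forall z : V * R, z.1 != 0 -> {for z, continuous (fun z : V * R => u (normalize z.1) z.2)}) ->
  continuous (fun z : V * R => sphere_ext u z.1 z.2).
Proof.
move=> cu z; have cz : continuous (fun z : V * R => enorm z.1) by cts.
have [z0|z0] := ltP (enorm z.1) 2^-1.
  have E : \forall y \near z, (fun z : V * R => sphere_ext u z.1 z.2) y = 0.
    have : \forall y \near z, enorm y.1 < 2^-1.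
      by have := cz z => /cvgr_lt; apply.
    by apply: filterS => y /ltW; exact: sphere_ext_small.
  apply: (cvg_trans (near_eq_cvg _) (cvg_cst _)).
  by rewrite sphere_ext_small ?ltW //; apply: filterS E => y ->.
apply: cvgM; first by apply: (@cf_max0 _ _ (fun z : V * R => 2 * enorm z.1 - 1)); cts.
by apply: cu; rewrite -enorm_eq0 gt_eqF //; lra.
Qed.

Context (a : R).
Hypothesis a01 : 0 < a < 1.

Definition cyl0 (u : V -> R -> R) : Prop :=
  continuous (fun z : V * R => sphere_ext u z.1 z.2) /\
  forall th t, esphere R n th -> t < a \/ 2 - a < t -> u th t = 0.

(** C^k in t, with every derivative jointly continuous; passing through [sphere_ext] makes only the
    values over the sphere count. *)
Fixpoint cyl (k : nat) (u : V -> R -> R) : Prop :=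
  cyl0 u /\
  if k is k'.+1 then
    exists2 u', (forall th t, esphere R n th -> dv (u th) t (u' th t)) & cyl k' u'
  else True.

Lemma cyl_cyl0 k u : cyl k u -> cyl0 u.
Proof. by case: k => [|k] []. Qed.

Lemma cylW k u : cyl k.+1 u -> cyl k u.
Proof.
elim: k u => [|k IH] u [c [u' du cu']]; split => //.
by exists u' => //; exact: IH.
Qed.

Lemma cyl_ext k u v : (forall th, esphere R n th -> u th = v th) -> cyl k u -> cyl k v.
Proof.
move=> uv; have h : cyl0 u -> cyl0 v.
  move=> [cu su]; split; first by rewrite -(sphere_ext_eq uv).
  by move=> th t Sth ht; rewrite -uv // su.
case: k => [|k] [c]; first by split => //; exact: h.
move=> [u' du cu']; split; first exact: h.
by exists u' => // th t Sth; rewrite -uv //; exact: du.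
Qed.

Lemma cyl_cst0 k : cyl k (fun _ _ => 0).
Proof.
have h : cyl0 (fun _ _ => 0).
  split=> //; rewrite (_ : (fun z => _) = fun=> 0); first exact: cst_continuous.
  by apply/funext => z; rewrite /sphere_ext mulr0.
elim: k => [|k IH]; split => //.
by exists (fun _ _ => 0) => // th t _; exact: dvC.
Qed.

Lemma cylD k u v : cyl k u -> cyl k v -> cyl k (fun th t => u th t + v th t).
Proof.
have h f g : cyl0 f -> cyl0 g -> cyl0 (fun th t => f th t + g th t).
  move=> [cf sf] [cg sg]; split; last by move=> th t Sth ht; rewrite sf // sg // addr0.
  rewrite (_ : (fun z => _) = fun z : V * R => sphere_ext f z.1 z.2 + sphere_ext g z.1 z.2).
    exact: cfD.
  by apply/funext => z; rewrite /sphere_ext mulrDr.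
elim: k u v => [|k IH] u v [cu]; first by move=> _ [cv _]; split => //; exact: h.
move=> [u' du cu'] [cv [v' dv' cv']]; split; first exact: h.
exists (fun th t => u' th t + v' th t); last exact: IH.
by move=> th t Sth; apply: dvD; [exact: du|exact: dv'].
Qed.

Lemma cylZ k c u : cyl k u -> cyl k (fun th t => c * u th t).
Proof.
have h f : cyl0 f -> cyl0 (fun th t => c * f th t).
  move=> [cf sf]; split; last by move=> th t Sth ht; rewrite sf // mulr0.
  rewrite (_ : (fun z => _) = fun z : V * R => c * sphere_ext f z.1 z.2).
    by apply: cfM => //; exact: cst_continuous.
  by apply/funext => z; rewrite /sphere_ext mulrCA.
elim: k u => [|k IH] u [cu]; first by split => //; exact: h.
move=> [u' du cu']; split; first exact: h.
exists (fun th t => c * u' th t); last exact: IH.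
by move=> th t Sth; apply: dvZ; exact: du.
Qed.

Lemma cyl_sum k (I : Type) (r : seq I) (u : I -> V -> R -> R) : (forall i, cyl k (u i)) ->
  cyl k (fun th t => \sum_(i <- r) u i th t).
Proof.
move=> cu; elim: r => [|i r IH].
  apply: cyl_ext (cyl_cst0 k) => th _; apply/funext => t; by rewrite big_nil.
apply: cyl_ext (cylD (cu i) IH) => th _; apply/funext => t; by rewrite big_cons.
Qed.

Lemma cyl_mulr k u : cyl k u -> cyl k (fun th t => t * u th t).
Proof.
have h f : cyl0 f -> cyl0 (fun th t => t * f th t).
  move=> [cf sf]; split; last by move=> th t Sth ht; rewrite sf // mulr0.
  rewrite (_ : (fun z => _) = fun z : V * R => z.2 * sphere_ext f z.1 z.2).
    by apply: cfM => //; cts.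
  by apply/funext => z; rewrite /sphere_ext mulrCA.
elim: k u => [|k IH] u cu; first by split => //; apply: h; exact: cyl_cyl0 cu.
split; first by apply: h; exact: cyl_cyl0 cu.
have cu0 := cylW cu; have [_ [u' du cu']] := cu.
exists (fun th t => u th t + t * u' th t); last by apply: cylD => //; exact: IH.
move=> th t Sth; apply: dv_eq (dvM (dvId t) (du th t Sth)) _; by rewrite mul1r.
Qed.

Lemma cyl_exp k N u : cyl k u -> cyl k (fun th t => t ^+ N * u th t).
Proof.
elim: N => [|N IH] cu; first by apply: cyl_ext cu => th _; apply/funext => t; rewrite mul1r.
by apply: cyl_ext (cyl_mulr (IH cu)) => th _; apply/funext => t; rewrite exprS mulrA.
Qed.

Lemma dvV (f : R -> R) x l : dv f x l -> f x != 0 -> dv (fun x => (f x)^-1) x (- (f x) ^- 2 * l).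
Proof. by move=> df f0; exact: is_deriveV. Qed.

Lemma cyl_divr k u : cyl k u -> cyl k (fun th t => t^-1 * u th t).
Proof.
have /andP[a0 a1] := a01.
have h f : cyl0 f -> cyl0 (fun th t => t^-1 * f th t).
  move=> [cf sf]; split; last by move=> th t Sth ht; rewrite sf // mulr0.
  (* 1/t is replaced by 1 / (a + max(0, t - a)), continuous for all t: the two agree for t >= a, and
     [f] is 0 below a. *)
  rewrite (_ : (fun z => _) =
      fun z : V * R => (a + Num.max 0 (z.2 - a))^-1 * sphere_ext f z.1 z.2).
    apply: cfM => //; apply: cfV => [|z].
      by apply: cfD; [cts|apply: cf_max0; cts].
    by rewrite gt_eqF // ltr_pwDl // le_max lexx.
  apply/funext => -[x t] /=.
  have [->|x0] := eqVneq x 0; first by rewrite !sphere_ext_small ?mulr0 // enorm0 invr_ge0.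
  rewrite /sphere_ext mulrCA; have [ta|ta] := ltP t a.
    by rewrite sf ?mulr0 //; [exact: sphere_normalize|left].
  have -> : Num.max 0 (t - a) = t - a by apply/max_idPr; rewrite subr_ge0.
  by rewrite (addrC a) subrK mulrCA.
elim: k u => [|k IH] u cu; first by split => //; apply: h; exact: cyl_cyl0 cu.
split; first by apply: h; exact: cyl_cyl0 cu.
have cu0 := cylW cu; have [[_ su] [u' du cu']] := cu; have [_ su'] := cyl_cyl0 cu'.
exists (fun th t => t^-1 * u' th t + -1 * (t^-1 * (t^-1 * u th t))); last first.
  by apply: cylD; [exact: IH|apply: cylZ; apply: (IH (fun th t => t^-1 * u th t)); exact: IH].
move=> th t Sth; have [ta|ta] := ltP t a.
  rewrite su ?su' //; try by left.
  rewrite !mulr0 addr0; apply: (dv_near _ (dvC 0 t)).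
  have d0 : 0 < a - t by rewrite subr_gt0.
  apply: (near_dist d0) => y hy; rewrite su ?mulr0 //; left.
  by have := ler_norm (y - t); lra.
have t0 : t != 0 by rewrite gt_eqF // (lt_le_trans a0).
apply: dv_eq (dvM (dvV (dvId t) t0) (du th t Sth)) _.
by rewrite expr2 invfM; ring.
Qed.

Lemma cyl_Dt u : (forall k, cyl k u) -> forall k, cyl k (fun th => Dt (u th)).
Proof.
move=> cu k; have [_ [u' du cu']] := cu k.+1.
apply: cyl_ext (cyl_divr cu') => th Sth; apply/funext => t.
by rewrite /Dt derive1E; congr (_ * _); apply/esym; apply: derive_val; exact: (du th t Sth).
Qed.

Lemma cyl_iter_Dt u j : (forall k, cyl k u) -> forall k, cyl k (fun th => iter j (@Dt R) (u th)).
Proof. by move=> cu; elim: j => [|j IH] //=; exact: cyl_Dt. Qed.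

(** For s = t^2 one has d/ds = (1/2) t^-1 d/dt, whence the factor 2^-j. *)
Definition cyl_fam (u : V -> R -> R) (j : nat) (x : V) (s : R) : R :=
  2 ^- j * sphere_ext (fun th => iter j (@Dt R) (u th)) x (Num.sqrt s).

Lemma cyl_famE u j th t : esphere R n th -> 0 <= t ->
  cyl_fam u j th (t ^+ 2) = 2 ^- j * iter j (@Dt R) (u th) t.
Proof. by move=> Sth t0; rewrite /cyl_fam sqrtr_sqr ger0_norm // sphere_extE. Qed.

Lemma cyl_fam_sfam u : (forall k, cyl k u) -> sfam (a ^+ 2 / 2) (cyl_fam u).
Proof.
move=> cu; have /andP[a0 a1] := a01; have a2 : 0 < a ^+ 2 by rewrite exprn_gt0.
have cj j := cyl_iter_Dt j cu 1.
have out j x s : s < a ^+ 2 \/ (2 - a) ^+ 2 < s -> cyl_fam u j x s = 0.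
  move=> hs; have [_ su] := cyl_cyl0 (cj j); rewrite /cyl_fam.
  have [->|x0] := eqVneq x 0; first by rewrite sphere_ext_small ?mulr0 // enorm0 invr_ge0.
  rewrite /sphere_ext su ?mulr0 //; first exact: sphere_normalize.
  case: hs => hs; [left|right].
    by rewrite -[ltRHS]ger0_norm ?ltW // -sqrtr_sqr ltr_sqrt.
  have h : 0 <= 2 - a by lra.
  rewrite -[ltLHS]ger0_norm // -sqrtr_sqr ltr_sqrt //.
  by apply: lt_trans hs; rewrite exprn_gt0 //; lra.
split.
- move=> j; have [cu0 _] := cyl_cyl0 (cj j).
  apply: cfM; first by cts.
  by apply: (cf2 cu0); [cts|apply: cf_sqrt; cts].
- move=> j x s; have [sa|sa] := ltP s (a ^+ 2).
    rewrite out; last by left.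
    have d0 : 0 < a ^+ 2 - s by rewrite subr_gt0.
    apply: (dv_near _ (dvC 0 s)); apply: (near_dist d0) => y hy; apply: out; left.
    by have := ler_norm (y - s); lra.
  have s0 : 0 < s by exact: lt_le_trans sa.
  have [->|x0] := eqVneq x 0.
    have E k : cyl_fam u k 0 = fun=> 0.
      by apply/funext => y; rewrite /cyl_fam sphere_ext_small ?mulr0 // enorm0 invr_ge0.
    by rewrite !E; exact: dvC.
  have Sx := sphere_normalize x0.
  have [_ [h' dh _]] := cj j.
  have D := dh _ (Num.sqrt s) Sx.
  apply: dv_eq (dvZ _ (dvZ _ (dv_comp _ D))) _; first exact: is_derive1_sqrt.
  rewrite /cyl_fam /sphere_ext /= /Dt derive1E.
  have -> : 'D_1 (iter j (@Dt R) (u (normalize x))) (Num.sqrt s) = h' (normalize x) (Num.sqrt s).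
    by apply: derive_val; exact: D.
  by rewrite exprS !invfM; ring.
(* Halving in e = a^2 / 2 makes both margins strict: a^2 / 2 < a^2 and (2 - a)^2 < 4 - a^2 / 2. *)
- move=> j x s hs; apply: out; rewrite !expr2 in hs *; case: hs => hs; [left|right]; nra.
Qed.

End cylinder_functions.


(** * From the definition of smoothness to regularity in t *)

Section smooth.
Context {R : realType} {V : normedModType R}.

Lemma Ck_openS k (U U' : set V) (f : V -> R) : U' `<=` U -> Ck_open k U f -> Ck_open k U' f.
Proof.
move=> UU; elim: k f => [|k IH] f /=; first by move=> h x /UU; exact: h.
by move=> [h1 h2]; split => [x /UU|v]; [exact: h1|apply: IH; exact: h2].
Qed.

Lemma smooth_openS (U U' : set V) (f : V -> R) :
  U' `<=` U -> smooth_open U f -> smooth_open U' f.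
Proof. by move=> UU h k; exact: Ck_openS (h k). Qed.

Lemma smooth_open_cst (U : set V) (c : R) : smooth_open U (fun=> c).
Proof.
move=> k; elim: k c => [|k IH] c /=; first by move=> x _; exact: cst_continuous.
split=> [x _|v]; first exact: differentiable_cst.
rewrite (_ : (fun x => 'D_v _ x) = fun=> 0); first exact: IH.
by apply/funext => x; exact: derive_cst.
Qed.

Lemma smooth_open_differentiable (U : set V) (f : V -> R) x :
  smooth_open U f -> U x -> differentiable f x.
Proof. by move=> /(_ 1%N)[h _]; exact: h. Qed.

Lemma smooth_open_derive (U : set V) (f : V -> R) v :
  smooth_open U f -> smooth_open U (fun x => 'D_v f x).
Proof. by move=> h k; have [_] := h k.+1; apply. Qed.

Lemma smooth_open_continuous (U : set V) (f : V -> R) x :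
  smooth_open U f -> U x -> {for x, continuous f}.
Proof. by move=> /(_ 0%N); apply. Qed.

Lemma dv_line (f : V -> R) (x v : V) t : differentiable f (x + t *: v) ->
  dv (fun s => f (x + s *: v)) t ('D_v f (x + t *: v)).
Proof.
move=> df; have dr : derivable f (x + t *: v) v by exact: diff_derivable.
have E : (fun h : R => h^-1 *: (((fun s => f (x + s *: v)) \o shift t) (h *: 1) - f (x + t *: v))) =
    (fun h : R => h^-1 *: ((f \o shift (x + t *: v)) (h *: v) - f (x + t *: v))).
  apply/funext => h /=; congr (_ *: (f _ - _)).
  by rewrite scalerDl /GRing.scale /= mulr1 addrCA addrA.
by split; [rewrite /derivable E|rewrite /derive E].
Qed.

End smooth.

Section cylinder_smooth.
Context {R : realType} (m : nat).
Local Notation n := (2 * m + 3)%N.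
Local Notation V := 'rV[R]_n.
Local Notation W := (V * R)%type.

Definition cyl_smooth (u : V -> R -> R) : Prop :=
  smooth_on (esphere R n `*` setT) (fun z : W => u z.1 z.2).

Lemma near_fiber (U : set W) th t : open U -> U (th, t) -> \forall s \near t, U (th, s).
Proof.
move=> oU Ut; have : nbhs (th, t) U by exact: open_nbhs_nbhs.
have c : continuous (fun s : R => (th, s) : W) by apply: cf_pair; cts.
exact: (c t).
Qed.

Lemma cyl_smooth_derive u : cyl_smooth u ->
  cyl_smooth (fun th t => derive1 (u th) t) /\
  forall th t, esphere R n th -> dv (u th) t (derive1 (u th) t).
Proof.
move=> su.
have H (U : set W) (h : W -> R) : open U -> smooth_open U h ->
    (forall y : W, (esphere R n `*` setT) y -> U y -> u y.1 y.2 = h y) ->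
    forall th t, esphere R n th -> U (th, t) -> dv (u th) t ('D_(0, 1) h (th, t)).
  move=> oU sh uh th t Sth Ut.
  have E s : (th, s) = (th, 0) + s *: ((0, 1) : W).
    by apply: injective_projections; rewrite /= ?scaler0 ?addr0 // add0r /GRing.scale /= mulr1.
  have D : dv (fun s => h (th, s)) t ('D_(0, 1) h (th, t)).
    have := @dv_line _ _ h (th, 0) (0, 1) t; rewrite -E => /(_ (smooth_open_differentiable sh Ut)).
    by under eq_fun do rewrite -E.
  apply: (dv_near _ D); have := near_fiber oU Ut; apply: filterS => s Us.
  exact: (uh (th, s)).
have dE f t l : dv f t l -> derive1 f t = l :> R.
  by move=> D; rewrite derive1E; apply: derive_val; exact: D.
split.
  move=> z Sz; have [U [h [oU Uz sh uh]]] := su z Sz.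
  exists U, (fun x => 'D_(0, 1) h x); split => //; first exact: smooth_open_derive.
  by move=> [th t] [Sth _] Ut; apply: dE; exact: (H U).
move=> th t Sth; have [U [h [oU Uz sh uh]]] := su (th, t) (conj Sth I).
have D := H U h oU sh uh th t Sth Uz.
by rewrite (dE _ _ _ D).
Qed.

Lemma cyl_smooth_continuous u : cyl_smooth u ->
  continuous (fun z : W => sphere_ext u z.1 z.2).
Proof.
move=> su; apply: sphere_ext_continuous => z z0.
pose nz (z : W) : W := (normalize z.1, z.2).
have cn : {for z, continuous nz} := cylinder_normalize_continuous z0.
have Sn (y : W) : y.1 != 0 -> (esphere R n `*` setT) (nz y).
  by move=> y0; split => //; exact: sphere_normalize.
have [U [h [oU Uz sh uh]]] := su (nz z) (Sn z z0).
have ch : {for z, continuous (h \o nz)}.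
  by apply: continuous_comp => //; exact: (smooth_open_continuous sh Uz).
have N1 : \forall y \near z, U (nz y) by apply: cn; exact: open_nbhs_nbhs.
have N2 : \forall y \near z, y.1 != 0.
  have cz : continuous (fun y : W => enorm y.1) by cts.
  have e0 : 0 < enorm z.1 by rewrite lt_def enorm_eq0 z0 enorm_ge0.
  have : \forall y \near z, 0 < enorm y.1 by have := cz z => /cvgr_gt; apply.
  by apply: filterS => y; rewrite lt_def enorm_eq0 => /andP[].
have E : \forall y \near z, (h \o nz) y = u (normalize y.1) y.2.
  by apply: filterS2 N1 N2 => y Uy y0; rewrite /= -uh //; exact: Sn.
apply: (cvg_trans (near_eq_cvg E)).
have <- : h (nz z) = u (normalize z.1) z.2 by rewrite -uh //; exact: Sn.
exact: ch.
Qed.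

Lemma cyl_smooth_cyl a k u : cyl_smooth u ->
  (forall th t, esphere R n th -> t < a \/ 2 - a < t -> u th t = 0) -> cyl a k u.
Proof.
elim: k u => [|k IH] u su s0.
  by split=> //; split => //; exact: cyl_smooth_continuous.
have [su' du] := cyl_smooth_derive su.
split; first by split => //; exact: cyl_smooth_continuous.
exists (fun th t => derive1 (u th) t) => //; apply: IH => // th t Sth ht.
apply: (dv_uniq (du th t Sth)); case: ht => ht.
- apply: (dv_near _ (dvC 0 t)); near=> s; apply: s0 => //; left.
  by near: s; exact: lt_nbhsl.
- apply: (dv_near _ (dvC 0 t)); near=> s; apply: s0 => //; right.
  by near: s; exact: lt_nbhsr.
Unshelve. all: by end_near. Qed.

(** Compactness of the support confines t to [a, 2 - a], so extension by 0 in t is smooth on the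
    sphere times R, and [cyl_smooth_cyl] applies. *)
Lemma Cc_smooth_cyl (g : W -> R) : Cc_smooth (cylinder R n) g ->
  exists a (u : V -> R -> R), [/\ 0 < a < 1, forall k, cyl a k u &
    forall th t, cylinder R n (th, t) -> u th t = g (th, t)].
Proof.
move=> [sg [K [cK Kc gK]]].
have [a a01 hK] : exists2 a : R, 0 < a < 1 & forall z : W, K z -> a <= z.2 <= 2 - a.
  have [K0|K0] := pselect (K !=set0); last first.
    by exists 2^-1; [lra|move=> z Kz; case: K0; exists z].
  (* The distance from t to the ends of (0, 2); its minimum over [K] is positive. *)
  pose f (z : W) : R := 1 - `|z.2 - 1|.
  have cf : continuous f by apply: cfB; [cts|apply: cf_norm; cts].
  have [c cK' fc] := compact_EVT_min K0 cK (continuous_subspaceT cf).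
  have f0 : 0 < f c.
    have [_] := Kc _ (set_mem cK'); rewrite /= in_itv /= => /andP[h1 h2].
    by rewrite subr_gt0 ltr_norml; lra.
  exists (Num.min (f c) 1 / 2).
    have : 0 < Num.min (f c) 1 <= 1 by rewrite lt_min f0 ltr01 ge_min lexx orbT.
    by move: (Num.min _ _) => x; lra.
  move=> z Kz; have := fc z (mem_set Kz); have : Num.min (f c) 1 <= f c by rewrite ge_min lexx.
  have : 0 < Num.min (f c) 1 by rewrite lt_min f0 ltr01.
  move: (Num.min _ _) => x x0 xf h; have : `|z.2 - 1| <= 1 - x by have h' : f c <= 1 - `|z.2 - 1| := h; lra.
  by rewrite ler_norml => /andP[? ?]; apply/andP; split; lra.
have /andP[a0 a1] := a01.
pose u (th : V) (t : R) : R := if 0 < t < 2 then g (th, t) else 0.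
have u0 th t : esphere R n th -> t < a \/ 2 - a < t -> u th t = 0.
  move=> Sth ht; rewrite /u; case: ifP => // t02; apply: gK.
    by split => //=; rewrite in_itv.
  by move=> /hK /= /andP[h1 h2]; lra.
exists a, u; split => //; last first.
  by move=> th t [_]; rewrite /= in_itv /= /u => ->.
move=> k; apply: cyl_smooth_cyl => // -[th t] [Sth _].
have [ht|ht] := pselect (t < a \/ 2 - a < t).
  exists [set z : W | z.2 < a \/ 2 - a < z.2], (fun=> 0); split => //.
  - rewrite (_ : [set _ | _] = snd @^-1` ([set x | x < a] `|` [set x | 2 - a < x])) //.
    by apply: open_comp; [move=> z _; exact: cvg_snd|apply: openU; [exact: open_lt|exact: open_gt]].
  - exact: smooth_open_cst.
  - by move=> [th' t'] [Sth' _] /=; exact: u0.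
have t02 : cylinder R n (th, t).
  split => //=; rewrite in_itv /=; apply/andP; split.
    by rewrite ltNge; apply/negP => h; apply: ht; left; lra.
  by rewrite ltNge; apply/negP => h; apply: ht; right; lra.
have [U [h [oU Uz sh gh]]] := sg _ t02.
exists (U `&` (snd @^-1` [set x : R | 0 < x < 2])), h; split => //.
- apply: openI => //; apply: open_comp; first by move=> z _; exact: cvg_snd.
  rewrite (_ : [set x | _] = [set x : R | 0 < x] `&` [set x | x < 2]).
    by apply: openI; [exact: open_gt|exact: open_lt].
  by apply/seteqP; split => x /=; [move/andP|move=> [-> ->]].
- by split => //; case: t02 => _; rewrite /= in_itv.
- by apply: smooth_openS sh; move=> z [].
- move=> [th' t'] [Sth' _] [Uz' /= t2]; rewrite /u t2; exact: gh.
Qed.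

End cylinder_smooth.


(** * Spherical means of smooth functions *)

Section mean_of_smooth.
Context {R : realType} (m : nat).
Local Notation n := (2 * m + 3)%N.
Local Notation N := (2 * m + 1)%N.
Local Notation V := 'rV[R]_n.

Let n0 : (0 < n)%N. Proof. by rewrite addnS. Qed.

Local Notation one := (fun _ : V => 1 : R).
Let ei (i : 'I_n) : V := delta_mx ord0 i.

Definition entire (h : V -> R) : Prop := smooth_on setT h.

Lemma entire_local h x : entire h -> exists U k, [/\ open U, U x, smooth_open U k &
  forall y, U y -> h y = k y].
Proof.
by move=> /(_ x I)[U [k [oU Ux sk hk]]]; exists U, k; split => // y Uy; exact: hk.
Qed.

Lemma entire_continuous h : entire h -> continuous h.
Proof.
move=> eh x; have [U [k [oU Ux sk hk]]] := entire_local x eh.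
have E : \forall y \near x, k y = h y.
  by apply: filterS (open_nbhs_nbhs (conj oU Ux)) => y /hk.
apply: (cvg_trans (near_eq_cvg E)); rewrite (hk x Ux); exact: (smooth_open_continuous sk Ux).
Qed.

Lemma entire_line h x v t : entire h -> dv (fun s => h (x + s *: v)) t ('D_v h (x + t *: v)).
Proof.
move=> eh; have [U [k [oU Ux sk hk]]] := entire_local (x + t *: v) eh.
have D := dv_line (smooth_open_differentiable sk Ux).
have DE : 'D_v h (x + t *: v) = 'D_v k (x + t *: v).
  apply: near_eq_derive; apply: filterS (open_nbhs_nbhs (conj oU Ux)) => y; exact: hk.
rewrite DE; apply: (dv_near _ D).
have c : continuous (fun s : R => x + s *: v) by cts.
have N1 : \forall s \near t, U (x + s *: v) by apply: c; exact: open_nbhs_nbhs.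
by apply: filterS N1 => s; exact: hk.
Qed.

Lemma entire_derive h v : entire h -> entire (fun x => 'D_v h x).
Proof.
move=> eh x _; have [U [k [oU Ux sk hk]]] := entire_local x eh.
exists U, (fun x => 'D_v k x); split => //; first exact: smooth_open_derive.
move=> y _ Uy; apply: near_eq_derive; apply: filterS (open_nbhs_nbhs (conj oU Uy)) => z; exact: hk.
Qed.

Lemma entire_gradient h x v : entire h -> 'D_v h x = \sum_i v ord0 i * 'D_(ei i) h x.
Proof.
move=> eh; have [U [k [oU Ux sk hk]]] := entire_local x eh.
have DE w : 'D_w h x = 'd k x w.
  rewrite -deriveE; last exact: (smooth_open_differentiable sk Ux).
  by apply: near_eq_derive; apply: filterS (open_nbhs_nbhs (conj oU Ux)) => y; exact: hk.
rewrite DE {1}(row_sum_delta v) linear_sum; apply: eq_bigr => i _.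
by rewrite linearZ DE.
Qed.

Lemma entire_gradient_line h y v t : entire h ->
  dv (fun s => h (y + s *: v)) t (\sum_i v ord0 i * 'D_(ei i) h (y + t *: v)).
Proof. by move=> eh; apply: dv_eq (entire_line y v t eh) _; exact: entire_gradient. Qed.

Lemma derive_out (h : V -> R) (d : R) (v y : V) : (forall y, d < enorm y -> h y = 0) -> d < enorm y ->
  'D_v h y = 0.
Proof.
move=> h0 dy; rewrite -(derive_cst (0 : R) y v); apply: near_eq_derive.
have cz : continuous (fun y : V => enorm y) by cts.
have : \forall z \near y, d < enorm z by have := cz y => /cvgr_gt; apply.
by apply: filterS => z; exact: h0.
Qed.

Context (a : R).
Hypothesis a01 : 0 < a < 1.

(* The truncation discards the mirror image at negative [t]; it is harmless
   because [h] vanishes near the sphere. *)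
Definition wmean (p h : V -> R) (th : V) (t : R) : R :=
  SI (fun w => p w * h (th + Num.max 0 t *: w)).

Lemma wmean_out p h th t : (forall y, 1 - a < enorm y -> h y = 0) -> esphere R n th ->
  t < a \/ 2 - a < t -> wmean p h th t = 0.
Proof.
move=> h0 Sth ht; have /andP[a0 a1] := a01.
rewrite -[RHS](SI_cst n0); apply: SI_ext => w Sw; rewrite h0 ?mulr0 //.
set r := Num.max 0 t; have r0 : 0 <= r by rewrite le_max lexx.
have E : enorm (r *: w) = r by rewrite enormZ Sw mulr1 ger0_norm.
case: ht => ht.
  have ra : r < a by rewrite /r gt_max a0 ht.
  have := enormD (th + r *: w) (- (r *: w)); rewrite addrK enormN E Sth; lra.
have ra : 2 - a < r by rewrite /r lt_max ht orbT.
have := enormD (th + r *: w) (- th); rewrite addrAC subrr add0r enormN E Sth; lra.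
Qed.

(** The weight [p] is there for the induction: a t-derivative replaces h by its partial derivatives
    and multiplies the weight by w_i. *)
Lemma wmean_cyl k p h : continuous p -> entire h -> (forall y, 1 - a < enorm y -> h y = 0) ->
  cyl a k (wmean p h).
Proof.
have /andP[a0 a1] := a01.
have C p' h' : continuous p' -> entire h' -> (forall y, 1 - a < enorm y -> h' y = 0) ->
    cyl0 a (wmean p' h').
  move=> cp eh h0; split; last by move=> th t; exact: wmean_out.
  apply: sphere_ext_continuous => z z0.
  have cw : continuous (fun z : V * R => wmean p' h' z.1 z.2).
    apply: (SI_continuous n0 (u := fun (z : V * R) w => p' w * h' (z.1 + Num.max 0 z.2 *: w))).
    apply: cfM; first by apply: (cf_q cp); cts.
    apply: (cf_comp _ (entire_continuous eh)); apply: cvD; first by cts.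
    by apply: cvZ; [apply: cf_max0|]; cts.
  exact: (continuous_comp (cylinder_normalize_continuous z0) (cw _)).
elim: k p h => [|k IH] p h cp eh h0; first by split => //; exact: C.
split; first exact: C.
pose u' i := wmean (fun w => p w * w ord0 i) (fun y => 'D_(ei i) h y).
have D0 i y : 1 - a < enorm y -> 'D_(ei i) h y = 0 by exact: derive_out.
exists (fun th t => \sum_i u' i th t); last first.
  apply: cyl_sum => i; apply: IH; [by cts|exact: entire_derive|exact: D0].
move=> th t Sth; have [ta|ta] := ltP t a.
  rewrite big1; last by move=> i _; apply: wmean_out => //; [exact: D0|left].
  apply: (dv_near _ (dvC 0 t)); near=> s; apply: wmean_out => //; left.
  by near: s; exact: lt_nbhsl.
have t0 : 0 < t by exact: lt_le_trans ta.
have ch := entire_continuous eh.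
have cD i : continuous (fun y => 'D_(ei i) h y) by apply: entire_continuous; exact: entire_derive.
have D : dv (fun s => SI (fun w => p w * h (th + s *: w))) t
    (SI (fun w => p w * \sum_i w ord0 i * 'D_(ei i) h (th + t *: w))).
  apply: (SI_derive n0 (u := fun s w => p w * h (th + s *: w))
    (u' := fun s w => p w * \sum_i w ord0 i * 'D_(ei i) h (th + s *: w))).
  - by move=> w s; apply: dvZ; exact: entire_gradient_line.
  - by move=> s; apply: cfM => //; apply: (cf_comp _ ch); cts.
  - apply: cfM; first by apply: (cf_q cp); cts.
    apply: cf_sum => i; apply: cfM; first by cts.
    by apply: (cf_comp _ (@cD i)); cts.
have -> : \sum_i u' i th t = SI (fun w => p w * \sum_i w ord0 i * 'D_(ei i) h (th + t *: w)).
  rewrite /u' /wmean (elimT max_idPr (ltW t0)) -SI_sum //.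
    by apply: SI_ext => w _; rewrite mulr_sumr; apply: eq_bigr => i _; rewrite mulrA.
  move=> i; apply: cfM; first by cts.
  by apply: (cf_comp _ (@cD i)); cts.
apply: (dv_near _ D); near=> s.
have s0 : 0 < s by near: s; exact: lt_nbhsr.
by rewrite /wmean (elimT max_idPr (ltW s0)).
Unshelve. all: by end_near. Qed.

End mean_of_smooth.

Lemma iter_Dt_eq (R : realType) (F G : R -> R) j : (forall s, 0 < s -> F s = G s) ->
  forall s, 0 < s -> iter j (@Dt R) F s = iter j (@Dt R) G s.
Proof.
move=> FG; elim: j => [|j IH] s s0 //=; first exact: FG.
rewrite /Dt !derive1E; congr (_ * _); apply: near_eq_derive; near=> t; apply: IH.
by near: t; exact: lt_nbhsr.
Unshelve. all: by end_near. Qed.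

Section spherical_mean_range.
Context {R : realType} (m : nat).
Local Notation n := (2 * m + 3)%N.
Local Notation N := (2 * m + 1)%N.
Local Notation V := 'rV[R]_n.

Lemma Cc_smooth_ball (f : V -> R) : Cc_smooth (eball R n) f ->
  exists2 d : R, 0 < d < 1 & entire (patch (fun=> 0) (eball R n) f) /\
    forall y, 1 - d < enorm y -> patch (fun=> 0) (eball R n) f y = 0.
Proof.
move=> [sf [K [cK Kb fK]]].
have cz : continuous (fun y : V => enorm y) by cts.
have [d d01 hK] : exists2 d : R, 0 < d < 1 & forall y : V, K y -> enorm y <= 1 - d.
  have [K0|K0] := pselect (K !=set0); last first.
    by exists 2^-1; [lra|move=> z Kz; case: K0; exists z].
  have ck : continuous (fun y : V => 1 - enorm y) by cts.
  have [c cK' fc] := compact_EVT_min K0 cK (continuous_subspaceT ck).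
  have f0 : 0 < 1 - enorm c by have := Kb _ (set_mem cK'); rewrite /eball /= subr_gt0.
  exists (Num.min (1 - enorm c) 1 / 2).
    have : 0 < Num.min (1 - enorm c) 1 <= 1 by rewrite lt_min f0 ltr01 ge_min lexx orbT.
    by move: (Num.min _ _) => x; lra.
  move=> z Kz; have := fc z (mem_set Kz).
  have : Num.min (1 - enorm c) 1 <= 1 - enorm c by rewrite ge_min lexx.
  have : 0 < Num.min (1 - enorm c) 1 by rewrite lt_min f0 ltr01.
  by move: (Num.min _ _) => x x0 xf h; lra.
have f0 y : 1 - d < enorm y -> patch (fun=> 0) (eball R n) f y = 0.
  move=> hy; rewrite patchE; case: ifPn => // /set_mem yb; apply: fK => //.
  by move=> /hK; lra.
exists d => //; split => // x _.
have [x1|x1] := ltP (enorm x) 1.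
  have [U [h [oU Ux sh fh]]] := sf x x1.
  exists (U `&` eball R n), h; split => //.
  - apply: openI => //; rewrite (_ : eball R n = (fun y => enorm y) @^-1` [set t | t < 1]) //.
    by apply: open_comp; [move=> y _; exact: cz|exact: open_lt].
  - by apply: smooth_openS sh; move=> y [].
  - by move=> y _ [Uy yb]; rewrite patchE mem_set //; exact: fh.
exists [set y : V | 1 - d < enorm y], (fun=> 0); split => //.
- rewrite (_ : [set _ | _] = (fun y => enorm y) @^-1` [set t | 1 - d < t]) //.
  by apply: open_comp; [move=> y _; exact: cz|exact: open_gt].
- by move: d01 => /andP[? ?] /=; lra.
- exact: smooth_open_cst.
- by move=> y _ /=; exact: f0.
Qed.

Theorem spherical_mean_family (f : V -> R) : Cc_smooth (eball R n) f ->
  exists e (A : nat -> V -> R -> R), [/\ 0 < e, sfam e A, bzero A (fun=> 1) N,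
    forall x, enorm x < 1 -> 2 * (dot x x - 1) * bpf A (fun=> 1) N.+1 x = rconst m * f x &
    forall th t, cylinder R n (th, t) -> A N th (t ^+ 2) = 2 ^- N *
      iter (n - 2) (@Dt R) (fun s => s ^+ (n - 2) * spherical_mean f th s) t].
Proof.
move=> /Cc_smooth_ball[d d01 [ef f0]]; have /andP[d0 d1] := d01.
pose g := patch (fun=> 0) (eball R n) f; have cg := entire_continuous ef.
pose u (th : V) t := t ^+ N * wmean (fun=> 1) g th t.
have cu k : cyl d k u by apply: cyl_exp; apply: wmean_cyl => //; exact: cst_continuous.
(* Halving d turns vanishing for |y| > 1 - d into vanishing for |y| >= 1 - d/2. *)
have d201 : 0 < d / 2 < 1 by lra.
have f02 y : 1 - d / 2 <= enorm y -> g y = 0 by move=> h; apply: f0; lra.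
have sA := cyl_fam_sfam d01 cu; pose A := cyl_fam u.
have um th t : 0 <= t -> u th t = t ^+ N * SI (fun w => g (th + t *: w)).
  move=> t0; rewrite /u /wmean (elimT max_idPr t0); congr (_ * _).
  by apply: SI_ext => w _; rewrite mul1r.
have A0 th t : esphere R n th -> 0 <= t -> A 0%N th (t ^+ 2) = t ^+ N * SI (fun w => g (th + t *: w)).
  by move=> Sth t0; rewrite /A cyl_famE //= expr0 invr1 mul1r um.
exists (d ^+ 2 / 2), A; split => //.
- by rewrite divr_gt0 // exprn_gt0.
- exact: (mean_bzero sA cg d201 f02 A0).
- move=> x x1; rewrite (mean_bpf sA cg d201 f02 A0 (p := fun i y => 'D_(delta_mx ord0 i) g y)) //.
  + by rewrite /g patchE mem_set.
  + by move=> i; apply: entire_continuous; exact: entire_derive.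
  + by move=> y v t; exact: entire_gradient_line.
- move=> th t [Sth]; rewrite /= in_itv /= => /andP[t0 _].
  have -> : (n - 2 = N)%N by lia.
  rewrite /A cyl_famE //; last exact: ltW.
  by congr (_ * _); apply: iter_Dt_eq => // s s0; rewrite um // ltW.
Qed.

End spherical_mean_range.


(** * Smoothness of backprojections *)

Section gradient.
Context {R : realType} (n : nat).
Local Notation V := 'rV[R]_n.

Let dot_linear (x : V) : linear (dot x : V -> R).
Proof. by move=> a u v; rewrite dotDr dotZr. Qed.

HB.instance Definition _ (x : V) := GRing.isLinear.Build R V R *:%R (dot x : V -> R) (dot_linear x).

Definition gradient (f : V -> R) (p : 'I_n -> V -> R) : Prop :=
  forall y v t, dv (fun s => f (y + s *: v)) t (\sum_i v ord0 i * p i (y + t *: v)).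

Lemma coord_le_norm (v : V) i : `|v ord0 i| <= `|v|.
Proof. by rewrite [leRHS]/Num.norm /= mx_normrE; apply: (le_bigmax _ _ (ord0, i)). Qed.

(** The mean value theorem on the segment from x to x + v gives the increment as a value of the
    gradient nearby; continuity of the [p i] at x makes the error o(|v|). *)
Lemma gradient_differentiable f p x : (forall i, continuous (p i)) -> gradient f p ->
  differentiable f x.
Proof.
move=> cp gf; pose P : V := \row_i p i x; pose df := dot P.
have cdf : continuous df by rewrite /df; cts.
have E : f \o shift x = cst (f x) + df +o_ 0 id.
  apply/eqaddoP => _/posnumP[e].
  pose F y := \sum_i `|p i y - p i x|.
  have cF : continuous F.
    by apply: cf_sum => i; apply: cf_norm; apply: cfB; [exact: (cp i)|exact: cst_continuous].
  have F0 : F x = 0 by rewrite /F big1 // => i _; rewrite subrr normr0.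
  have : \forall y \near x, F y < e%:num by have := cF x => /cvgr_lt; apply; rewrite F0.
  move=> /nbhs_ballP[r /= r0 hr].
  have : \forall v \near (0 : V), `|v| < r.
    by apply/nbhs_ballP; exists r => //= v; rewrite -ball_normE /= sub0r normrN.
  apply: filterS => v vr /=.
  have [c [c1 Ec]] := dv_mvt 0 1 (gf x v).
  rewrite scale0r addr0 scale1r subr0 mulr1 in Ec.
  have -> : (f \o shift x - (cst (f x) + df)) v = \sum_i v ord0 i * (p i (x + c *: v) - p i x).
    rewrite /GRing.add /GRing.opp /= [v + x]addrC opprD addrA Ec /df /dot -sumrB.
    by apply: eq_bigr => i _; rewrite mxE mulrBr (mulrC (p i x)).
  apply: le_trans (ler_norm_sum _ _ _) _.
  apply: (@le_trans _ _ (`|v| * F (x + c *: v))).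
    by rewrite mulr_sumr; apply: ler_sum => i _; rewrite normrM ler_wpM2r // coord_le_norm.
  rewrite mulrC ler_wpM2r //; apply: ltW; apply: hr.
  rewrite -ball_normE /= opprD addrA subrr sub0r normrN normrZ; apply: le_lt_trans vr.
  by rewrite -[leRHS]mul1r ler_wpM2r //; move: c1; rewrite !subr0 normr1.
have dE := diff_unique cdf E.
by apply/diff_locallyP; rewrite dE.
Qed.

Lemma gradient_derive f p x v : (forall i, continuous (p i)) -> gradient f p ->
  'D_v f x = \sum_i v ord0 i * p i x.
Proof.
move=> cp gf; have := @dv_line _ _ f x v 0 (gradient_differentiable _ cp gf).
by have := gf x v 0; rewrite scale0r addr0 => /[swap]; exact: dv_uniq.
Qed.

(** Induction on the order for all members of the class at once, since each directional derivative
    is again a member. *)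
Lemma gradient_smooth (C : (V -> R) -> Prop) (U : set V) :
  (forall f, C f -> continuous f) ->
  (forall f, C f -> exists p, [/\ gradient f p, forall i, continuous (p i) &
     forall v : V, C (fun x => \sum_i v ord0 i * p i x)]) ->
  forall f, C f -> smooth_open U f.
Proof.
move=> cC gC f Cf k; elim: k f Cf => [|k IH] f Cf /=; first by move=> x _; exact: cC.
have [p [gf cp Cp]] := gC f Cf; split => [x _|v]; first exact: gradient_differentiable gf.
by rewrite (_ : (fun x => _) = fun x => \sum_i v ord0 i * p i x); [apply: IH|apply/funext => x; exact: gradient_derive cp gf].
Qed.

End gradient.

Section backprojection_expressions.
Context {R : realType} (m : nat).
Local Notation n := (2 * m + 3)%N.
Local Notation V := 'rV[R]_n.

Let n0 : (0 < n)%N. Proof. by rewrite addnS. Qed.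

Context (e : R) (G : nat -> V -> R -> R).
Hypothesis sG : sfam e G.

(* A class of functions, closed under directional derivatives, that contains the backprojections. *)
Inductive bexp : (V -> R) -> Prop :=
| bexp_bpf q j : continuous q -> bexp (bpf G q j)
| bexp_cst c : bexp (fun=> c)
| bexp_dot w : bexp (fun x => dot w x)
| bexpD f g : bexp f -> bexp g -> bexp (fun x => f x + g x)
| bexpM f g : bexp f -> bexp g -> bexp (fun x => f x * g x).

Lemma bexp_continuous f : bexp f -> continuous f.
Proof.
elim=> [q j cq|c|w|f1 g1 _ c1 _ c2|f1 g1 _ c1 _ c2].
- exact: (cf_bpf sG).
- exact: cst_continuous.
- by cts.
- exact: cfD.
- exact: cfM.
Qed.

Lemma bexp_sum (I : Type) (r : seq I) (F : I -> V -> R) : (forall i, bexp (F i)) ->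
  bexp (fun x => \sum_(i <- r) F i x).
Proof.
move=> bF; elim: r => [|i r IH].
  rewrite (_ : (fun x => _) = fun=> 0); first exact: bexp_cst.
  by apply/funext => x; rewrite big_nil.
rewrite (_ : (fun x => _) = fun x => F i x + \sum_(j <- r) F j x); first exact: bexpD.
by apply/funext => x; rewrite big_cons.
Qed.

Let ei (i : 'I_n) : V := delta_mx ord0 i.

Lemma bexp_gradient f : bexp f -> exists2 p, gradient f p & forall i, bexp (p i).
Proof.
elim=> [q j cq|c|w|f1 g1 _ [p1 d1 b1] _ [p2 d2 b2]|f1 g1 bf1 [p1 d1 b1] bg1 [p2 d2 b2]].
- have cd i : continuous (fun th : V => dot (ei i) th * q th) by cts.
  exists (fun i x => 2 * dot (ei i) x * bpf G q j.+1 x +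
      - 2 * bpf G (fun th => dot (ei i) th * q th) j.+1 x); last first.
    move=> i; apply: bexpD; apply: bexpM; [|exact: bexp_bpf|exact: bexp_cst|exact: bexp_bpf].
    by apply: bexpM; [exact: bexp_cst|exact: bexp_dot].
  move=> y v t; apply: dv_eq (dv_bpf sG j y v t cq) _; set x := y + t *: v.
  have -> : bpf G (fun th => dot v th * q th) j.+1 x =
      \sum_i v ord0 i * bpf G (fun th => dot (ei i) th * q th) j.+1 x.
    rewrite -(bpf_sum sG) //; apply: (bpf_ext G) => th _; rewrite /dot mulr_suml.
    apply: eq_bigr => i _; rewrite -/(dot (ei i) th) (dotC (ei i)) dot_delta; ring.
  have -> : dot x v = \sum_i x ord0 i * v ord0 i by [].
  rewrite mulr_sumr mulr_suml mulr_sumr -sumrB; apply: eq_bigr => i _.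
  by rewrite (dotC (ei i)) dot_delta; ring.
- exists (fun _ _ => 0); last by move=> i; exact: bexp_cst.
  by move=> y v t; apply: dv_eq (dvC c t) _; rewrite big1 // => i _; rewrite mulr0.
- exists (fun i _ => w ord0 i); last by move=> i; exact: bexp_cst.
  move=> y v t; under eq_fun do rewrite dotDr dotZr.
  apply: dv_eq (dvD (dvC _ t) (dvM (dvId t) (dvC _ t))) _.
  by rewrite add0r mul1r mulr0 addr0; apply: eq_bigr => i _; rewrite mulrC.
- exists (fun i x => p1 i x + p2 i x); last by move=> i; exact: bexpD.
  move=> y v t; apply: dv_eq (dvD (d1 y v t) (d2 y v t)) _; rewrite -big_split /=.
  by apply: eq_bigr => i _; rewrite mulrDr.
- exists (fun i x => p1 i x * g1 x + f1 x * p2 i x).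
    move=> y v t; apply: dv_eq (dvM (d1 y v t) (d2 y v t)) _.
    by rewrite mulr_suml mulr_sumr -big_split /=; apply: eq_bigr => i _; ring.
  by move=> i; apply: bexpD; exact: bexpM.
Qed.

Lemma bexp_smooth U f : bexp f -> smooth_open U f.
Proof.
apply: (gradient_smooth (C := bexp)); first exact: bexp_continuous.
move=> h /bexp_gradient[p gp bp]; exists p; split => // [i|v]; first exact: bexp_continuous.
by apply: bexp_sum => i; apply: bexpM => //; exact: bexp_cst.
Qed.

End backprojection_expressions.


(** * Comparison of two families and the range theorem *)

Section sfam_combination.
Context {R : realType} (m : nat).
Local Notation n := (2 * m + 3)%N.
Local Notation V := 'rV[R]_n.

Lemma sfam_sub (e e' c : R) (G A : nat -> V -> R -> R) k : sfam e G -> sfam e' A ->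
  sfam (Num.min e e') (fun j x s => G j x s - c * A (k + j)%N x s).
Proof.
move=> [cG dG G0] [cA dA A0]; split.
- move=> j; apply: cfB; first exact: (@cG j).
  by apply: cfM; [exact: cst_continuous|exact: (@cA (k + j)%N)].
- by move=> j x s; apply: dvB; [exact: dG|apply: dvZ; rewrite addnS; exact: dA].
move=> j x s hs; have e1 : Num.min e e' <= e by rewrite ge_min lexx.
have e2 : Num.min e e' <= e' by rewrite ge_min lexx orbT.
by rewrite G0 ?A0 ?mulr0 ?subrr //; case: hs => hs; (left; lra) || (right; lra).
Qed.

Lemma bpf_sub (e e' c : R) (G A : nat -> V -> R -> R) k j x : sfam e G -> sfam e' A ->
  bpf (fun j x s => G j x s - c * A (k + j)%N x s) (fun=> 1) j x =
  bpf G (fun=> 1) j x - c * bpf A (fun=> 1) (k + j) x.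
Proof.
move=> sG sA; have c1 : continuous (fun _ : V => 1 : R) by exact: cst_continuous.
have cG := @cf_bpf_in _ _ _ _ sG _ j x c1; have cA := @cf_bpf_in _ _ _ _ sA _ (k + j) x c1.
rewrite /bpf -SIZ // -SIB //; last by apply: cfM => //; exact: cst_continuous.
by apply: SI_ext => th _; ring.
Qed.

(** For |x| < 1 the distance |x - theta| lies in (0, 2), so only values of g on the cylinder
    occur. *)
Lemma backprojection_bpf (G : nat -> V -> R -> R) (g : V * R -> R) x : enorm x < 1 ->
  (forall th t, cylinder R n (th, t) -> G 0 th (t ^+ 2) = g (th, t)) ->
  backprojection g x = bpf G (fun=> 1) 0 x.
Proof.
move=> x1 Gg; apply: SI_ext => th Sth; rewrite mul1r.
have E : sqd x th = enorm (x - th) ^+ 2 by rewrite sqr_enorm sqd_sphere.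
rewrite E Gg //; split => //=; rewrite in_itv /=.
have h1 := enormD (x - th) (- x); rewrite addrAC subrr add0r !enormN Sth in h1.
have h2 := enormD x (- th); rewrite enormN Sth in h2.
by apply/andP; split; lra.
Qed.

End sfam_combination.

Section range_theorem.
Context {R : realType} (m : nat).
Local Notation n := (2 * m + 3)%N.
Local Notation N := (2 * m + 1)%N.
Local Notation V := 'rV[R]_n.

Lemma range_backprojection0 (g : V * R -> R) (f : V -> R) : Cc_smooth (eball R n) f ->
  (forall th t, cylinder R n (th, t) -> g (th, t) =
     iter (n - 2) (@Dt R) (fun s => s ^+ (n - 2) * spherical_mean f th s) t) ->
  forall x, eball R n x -> backprojection g x = 0.
Proof.
move=> sf gf x x1; have [e [A [_ sA zA _ AE]]] := spherical_mean_family sf.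
(* The factor 2^N undoes the 2^-N in [A N], the s-derivative of order N, so the family starts at g
   itself. *)
rewrite (backprojection_bpf (G := fun j th s => 2 ^+ N * A (N + j)%N th s)) //; last first.
  by move=> th t ht; rewrite addn0 AE // mulVKf ?gf // expf_neq0.
transitivity (2 ^+ N * bpf A (fun=> 1) N x); last by rewrite zA // mulr0.
rewrite -SIZ; last by apply: (cf_bpf_in sA); exact: cst_continuous.
by apply: SI_ext => th _; rewrite addn0; ring.
Qed.

Lemma backprojection0_range (g : V * R -> R) : Cc_smooth (cylinder R n) g ->
  (forall x, eball R n x -> backprojection g x = 0) ->
  exists f : V -> R, Cc_smooth (eball R n) f /\
    forall th t, cylinder R n (th, t) -> g (th, t) =
     iter (n - 2) (@Dt R) (fun s => s ^+ (n - 2) * spherical_mean f th s) t.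
Proof.
move=> /Cc_smooth_cyl[a [u [a01 cu ug]]] P0; have /andP[a0 a1] := a01.
have sG := cyl_fam_sfam a01 cu; pose G := cyl_fam u.
have e0 : 0 < a ^+ 2 / 2 by rewrite divr_gt0 // exprn_gt0.
have GE th t : cylinder R n (th, t) -> G 0%N th (t ^+ 2) = g (th, t).
  move=> ht; rewrite -ug //; case: ht => Sth; rewrite /= in_itv /= => /andP[t0 _].
  by rewrite /G cyl_famE ?ltW // expr0 invr1 mul1r.
have zG : bzero G (fun=> 1) 0 by move=> x x1; rewrite -(backprojection_bpf x1 GE) P0.
have [d d01 dG] := bpf_annulus e0 sG zG.
(* The identity of [mean_bpf] solved for f, with 2^-N F_1 in the place of the mean of A_(N+1). *)
pose f x := 2 ^- N * (2 / rconst m) * (dot x x - 1) * bpf G (fun=> 1) 1 x.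
have sf : Cc_smooth (eball R n) f.
  split.
    move=> x x1; exists (eball R n), f; split => //.
    - have cz : continuous (fun y : V => enorm y) by cts.
      rewrite (_ : eball R n = (fun y => enorm y) @^-1` [set t | t < 1]) //.
      by apply: open_comp; [move=> y _; exact: cz|exact: open_lt].
    - apply: (bexp_smooth sG).
      have bd : bexp G (fun x => dot x x).
        apply: bexp_sum => i.
        have E : (fun x : V => x ord0 i) = fun x => dot (delta_mx ord0 i) x.
          by apply/funext => y; rewrite dotC dot_delta.
        have b : bexp G (fun x : V => x ord0 i) by rewrite E; exact: bexp_dot.
        exact: (bexpM b b).
      apply: bexpM; last by apply: bexp_bpf; exact: cst_continuous.
      apply: bexpM; first exact: bexp_cst.
      by apply: bexpD => //; exact: bexp_cst.
  exists [set y | enorm y <= 1 - d]; split.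
  - exact: compact_cball.
  - by move=> y /=; move: d01 => /andP[? ?]; rewrite /eball /=; lra.
  - move=> x x1 /negP; rewrite -ltNge => xd.
    by rewrite /f dG ?mulr0 //; apply/andP; split.
exists f; split => // th t ht.
have [e' [A [e'0 sA zA FA AE]]] := spherical_mean_family sf.
have sH := sfam_sub (2 ^+ N) N sG sA.
(* G_0 = g is to be matched with 2^N A_N, so the second family is shifted by N. The choice of f is
   what makes the F_1 of the difference vanish. *)
pose H j x s := G j x s - 2 ^+ N * A (N + j)%N x s.
have h0 : 0 < Num.min (a ^+ 2 / 2) e' by rewrite lt_min e0.
have z0 : bzero H (fun=> 1) 0.
  by move=> x x1; rewrite (bpf_sub _ _ _ _ sG sA) zG // addn0 zA // mulr0 subrr.
have z1 : bzero H (fun=> 1) 1.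
  move=> x x1; rewrite (bpf_sub _ _ _ _ sG sA) (addn1 N).
  have x2 : dot x x < 1 by move: x1; rewrite enorm_lt // expr1n.
  have k0 : 2 * (dot x x - 1) != 0 by rewrite mulf_neq0 // lt_eqF // subr_lt0.
  apply: (mulfI k0); rewrite mulr0 mulrBr [X in _ - X]mulrCA FA // /f.
  have r0 := rconst_neq0 (R := R) m; have p0 : (2 : R) ^+ N != 0 by rewrite expf_neq0.
  by move: (2 ^+ N) p0 => p p0; field; rewrite r0 p0.
have [Sth _] := ht.
have := bzero_unique h0 sH z0 z1 (t ^+ 2) Sth; rewrite /= addn0 => /eqP.
by rewrite subr_eq0 -/(G 0%N th _) GE // AE // mulVKf ?expf_neq0 // => /eqP.
Qed.

End range_theorem.

Unset Implicit Arguments.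
Theorem theorem1p2 (R : realType) (n : nat) (hn : (3 <= n)%N) (hodd : odd n)
  (g : 'rV[R]_n * R -> R) (hg : Cc_smooth (cylinder R n) g) :
  (forall x, eball R n x -> backprojection g x = 0) <->
  (exists f : 'rV[R]_n -> R,
     Cc_smooth (eball R n) f /\
     forall theta t, cylinder R n (theta, t) ->
       g (theta, t) =
       iter (n - 2) (@Dt R)
         (fun s => s ^+ (n - 2) * spherical_mean f theta s) t).
Proof.
have [m E] : exists m, n = (2 * m + 3)%N.
  by exists (n - 3)./2; have := odd_double_half n; rewrite hodd; lia.
subst n; split; first exact: backprojection0_range.
by move=> [f [sf gf]]; exact: range_backprojection0 sf gf.
Qed.
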